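(* Let $m=m_n$ and let $m,n\to+\infty$. Assume that $\frac{m}{n}\to\mu\in(0,\infty)$, and that $P^{(n)}\to P$ weakly for a probability measure $P$ on $\mathbb{Z}_+\times[0,1]$, with $P^{(n)}_{rs}\to P_{rs}$ for $rs=10,21$, where $0<P_{rs}<\infty$. Let $f_{2,n}$ be the model bidegree distribution of the superposition random graph $G_n$ and let $\bar f_2$ be the limiting bidegree distribution determined by $\mu$ and $P$. Then $$\rho_{\rm Ken}(f_{2,n})\to\rho_{\rm Ken}(\bar f_2)\qquad\text{and}\qquad\rho_{\rm Spe}(f_{2,n})\to\rho_{\rm Spe}(\bar f_2).$$
   Context: Notation: $\mathbb{Z}_+=\{0,1,2,\dots\}$, $[n]=\{1,\dots,n\}$, $(x)_r=x(x-1)\cdots(x-r+1)$. $\delta_x$ is the Dirac measure at $x$; $\otimes$ is the product of measures and $\ast$ the convolution (here of probability measures on $\mathbb{Z}_+^2$). $\mathrm{Bin}(x,y)(s)=\binom{x}{s}(1-y)^{x-s}y^s$. $\mathrm{Cor}$ is the Pearson correlation. Model: For each $n$, let $m=m_n$ be the number of layers and $P^{(n)}$ a probability measure on $\{0,\dots,n\}\times[0,1]$. The triples $(G_{n,k},X_{n,k},Y_{n,k})$, $k=1,\dots,m$, are mutually independent, where $(X_{n,k},Y_{n,k})$ has distribution $P^{(n)}$ (size and strength of layer $k$, possibly dependent on each other) and $G_{n,k}$ is a random undirected graph with node set contained in $[n]$ such that: given $(X_{n,k},Y_{n,k})$, $V(G_{n,k})$ is uniformly distributed on the subsets of $[n]$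 of size $X_{n,k}$; and given $(V(G_{n,k}),X_{n,k},Y_{n,k})$, each unordered node pair of $V(G_{n,k})$ is linked in $G_{n,k}$ with probability $Y_{n,k}$, independently of other pairs. The superposition graph $G_n$ has $V(G_n)=[n]$ and $E(G_n)=E(G_{n,1})\cup\cdots\cup E(G_{n,m})$. Cross moments: $P^{(n)}_{rs}=\mathbb{E}\big((X_{n,k})_rY_{n,k}^s\big)$ and $P_{rs}=\mathbb{E}\big((X)_rY^s\big)$ with $(X,Y)\sim P$. Model bidegree distribution: $f_{2,n}(s,t)=\mathbb{P}\big(\deg_{G_n}(1)=s,\ \deg_{G_n}(2)=t\mid\{1,2\}\in E(G_n)\big)$. Limiting bidegree distribution: $\bar f_2=\delta_{(1,1)}\ast(\bar f_1\otimes\bar f_1)\ast f_2'$. Here $\bar f_1$ is the law of $\sum_{k=1}^{\Lambda}H_k$, where $\Lambda,H_1,H_2,\dots$ are independent, $\Lambda$ is Poisson with mean $\mu P_{10}$, and each $H_k$ has law $g(s)=\int_{\mathbb{Z}_+\times[0,1]}\mathrm{Bin}(x-1,y)(s)\frac{x\,P(dx,dy)}{P_{10}}$, $s\in\mathbb{Z}_+$; and $$f_2'(s,t)=\int_{\mathbb{Z}_+\times[0,1]}\mathrm{Bin}(x-2,y)(s)\,\mathrm{Bin}(x-2,y)(t)\,\frac{(x)_2\,y\,P(dx,dy)}{P_{21}}.$$ Rank correlations: let $f$ be a probability measure on $\mathbb{R}^2$ with nondegenerate marginals $f^{(1)},f^{(2)}$. Let $(U^{(1)},U^{(2)})$ and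 $(Z^{(1)},Z^{(2)})$ be independent and $f$-distributed. Kendall's rank correlation is $$\rho_{\rm Ken}(f)=\mathrm{Cor}\big(\mathrm{sgn}(U^{(1)}-Z^{(1)}),\ \mathrm{sgn}(U^{(2)}-Z^{(2)})\big),\qquad \mathrm{sgn}(x)=1(x>0)-1(x<0).$$ Spearman's rank correlation is $\rho_{\rm Spe}(f)=\mathrm{Cor}\big(r_1(U^{(1)}),\,r_2(U^{(2)})\big)$, where $r_i(x)=\frac12\big(f^{(i)}((-\infty,x))+f^{(i)}((-\infty,x])\big)$. *)

(* Defs.v *)
From HB Require Import structures.
From mathcomp Require Import all_boot all_order all_algebra finmap.
From mathcomp Require Import all_classical all_reals all_analysis.

Set Implicit Arguments.
Unset Strict Implicit.
Unset Printing Implicit Defensive.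

Import Order.TTheory GRing.Theory Num.Theory.
Import numFieldNormedType.Exports.

Local Open Scope classical_set_scope.
Local Open Scope ring_scope.

Lemma measurable_nat2 (A : set (nat * nat)) : measurable A.
Proof.
apply: countable_measurable; last exact: countableP.
move=> [s t]; rewrite (_ : [set (s, t)] = [set s] `*` [set t]).
  exact: measurableX.
by apply/seteqP; split => -[a b] /= [-> ->].
Qed.

Section independence.
Local Open Scope ereal_scope.

Definition mutually_independent d d' (Omega : measurableType d)
    (T : measurableType d') (R : realType) (Pr : probability Omega R)
    (I : choiceType) (X : I -> {mfun Omega >-> T}) : Prop :=
  forall (J : {fset I}) (B : I -> set T), (forall i, measurable (B i)) ->
    Pr (\bigcap_(i in [set` J]) (X i @^-1` B i)) =
    \prod_(i <- J) Pr (X i @^-1` B i).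

End independence.

(* Graphs with node set contained in [n]; the ordinal i represents node i+1. *)
Section graphs.
Variable n : nat.

Definition node_pairs (V : {set 'I_n}) : {set {set 'I_n}} :=
  [set e : {set 'I_n} | (e \subset V) && (#|e| == 2)]%SET.

Definition lgraph : Type :=
  {g : {set 'I_n} * {set {set 'I_n}} | g.2 \subset node_pairs g.1}.

HB.instance Definition _ := Finite.on lgraph.

Definition nodes (g : lgraph) : {set 'I_n} := (val g).1.
Definition edges (g : lgraph) : {set {set 'I_n}} := (val g).2.

Definition linked (E : {set {set 'I_n}}) (i j : nat) : bool :=
  [exists u : 'I_n, exists v : 'I_n,
    [&& u.+1 == i, v.+1 == j & [set u; v]%SET \in E]].

Definition degree (E : {set {set 'I_n}}) (i : nat) : nat :=
  #|[set v : 'I_n | linked E i v.+1]%SET|.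

Let empty_graph_subproof :
  ((finset.set0, finset.set0) : {set 'I_n} * {set {set 'I_n}}).2 \subset node_pairs finset.set0.
Proof. exact: finset.sub0set. Qed.

HB.instance Definition _ :=
  isPointed.Build lgraph (exist _ (_, _) empty_graph_subproof).

HB.instance Definition _ := @isMeasurable.Build default_measure_display
  lgraph discrete_measurable discrete_measurable0
  discrete_measurableC discrete_measurableU.

End graphs.

(* A probability measure on Z_+ x [0,1] is encoded as a probability on
   [nat * R] that gives full mass to [strip]. *)
Section layer_types.
Variable R : realType.
Local Open Scope ereal_scope.

Definition strip : set (nat * R) := [set z | (0 <= z.2 <= 1)%R].

Definition strip_upto (n : nat) : set (nat * R) :=
  [set z | (z.1 <= n)%N /\ (0 <= z.2 <= 1)%R].

Definition weakly_converges (Pn : nat -> probability (nat * R)%type R)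
    (P : probability (nat * R)%type R) : Prop :=
  forall f : nat * R -> R, {within strip, continuous f} ->
    (exists M : R, forall z, strip z -> (`|f z| <= M)%R) ->
    \int[Pn n]_(z in strip) (f z)%:E @[n --> \oo]
      --> \int[P]_(z in strip) (f z)%:E.

Definition cross_moment (P : probability (nat * R)%type R) (r s : nat)
  : \bar R := \int[P]_(z in strip) ((z.1 ^_ r)%:R * z.2 ^+ s)%:E.

End layer_types.
Arguments strip {R}.
Arguments strip_upto {R} n.

Section superposition.
Variables (R : realType) (n m : nat) (d : measure_display).
Variables (Omega : measurableType d) (Pr : probability Omega R).

Section layer.
Variable L : {mfun Omega >-> (nat * R * lgraph n)%type}.

Definition lsize (w : Omega) : nat := (L w).1.1.
Definition lstrength (w : Omega) : R := (L w).1.2.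
Definition lnodes (w : Omega) : {set 'I_n} := nodes (L w).2.
Definition ledges (w : Omega) : {set {set 'I_n}} := edges (L w).2.

Local Open Scope ereal_scope.

Definition size_strength_law (P : probability (nat * R)%type R) : Prop :=
  forall B, measurable B -> Pr [set w | B (L w).1] = P B.

(* The next two predicates are the disintegrations expressing the conditional
   law of the node set given (X, Y), and of the edge set given the node set
   and (X, Y). *)
Definition uniform_node_set : Prop :=
  forall B (V : {set 'I_n}), measurable B ->
    Pr [set w | B (L w).1 /\ lnodes w = V] =
    \int[Pr]_(w in [set w | B (L w).1])
      (if #|V| == lsize w then 'C(n, lsize w)%:R^-1 else 0)%:E.

Definition bernoulli_edges : Prop :=
  forall B (V : {set 'I_n}) (E : {set {set 'I_n}}),
    measurable B -> E \subset node_pairs V ->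
    Pr [set w | [/\ B (L w).1, lnodes w = V & ledges w = E]] =
    \int[Pr]_(w in [set w | B (L w).1 /\ lnodes w = V])
      (\prod_(e in node_pairs V)
         (if e \in E then lstrength w else 1 - lstrength w))%:E.

End layer.

Variable L : 'I_m -> {mfun Omega >-> (nat * R * lgraph n)%type}.

Record layer_model (P : probability (nat * R)%type R) : Prop := LayerModel {
  layers_independent : mutually_independent Pr L ;
  layer_size_strength : forall k, size_strength_law (L k) P ;
  layer_nodes : forall k, uniform_node_set (L k) ;
  layer_edges : forall k, bernoulli_edges (L k) }.

Definition superposition (w : Omega) : {set {set 'I_n}} :=
  (\bigcup_(k < m) ledges (L k) w)%SET.

Definition bidegree (w : Omega) : nat * nat :=
  (degree (superposition w) 1, degree (superposition w) 2).

Definition linked12 : set Omega := [set w | linked (superposition w) 1 2].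

Lemma measurable_superposition (A : set {set {set 'I_n}}) :
  measurable [set w | A (superposition w)].
Proof.
pose F (f : {ffun 'I_m -> lgraph n}) : set Omega :=
  \bigcap_(k in [set: 'I_m]) (L k @^-1` ([set: nat * R] `*` [set f k])).
pose U (f : {ffun 'I_m -> lgraph n}) := (\bigcup_(k < m) edges (f k))%SET.
rewrite (_ : [set w | _] = \bigcup_f (if `[< A (U f) >] then F f else set0)).
  apply: countable_bigcupT_measurable => [|f]; first exact: countableP.
  case: ifPn => // _; apply: fin_bigcap_measurable => [|k _].
    exact: finite_finset.
  rewrite -[X in measurable X]setTI; apply: measurable_funPT => //.
  exact: measurableX.
apply/seteqP; split => w /=.
  move=> Aw; exists [ffun k => (L k w).2] => //.
  have UE : U [ffun k => (L k w).2] = superposition w.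
    by apply: eq_bigr => k _; rewrite ffunE.
  rewrite UE (asboolT Aw) => k _ /=; split => //=; by rewrite ffunE.
move=> [f _]; case: ifPn => // /asboolP AU Ff.
suff -> : superposition w = U f by [].
by apply: eq_bigr => k _; have [_ /= <-] := Ff k Logic.I.
Qed.

Lemma measurable_linked12 : measurable linked12.
Proof. exact: (measurable_superposition [set E | linked E 1 2]). Qed.

Lemma measurable_bidegree : measurable_fun [set: Omega] bidegree.
Proof.
move=> _ B _; rewrite setTI.
exact: (measurable_superposition [set E | B (degree E 1, degree E 2)]).
Qed.

HB.instance Definition _ :=
  isMeasurableFun.Build _ _ _ _ bidegree measurable_bidegree.

(* [mnormalize (mrestr Pr _) Pr] is the conditional probability given the
   event {1,2} in E(G); it falls back on [Pr] when that event is null. *)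
Definition model_bidegree : probability (nat * nat)%type R :=
  distribution (mnormalize (mrestr Pr measurable_linked12) Pr) bidegree.

End superposition.

Section limit_law.
Variables (R : realType) (mu : R) (P : probability (nat * R)%type R).
Local Open Scope ereal_scope.

Let P10 : R := fine (cross_moment P 1 0).
Let P21 : R := fine (cross_moment P 2 1).

(* The weights x and (x)_2 vanish where the subtractions truncate. *)
Definition summand_pmf (s : nat) : \bar R :=
  \int[P]_(z in strip) (binomial_pmf (z.1 - 1) z.2 s * (z.1%:R / P10))%:E.

Definition joint_pmf (st : nat * nat) : \bar R :=
  \int[P]_(z in strip)
    (binomial_pmf (z.1 - 2) z.2 st.1 * binomial_pmf (z.1 - 2) z.2 st.2
     * ((z.1 ^_ 2)%:R * z.2 / P21))%:E.

Definition joint_measure (U : set (nat * nat)) : \bar R :=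
  \esum_(st in U) joint_pmf st.

Lemma joint_pmf_ge0 st : 0 <= joint_pmf st.
Proof.
apply: integral_ge0 => z; rewrite /strip /= => z01; have /andP[z0 _] := z01.
rewrite lee_fin mulr_ge0 ?mulr_ge0 ?binomial_pmf_ge0// invr_ge0 fine_ge0//.
apply: integral_ge0 => y /= /andP[y0 _].
by rewrite lee_fin mulr_ge0// exprn_ge0.
Qed.

Let joint_measure0 : joint_measure set0 = 0.
Proof. exact: esum_set0. Qed.

Let joint_measure_ge0 U : 0 <= joint_measure U.
Proof. by apply: esum_ge0 => st _; exact: joint_pmf_ge0. Qed.

Let joint_measure_sigma_additive : semi_sigma_additive joint_measure.
Proof.
move=> F mF tF mUF; apply: cvg_toP.
  apply: ereal_nondecreasing_is_cvgn => a b ab.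
  by apply: lee_sum_nneg_natr => // n _ _; exact: joint_measure_ge0.
by rewrite /joint_measure nneseries_sum_bigcup// => i; exact: joint_pmf_ge0.
Qed.

HB.instance Definition _ := isMeasure.Build _ _ _ joint_measure
  joint_measure0 joint_measure_ge0 joint_measure_sigma_additive.

(* The total mass is already 1 when 0 < P21 < +oo and P is carried by [strip];
   the normalization only makes the definition total. *)
Definition joint_law : probability (nat * nat)%type R :=
  mnormalize joint_measure (dirac (0%N, 0%N)).

Section random_sum.
Variables (d : measure_display) (Omega : measurableType d).
Variables (Q : probability Omega R).
Variables (Lambda : {mfun Omega >-> nat}) (H : nat -> {mfun Omega >-> nat}).

Record random_sum_model : Prop := RandomSumModel {
  counts_independent : mutually_independent Q
    (fun i : option nat => if i is Some k then H k else Lambda) ;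
  count_law : forall l,
    Q (Lambda @^-1` [set l]) = (poisson_pmf (mu * P10) l)%:E ;
  summand_law : forall k s, Q (H k @^-1` [set s]) = summand_pmf s }.

Definition random_sum (w : Omega) : nat := (\sum_(k < Lambda w) H k w)%N.

Lemma measurable_random_sum : measurable_fun [set: Omega] random_sum.
Proof.
have mS l : measurable_fun [set: Omega] (fun w => \sum_(k < l) H k w)%N.
  elim: l => [|l IHl].
    by under eq_fun do rewrite big_ord0; exact: measurable_cst.
  under eq_fun do rewrite big_ord_recr/=.
  have mD : measurable_fun [set: nat * nat] (fun st => st.1 + st.2)%N.
    by move=> _ A _; exact: measurable_nat2.
  have mH : measurable_fun [set: Omega] (H l) by [].
  exact: (measurableT_comp mD (measurable_fun_pair IHl mH)).
move=> _ B mB; rewrite setTI.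
rewrite (_ : _ @^-1` _ = \bigcup_l ((Lambda @^-1` [set l]) `&`
    ([set: Omega] `&` (fun w => \sum_(k < l) H k w)%N @^-1` B))).
  apply: bigcup_measurable => l _; apply: measurableI; last exact: mS.
  exact: measurable_funPTI.
apply/seteqP; split => w /=; first by exists (Lambda w).
by move=> [l _ /= [<- []]].
Qed.

HB.instance Definition _ :=
  isMeasurableFun.Build _ _ _ _ random_sum measurable_random_sum.

Definition random_sum_law : probability nat R := distribution Q random_sum.

End random_sum.
End limit_law.

Section convolution.
Variable R : realType.

Definition add_pair (z : (nat * nat) * (nat * nat)) : nat * nat :=
  (z.1.1 + z.2.1, z.1.2 + z.2.2)%N.

Lemma measurable_add_pair :
  measurable_fun [set: (nat * nat) * (nat * nat)] add_pair.
Proof.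
move=> _ B _; rewrite setTI; apply: countable_measurable => [[z z']|].
  rewrite (_ : [set _] = [set z] `*` [set z']).
    by apply: measurableX; exact: measurable_nat2.
  by apply/seteqP; split => -[a b] /= [-> ->].
exact: countableP.
Qed.

HB.instance Definition _ :=
  isMeasurableFun.Build _ _ _ _ add_pair measurable_add_pair.

Definition convolution (f g : probability (nat * nat)%type R)
  : probability (nat * nat)%type R := distribution (f \x g)%E add_pair.

Definition limit_bidegree (P : probability (nat * R)%type R)
    d (Omega : measurableType d) (Q : probability Omega R)
    (Lambda : {mfun Omega >-> nat}) (H : nat -> {mfun Omega >-> nat})
  : probability (nat * nat)%type R :=
  let f1 := random_sum_law Q Lambda H in
  convolution (convolution (dirac (1%N, 1%N)) (f1 \x f1)%E) (joint_law P).

End convolution.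

Section rank_correlations.
Variable R : realType.

(* Pearson correlation; it is 0 by convention when a variance vanishes. *)
Definition correlation d (T : measurableType d) (Pr : probability T R)
    (X Y : T -> R) : R :=
  fine (covariance Pr X Y)
  / (Num.sqrt (fine 'V_Pr[X]) * Num.sqrt (fine 'V_Pr[Y])).

Variable f : probability (R * R)%type R.

Definition kendall : R :=
  correlation (f \x f)%E
    (fun uz : (R * R) * (R * R) => Num.sg (uz.1.1 - uz.2.1))
    (fun uz : (R * R) * (R * R) => Num.sg (uz.1.2 - uz.2.2)).

Definition midrank (m : set R -> \bar R) (x : R) : R :=
  (fine (m `]-oo, x[%classic) + fine (m `]-oo, x]%classic)) / 2.

Definition spearman : R :=
  correlation f
    (fun u : R * R => midrank (pushforward f fst) u.1)
    (fun u : R * R => midrank (pushforward f snd) u.2).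

End rank_correlations.

Section embedding.
Variable R : realType.

Definition real_pair (st : nat * nat) : R * R := (st.1%:R, st.2%:R).

Lemma measurable_real_pair : measurable_fun [set: nat * nat] real_pair.
Proof. by move=> _ B _; rewrite setTI; exact: measurable_nat2. Qed.

HB.instance Definition _ :=
  isMeasurableFun.Build _ _ _ _ real_pair measurable_real_pair.

Definition real_law (f : probability (nat * nat)%type R)
  : probability (R * R)%type R := distribution f real_pair.

End embedding.

(* Main.v *)
Require Import Defs.
From HB Require Import structures.
From mathcomp Require Import all_boot all_order all_algebra finmap.
From mathcomp Require Import all_classical all_reals all_analysis.
From mathcomp Require Import measurable_realfun ring lra.
Set Implicit Arguments.
Unset Strict Implicit.
Unset Printing Implicit Defensive.
Import Order.TTheory GRing.Theory Num.Theory.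
Import numFieldNormedType.Exports.
Local Open Scope ring_scope.

(* For nodes u, v, the power [a ^+ deg u] is the probability that a random set
   containing each node independently with probability [1 - a] misses the
   neighbours of u. Given such random sets for u and for v, the independence of
   the layers turns the generating function of the bidegree on the event that u
   and v are linked into the mean of [q ^+ m - (q - w) ^+ m], where [q] is the
   probability that one layer avoids both sets and [w] the probability that it
   moreover links u and v. Since E X_n^2 = o(n), the dependence of q on the random
   sets is negligible, and only the mean of w matters; after normalization the
   limit is the generating function of the limiting bidegree distribution, a
   compound Poisson factor times an edge-biased one. Hence the point masses converge, and so do
   the expectations of bounded functions, of which both correlations are
   continuous functions as long as the limiting variances are positive. They are
   because the limit law charges two points that differ in both coordinates. *)

(** * Approximation of the generating function of a superposition *)

(** A degree is the size of a union of neighbourhoods, and a power of that size does not factor over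
    the layers; missing a fixed set does, whence the random sets. One layer links a given pair with
    probability of order [n ^- 2], and there are of order [n] layers, so the linking event has
    probability of order [1 / n]. An approximation is therefore useful only with an error
    [o(1 / n)]: every bound carries the factor [m w], or rather its maximum over the random sets,
    and what multiplies it need only tend to 0. There the fluctuation of [q] counts for
    [m * sqrt (n * n ^- 4)], of order [n ^- (1/2)], and the layers that contain both nodes for
    [m * E (X)_2 / (n)_2]. This last term is where a second moment of the size enters, although only
    [P10] and [P21] are assumed to converge; the bound [X_n <= n] and the uniform integrability of
    [X_n] make up for it. *)

Section thinning.
Variables (R : realType) (I : finType).

(* The law of the random subset containing each point independently with
   probability [1 - a]; it misses [N] with probability [a ^+ #|N|]. *)
Definition thin (a : R) (S : {set I}) : R :=
  \prod_v (if v \in S then 1 - a else a).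

Lemma thin_ge0 a S : 0 <= a <= 1 -> 0 <= thin a S.
Proof.
move=> /andP[a0 a1]; apply: prodr_ge0 => v _.
by case: ifP => // _; rewrite subr_ge0.
Qed.

Lemma sum_thin_disjoint a (N : {set I}) :
  \sum_(S : {set I}) thin a S * [disjoint N & S]%:R = a ^+ #|N|.
Proof.
transitivity (\prod_v ((if v \in N then 0 else 1 - a) + a)).
  rewrite bigA_distr; apply: eq_bigr => S _; rewrite /thin.
  have [NS|/pred0Pn[v /andP[/= vN vS]]] := boolP [disjoint N & S].
    rewrite mulr1; apply: eq_bigr => v _; case: ifP => // vS; case: ifP => // vN.
    by rewrite (disjointFr NS vN) in vS.
  by rewrite mulr0 (bigD1 v)//= vS vN mul0r.
rewrite (bigID [in N])/= [X in _ * X]big1 ?mulr1.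
  by rewrite (eq_bigr (fun=> a)) ?prodr_const// => v ->; rewrite add0r.
by move=> v /negbTE ->; rewrite subrK.
Qed.

Lemma sum_thin a : \sum_(S : {set I}) thin a S = 1.
Proof.
rewrite -[RHS](expr0 a) -(cards0 I) -sum_thin_disjoint.
apply: eq_bigr => S _; suff -> : [disjoint finset.set0 & S] by rewrite mulr1.
by apply/pred0P => v /=; rewrite inE.
Qed.

End thinning.

Lemma prod_natr_bool (R : comPzRingType) (I : finType) (P : pred I) :
  \prod_i (P i)%:R = [forall i, P i]%:R :> R.
Proof.
have [/forallP P1|/forallPn[i Pi]] := boolP [forall i, P i].
  by rewrite big1// => i _; rewrite P1.
by rewrite (bigD1 i)//= (negbTE Pi) mul0r.
Qed.

Lemma disjoint_bigcup (I K : finType) (N : K -> {set I}) (S : {set I}) :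
  [disjoint (\bigcup_k N k)%SET & S] = [forall k, [disjoint N k & S]].
Proof.
apply/idP/forallP => [NS k|NS].
  by apply: disjointWl NS; exact: finset.bigcup_sup.
rewrite finset.disjoints_subset; apply/finset.bigcupsP => k _.
by rewrite -finset.disjoints_subset.
Qed.

(** * Elementary inequalities for powers and exponentials *)

Section scalar_bounds.
Variable R : realType.
Implicit Types (q w x y z : R) (k m : nat).

Lemma ler_norm_subX x y k : 0 <= x <= 1 -> 0 <= y <= 1 ->
  `|x ^+ k - y ^+ k| <= k%:R * `|x - y|.
Proof.
move=> /andP[x0 x1] /andP[y0 y1]; rewrite subrXX normrM mulrC ler_wpM2r//.
apply: le_trans (ler_norm_sum _ _ _) _.
rewrite -[leRHS]mul1r mulr_natr -[X in _ <= _ *+ X]card_ord -sumr_const.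
apply: ler_sum => i _; rewrite normrM !normrX !ger0_norm//.
by rewrite mulr_ile1 ?exprn_ge0// exprn_ile1.
Qed.

(** [exp x >= 1 + x] gives [exp (- x) <= 1 / (1 + x)], which is at most [1 - x + x ^ 2] because
    [(1 + x) (1 - x + x ^ 2) = 1 + x ^ 3]. *)
Lemma norm_expR_sub1 x : 0 <= x <= 1 -> `|1 - x - expR (- x)| <= x ^+ 2.
Proof.
move=> /andP[x0 x1]; have := expR_ge1Dx (- x); have := expR_ge1Dx x.
have : expR (- x) * expR x = 1 by rewrite -expRD addNr expR0.
have := expR_gt0 (- x); have := expR_gt0 x.
move: (expR x) (expR (- x)) => e f e0 f0 fe eg fg.
have -> : `|1 - x - f| = f - (1 - x).
  by rewrite distrC ger0_norm// subr_ge0.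
have : f * (1 + x) <= 1 by rewrite -[leRHS]fe ler_wpM2l// ltW.
have x3 : 0 <= x ^+ 3 by rewrite exprn_ge0.
move=> fx; have : (1 + x) * f <= (1 + x) * (1 - x + x ^+ 2).
  by apply: (@le_trans _ _ 1); [rewrite mulrC|nra].
by rewrite ler_pM2l; lra.
Qed.

Lemma norm_expRN_sub x y : 0 <= x -> 0 <= y ->
  `|expR (- x) - expR (- y)| <= `|x - y|.
Proof.
wlog xy : x y / x <= y => [hw x0 y0|x0 _].
  have [xy|/ltW yx] := leP x y; first exact: hw.
  by rewrite distrC [leRHS]distrC; exact: hw.
have -> : expR (- x) - expR (- y) = expR (- x) * (1 - expR (- (y - x))).
  by rewrite mulrBr mulr1 -expRD; congr (_ - expR _); ring.
rewrite [leRHS]distrC normrM (ger0_norm (expR_ge0 _)) !ger0_norm; last first.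
- by rewrite subr_ge0 -expR0 ler_expR; lra.
- by rewrite subr_ge0.
apply: (@le_trans _ _ (1 * (y - x))); last by rewrite mul1r.
apply: ler_pM; rewrite ?expR_ge0//.
- by rewrite subr_ge0 -expR0 ler_expR; lra.
- by rewrite -expR0 ler_expR; lra.
- by have := expR_ge1Dx (- (y - x)); lra.
Qed.

(** A first-order expansion in [w]. From one exponent to the next the remainder is multiplied by
    [q <= 1] and gains [w] times an increment of at most [k.+1 * w]; the constants fit since
    [K ^ 2 + K <= (K + 1) ^ 2]. *)
Lemma subX_linear q w k : 0 <= w <= q -> q <= 1 ->
  `|q ^+ k.+1 - (q - w) ^+ k.+1 - k.+1%:R * (w * q ^+ k)|
  <= (k.+1%:R * w) ^+ 2.
Proof.
move=> /andP[w0 wq] q1; have q0 : 0 <= q by lra.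
elim: k => [|k IH].
  rewrite expr0 !expr1 mulr1 mul1r (_ : q - (q - w) - w = 0); last by ring.
  by rewrite normr0 sqr_ge0.
have -> : q ^+ k.+2 - (q - w) ^+ k.+2 - k.+2%:R * (w * q ^+ k.+1) =
    q * (q ^+ k.+1 - (q - w) ^+ k.+1 - k.+1%:R * (w * q ^+ k)) -
    w * (q ^+ k.+1 - (q - w) ^+ k.+1).
  by rewrite !exprS -(natr1 k.+1); ring.
apply: le_trans (ler_normB _ _) _; rewrite !normrM !(ger0_norm w0) (ger0_norm q0).
have h2 : `|q ^+ k.+1 - (q - w) ^+ k.+1| <= k.+1%:R * w.
  have := @ler_norm_subX q (q - w) k.+1.
  by rewrite (_ : q - (q - w) = w) ?(ger0_norm w0); [apply; lra|ring].
have h1 : q * `|q ^+ k.+1 - (q - w) ^+ k.+1 - k.+1%:R * (w * q ^+ k)| <=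
    (k.+1%:R * w) ^+ 2.
  by apply: le_trans IH; rewrite ler_piMl.
have h3 : w * `|q ^+ k.+1 - (q - w) ^+ k.+1| <= w * (k.+1%:R * w).
  by rewrite ler_wpM2l.
apply: le_trans (lerD h1 h3) _; rewrite -(natr1 k.+1).
have k0 : 0 <= k.+1%:R :> R by [].
by move: (k.+1%:R : R) k0 => K K0; nra.
Qed.

(* [q - w] and [q] are the probabilities that one layer misses given sets,
   with and without the requirement that it does not link the pair. *)
Lemma subX_poisson q w m (B lam del : R) : 0 <= w <= q -> 0 <= 1 - q <= B ->
  0 <= lam -> `|1 - q - lam| <= del ->
  `|q ^+ m - (q - w) ^+ m - m%:R * w * expR (- (m%:R * lam))| <=
  m%:R * w * (m%:R * w + B + m%:R * B ^+ 2 + m%:R * del).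
Proof.
move=> wq /andP[q1 qB] lam0 qdel; have /andP[w0 wq'] := wq.
have q01 : 0 <= q <= 1 by lra.
case: m => [|k]; first by rewrite !expr0 !mul0r !subrr normr0.
set m := k.+1; have m0 : 0 <= m%:R :> R by [].
have -> : q ^+ m - (q - w) ^+ m - m%:R * w * expR (- (m%:R * lam)) =
   (q ^+ m - (q - w) ^+ m - m%:R * (w * q ^+ k)) +
   m%:R * w * (q ^+ k - expR (- (m%:R * lam))) by ring.
apply: le_trans (ler_normD _ _) _.
rewrite [leRHS](_ : _ = (m%:R * w) ^+ 2 +
  m%:R * w * (B + (m%:R * B ^+ 2 + m%:R * del))); last by ring.
apply: lerD; first by apply: subX_linear; lra.
rewrite normrM ger0_norm ?mulr_ge0// ler_wpM2l ?mulr_ge0//.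
(* Three replacements: the exponent [k] by [m] costs [B], the base [q] by [exp (- (1 - q))] costs
   [m B ^ 2], and [1 - q] by [lam] costs [m del]. *)
have -> : q ^+ k - expR (- (m%:R * lam)) = (q ^+ k - q ^+ m) +
   ((q ^+ m - expR (- (1 - q)) ^+ m) +
   (expR (- (m%:R * (1 - q))) - expR (- (m%:R * lam)))).
  by rewrite -expRM_natl mulrN; ring.
apply: le_trans (ler_normD _ _) _; apply: lerD.
  have -> : q ^+ k - q ^+ m = q ^+ k * (1 - q) by rewrite /m exprS; ring.
  rewrite ger0_norm ?mulr_ge0 ?exprn_ge0//; try lra.
  apply: le_trans qB; rewrite ler_piMl// exprn_ile1//; lra.
apply: le_trans (ler_normD _ _) _; apply: lerD.
  apply: le_trans (ler_norm_subX _ _ _) _ => //.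
    by rewrite expR_ge0 -[X in _ <= X]expR0 ler_expR; lra.
  rewrite ler_wpM2l//; have := @norm_expR_sub1 (1 - q).
  rewrite (_ : 1 - (1 - q) = q); last by ring.
  move=> h; apply: (le_trans (h _)); first lra.
  by rewrite ler_pXn2r// nnegrE; lra.
apply: le_trans (norm_expRN_sub _ _) _; rewrite ?mulr_ge0//.
by rewrite -mulrBr normrM ger0_norm// ler_wpM2l.
Qed.

(* Jensen's inequality for the square, in a form without integrals. *)
Lemma weighted_norm_le_sqrt (K : finType) (c x : K -> R) (v : R) :
  (forall i, 0 <= c i) -> \sum_i c i = 1 ->
  \sum_i c i * x i ^+ 2 <= v -> \sum_i c i * `|x i| <= Num.sqrt v.
Proof.
move=> c0 c1 xv; set t := \sum_i c i * `|x i|.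
have t0 : 0 <= t by apply: sumr_ge0 => i _; rewrite mulr_ge0.
rewrite -(ger0_norm t0) -sqrtr_sqr ler_wsqrtr//; apply: le_trans xv.
rewrite -subr_ge0.
(* The difference is the variance of [|x|] under the weights [c]. *)
suff -> : \sum_i c i * x i ^+ 2 - t ^+ 2 = \sum_i c i * (`|x i| - t) ^+ 2.
  by apply: sumr_ge0 => i _; rewrite mulr_ge0// sqr_ge0.
transitivity (\sum_i (c i * x i ^+ 2 - 2 * t * (c i * `|x i|) + t ^+ 2 * c i)).
  by rewrite big_split/= sumrB -!mulr_sumr c1 -/t; ring.
apply: eq_bigr => i _; rewrite -[x i ^+ 2]real_normK ?num_real//; ring.
Qed.

End scalar_bounds.

(** * Generating function of a union of independent layers *)

Section superposed_layers.
Variables (R : realType) (I T : finType) (m : nat).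
Variables (p : T -> R) (N1 N2 : T -> {set I}) (J : pred T).

Definition mean (F : T -> R) : R := \sum_g p g * F g.

(** [p] is the law of one layer on its finite set [T] of outcomes, [N1] and [N2] are the
    neighbourhoods that it gives to the two nodes, and [J] says that it links them. The sum is an
    expectation over [m] independent layers. *)
Definition superposed_mean (a b : R) : R :=
  \sum_(G : {ffun 'I_m -> T}) (\prod_k p (G k)) *
    (a ^+ #|(\bigcup_k N1 (G k))%SET| * b ^+ #|(\bigcup_k N2 (G k))%SET|
     * [exists k, J (G k)]%:R).

Definition avoids (S S' : {set I}) (g : T) : bool :=
  [disjoint N1 g & S] && [disjoint N2 g & S'].

(** This is the [q] of the overview, and [avoid_link] is its [w]. *)
Definition avoid (S S' : {set I}) : R := mean (fun g => (avoids S S' g)%:R).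

Definition avoid_link (S S' : {set I}) : R :=
  mean (fun g => (avoids S S' g && J g)%:R).

(** For fixed [S] and [S'], that all layers avoid them, and that all layers avoid them without any
    link, are intersections of independent events on single layers, of probabilities [q ^ m] and
    [(q - w) ^ m]. The difference is the event that all layers avoid and some layer links. *)
Lemma superposed_mean_thin a b :
  superposed_mean a b =
  \sum_(S : {set I}) \sum_(S' : {set I}) thin a S * thin b S' *
    (avoid S S' ^+ m - (avoid S S' - avoid_link S S') ^+ m).
Proof.
have avE (S S' : {set I}) :
    \sum_(G : {ffun 'I_m -> T}) (\prod_k p (G k)) *
      ([disjoint (\bigcup_k N1 (G k))%SET & S]%:R *
       [disjoint (\bigcup_k N2 (G k))%SET & S']%:R * [exists k, J (G k)]%:R)
    = avoid S S' ^+ m - (avoid S S' - avoid_link S S') ^+ m.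
  have -> : avoid S S' - avoid_link S S'
      = mean (fun g => (avoids S S' g && ~~ J g)%:R).
    rewrite /avoid /avoid_link /mean -sumrB; apply: eq_bigr => g _.
    by case: avoids; case: (J g); rewrite /= ?mulr0 ?mulr1 ?subr0 ?subrr.
  rewrite /avoid /mean.
  have expE (F : T -> R) : (\sum_g F g) ^+ m =
      \sum_(G : {ffun 'I_m -> T}) \prod_k F (G k).
    by rewrite -(bigA_distr_bigA (fun (_ : 'I_m) g => F g)) prodr_const card_ord.
  rewrite !expE -sumrB; apply: eq_bigr => G _; rewrite !big_split/= -mulrBr.
  congr (_ * _); rewrite !disjoint_bigcup !prod_natr_bool -natrM mulnb.
  have -> : [forall k, [disjoint N1 (G k) & S]] &&
    [forall k, [disjoint N2 (G k) & S']] = [forall k, avoids S S' (G k)].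
    apply/andP/forallP => [[/forallP h1 /forallP h2] k|h].
      by rewrite /avoids h1 h2.
    by split; apply/forallP => k; have /andP[] := h k.
  have -> : [forall k, avoids S S' (G k) && ~~ J (G k)] =
    [forall k, avoids S S' (G k)] && ~~ [exists k, J (G k)].
    apply/forallP/andP => [h|[/forallP h /existsPn h'] k]; last by rewrite h h'.
    split; first by apply/forallP => k; have /andP[] := h k.
    by apply/existsPn => k; have /andP[] := h k.
  by case: [forall k, _]; case: [exists k, _];
    rewrite /= ?mulr0 ?mulr1 ?subr0 ?subrr.
under [RHS]eq_bigr => S _ do under eq_bigr => S' _ do
  rewrite -avE mulr_sumr.
under [RHS]eq_bigr => S _ do rewrite exchange_big.
rewrite exchange_big/=; apply: eq_bigr => G _.
rewrite -!sum_thin_disjoint big_distrl/= big_distrl/= mulr_sumr.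
apply: eq_bigr => S _; rewrite mulr_sumr mulr_suml mulr_sumr.
by apply: eq_bigr => S' _; ring.
Qed.

Hypotheses (p_ge0 : forall g, 0 <= p g) (p_sum1 : \sum_g p g = 1).

Lemma le_mean F F' : (forall g, F g <= F' g) -> mean F <= mean F'.
Proof. by move=> FF'; apply: ler_sum => g _; rewrite ler_wpM2l. Qed.

Lemma mean_ge0 F : (forall g, 0 <= F g) -> 0 <= mean F.
Proof. by move=> F0; apply: sumr_ge0 => g _; rewrite mulr_ge0. Qed.

Lemma mean_cst c : mean (fun=> c) = c.
Proof. by rewrite /mean -mulr_suml p_sum1 mul1r. Qed.

Lemma meanD F F' : mean (fun g => F g + F' g) = mean F + mean F'.
Proof. by rewrite /mean -big_split; apply: eq_bigr => g _; rewrite mulrDr. Qed.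

Lemma meanB F F' : mean (fun g => F g - F' g) = mean F - mean F'.
Proof. by rewrite /mean -sumrB; apply: eq_bigr => g _; rewrite mulrBr. Qed.

Lemma eq_mean F F' : F =1 F' -> mean F = mean F'.
Proof. by move=> FF'; apply: eq_bigr => g _; rewrite FF'. Qed.

(* The chance that two independent layers have overlapping neighbourhoods
   controls the fluctuations of a one-layer avoidance probability. *)
Lemma thin_fluctuation (N : T -> {set I}) (a : R) : 0 <= a <= 1 ->
  \sum_(S : {set I}) thin a S *
     `|mean (fun g => [disjoint N g & S]%:R) - mean (fun g => a ^+ #|N g|)|
  <= Num.sqrt (\sum_v mean (fun g => (v \in N g)%:R) ^+ 2).
Proof.
move=> a01; have /andP[a0 a1] := a01.
apply: weighted_norm_le_sqrt => [S||]; [exact: thin_ge0|exact: sum_thin|].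
set c := mean (fun g => a ^+ #|N g|).
have cE : \sum_(S : {set I}) thin a S * mean (fun g => [disjoint N g & S]%:R) = c.
  rewrite /c /mean; under eq_bigr do rewrite mulr_sumr.
  rewrite exchange_big; apply: eq_bigr => g _; rewrite -sum_thin_disjoint mulr_sumr.
  by apply: eq_bigr => S _; rewrite mulrCA.
have sqE (F F' : T -> R) :
    mean F * mean F' = mean (fun g => mean (fun g' => F g * F' g')).
  rewrite /mean mulr_suml; apply: eq_bigr => g _.
  by rewrite mulr_sumr mulr_sumr; apply: eq_bigr => g' _; ring.
(* A product of two means is a mean over two independent copies, and both copies miss [S] exactly
   when their union does. *)
have c2E : \sum_(S : {set I}) thin a S *
    mean (fun g => [disjoint N g & S]%:R) ^+ 2 =
    mean (fun g => mean (fun g' => a ^+ #|(N g :|: N g')%SET|)).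
  under eq_bigr do rewrite expr2 sqE.
  rewrite /mean; under eq_bigr do rewrite mulr_sumr.
  rewrite exchange_big; apply: eq_bigr => g _.
  under eq_bigr do rewrite mulrCA mulr_sumr mulr_sumr.
  rewrite exchange_big/= mulr_sumr; apply: eq_bigr => g' _.
  rewrite -sum_thin_disjoint mulr_sumr mulr_sumr; apply: eq_bigr => S _.
  have -> : [disjoint (N g :|: N g')%SET & S] =
      [disjoint N g & S] && [disjoint N g' & S].
    by rewrite -!finset.setI_eq0 finset.setIUl finset.setU_eq0.
  by rewrite -mulnb natrM; ring.
(* The intermediate quantity is the mean size of the overlap of two independent copies. *)
apply: (@le_trans _ _ (mean (fun g => mean (fun g' =>
    \sum_v (v \in N g)%:R * (v \in N g')%:R)))); last first.
  rewrite (_ : mean _ = \sum_v mean (fun g => (v \in N g)%:R) ^+ 2)//.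
  under [RHS]eq_bigr do rewrite expr2 sqE.
  rewrite /mean exchange_big; apply: eq_bigr => g _.
  rewrite -mulr_sumr exchange_big/=; congr (_ * _); apply: eq_bigr => g' _.
  by rewrite mulr_sumr.
(* The left-hand side is the variance of the avoidance probability over the random set. *)
rewrite [leLHS](_ : _ = mean (fun g => mean (fun g' =>
    a ^+ #|(N g :|: N g')%SET| - a ^+ #|N g| * a ^+ #|N g'|))); last first.
  rewrite (eq_mean (F' := fun g => mean (fun g' => a ^+ #|(N g :|: N g')%SET|)
    - mean (fun g' => a ^+ #|N g| * a ^+ #|N g'|))); last first.
    by move=> g; rewrite meanB.
  rewrite meanB -sqE -/c -c2E.
  rewrite (_ : \sum_i _ = \sum_(S : {set I})
    (thin a S * mean (fun g => [disjoint N g & S]%:R) ^+ 2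
     - 2 * c * (thin a S * mean (fun g => [disjoint N g & S]%:R))
     + c ^+ 2 * thin a S)); last by apply: eq_bigr => S _; ring.
  by rewrite big_split/= sumrB -!mulr_sumr cE sum_thin; ring.
apply: le_mean => g; apply: le_mean => g'.
(* Disjoint copies contribute 0; otherwise the difference is at most 1 and the overlap has at least
   one point. *)
have [NN|/pred0Pn[v /andP[/= vg vg']]] := boolP [disjoint N g & N g'].
  rewrite finset.cardsU (eqP (_ : N g :&: N g' == finset.set0)%SET) ?finset.setI_eq0//.
  by rewrite cards0 subn0 exprD subrr sumr_ge0// => v _; rewrite mulr_ge0.
rewrite (bigD1 v)//= vg vg' mul1r; apply: (@le_trans _ _ 1).
  by rewrite lerBlDr (le_trans (exprn_ile1 _ a0 a1))// lerDl mulr_ge0 ?exprn_ge0.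
by rewrite lerDl sumr_ge0// => u _; rewrite mulr_ge0.
Qed.

(** A layer hits one of the random sets with mean probability about [lam], so that [m] layers avoid
    both with probability about [exp (- m lam)]; the link is made by one of the [m] layers, whence
    [m h]. In the error, [k1] and [k2] account for the dependence on the random sets, and [both] for
    the failure of additivity of the two hitting probabilities. *)
Lemma superposed_mean_approx (a b : R) : 0 <= a <= 1 -> 0 <= b <= 1 ->
  let h := mean (fun g => a ^+ #|N1 g| * b ^+ #|N2 g| * (J g)%:R) in
  let link := mean (fun g => (J g)%:R) in
  let lam := mean (fun g => 1 - a ^+ #|N1 g|) + mean (fun g => 1 - b ^+ #|N2 g|) in
  let B := mean (fun g => (N1 g != finset.set0)%:R) +
    mean (fun g => (N2 g != finset.set0)%:R) in
  let both := mean (fun g => ((N1 g != finset.set0) && (N2 g != finset.set0))%:R) in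
  let k1 := \sum_v mean (fun g => (v \in N1 g)%:R) ^+ 2 in
  let k2 := \sum_v mean (fun g => (v \in N2 g)%:R) ^+ 2 in
  (`|superposed_mean a b - m%:R * h * expR (- (m%:R * lam))| <=
   m%:R * link * (m%:R * link + B + m%:R * B ^+ 2
     + m%:R * (Num.sqrt k1 + Num.sqrt k2 + both)) : Prop).
Proof.
move=> a01 b01 h link lam B both k1 k2.
have /andP[a0 a1] := a01; have /andP[b0 b1] := b01.
pose e := expR (- (m%:R * lam)).
pose u (S : {set I}) := mean (fun g => [disjoint N1 g & S]%:R).
pose v (S : {set I}) := mean (fun g => [disjoint N2 g & S]%:R).
pose u0 := mean (fun g => a ^+ #|N1 g|).
pose v0 := mean (fun g => b ^+ #|N2 g|).
have lamE : lam = (1 - u0) + (1 - v0) by rewrite /lam !meanB !mean_cst.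
(* Averaging over the random sets undoes the thinning, so the term linear in [w] has mean exactly
   [h]. *)
have hE : h = \sum_(S : {set I}) \sum_(S' : {set I})
    thin a S * thin b S' * avoid_link S S'.
  rewrite /h /avoid_link /mean.
  under [RHS]eq_bigr => S _ do under eq_bigr => S' _ do rewrite mulr_sumr.
  under [RHS]eq_bigr do rewrite exchange_big.
  rewrite [RHS]exchange_big; apply: eq_bigr => g _.
  rewrite -!sum_thin_disjoint !mulr_suml mulr_sumr; apply: eq_bigr => S _.
  rewrite mulr_sumr mulr_suml mulr_sumr; apply: eq_bigr => S' _.
  by rewrite /avoids -!mulnb !natrM; ring.
have ptw S S' : `|avoid S S' ^+ m - (avoid S S' - avoid_link S S') ^+ m
      - m%:R * avoid_link S S' * e| <=
    m%:R * link * (m%:R * link + B + m%:R * B ^+ 2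
    + m%:R * (`|u S - u0| + `|v S' - v0| + both)).
  have wl : avoid_link S S' <= link.
    by apply: le_mean => g; rewrite ler_nat; case: avoids; case: (J g).
  have w0 : 0 <= avoid_link S S' by apply: mean_ge0.
  have B0 : 0 <= B by rewrite addr_ge0// mean_ge0.
  have both0 : 0 <= both by exact: mean_ge0.
  pose r := mean (fun g => (~~ [disjoint N1 g & S] && ~~ [disjoint N2 g & S'])%:R).
  have r0 : 0 <= r by apply: mean_ge0.
  have hit (N S0 : {set I}) : ~~ [disjoint N & S0] -> N != finset.set0.
    by apply: contraNneq => ->; rewrite -finset.setI_eq0 finset.set0I.
  have rB : r <= both.
    apply: le_mean => g; rewrite ler_nat.
    by case: (boolP [disjoint N1 g & S]) => // /hit ->;
      case: (boolP [disjoint N2 g & S']) => // /hit ->.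
  (* Inclusion-exclusion for hitting [S] or [S']; the correction [r] needs both neighbourhoods to be
     nonempty. *)
  have qE : 1 - avoid S S' = (1 - u S) + (1 - v S') - r.
    rewrite -[X in X - avoid _ _](mean_cst 1) -{1}[1 in RHS](mean_cst 1).
    rewrite -{1}[X in _ + (X - _)](mean_cst 1) -!meanB -meanD -meanB.
    apply: eq_mean => g; rewrite /avoids.
    by case: [disjoint _ & _]; case: [disjoint _ & _] => /=; ring.
  have wq : avoid_link S S' <= avoid S S'.
    by apply: le_mean => g; rewrite ler_nat; case: avoids; case: (J g).
  have q1 : 0 <= 1 - avoid S S'.
    rewrite -(mean_cst 1) -meanB; apply: mean_ge0 => g.
    by case: avoids; rewrite ?subr0 ?subrr.
  have qB : 1 - avoid S S' <= B.
    have : (1 - u S) + (1 - v S') <= B.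
      rewrite -[X in X - _](mean_cst 1) -[X in _ + (X - _)](mean_cst 1) -!meanB.
      apply: lerD; apply: le_mean => g; case: (boolP [disjoint _ & _]) => [|/hit ->];
        by rewrite ?subr0 ?subrr.
    by rewrite qE; lra.
  apply: le_trans (@subX_poisson _ _ _ m B lam
      (`|u S - u0| + `|v S' - v0| + both) _ _ _ _) _.
  - by rewrite w0.
  - by rewrite q1.
  - by apply: addr_ge0; apply: mean_ge0 => g; rewrite subr_ge0 exprn_ile1.
  - rewrite qE lamE (_ : _ - _ = - (u S - u0) + - (v S' - v0) - r); last by ring.
    apply: le_trans (ler_normB _ _) _; rewrite (ger0_norm r0); apply: lerD => //.
    by apply: le_trans (ler_normD _ _) _; rewrite !normrN.
  have m0 : 0 <= m%:R :> R by [].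
  have d0 : 0 <= `|u S - u0| + `|v S' - v0| + both by rewrite !addr_ge0.
  have B2 : 0 <= m%:R * B ^+ 2 by rewrite mulr_ge0// sqr_ge0.
  apply: ler_pM; rewrite ?mulr_ge0 ?ler_wpM2l//.
    apply: addr_ge0; last exact: mulr_ge0.
    by do 2 apply: addr_ge0 => //; exact: mulr_ge0.
  by rewrite !lerD// ler_wpM2l.
rewrite superposed_mean_thin hE.
have -> : m%:R * (\sum_(S : {set I}) \sum_(S' : {set I})
    thin a S * thin b S' * avoid_link S S') * e =
  \sum_(S : {set I}) \sum_(S' : {set I})
    thin a S * thin b S' * (m%:R * avoid_link S S' * e).
  rewrite mulr_sumr mulr_suml; apply: eq_bigr => S _.
  rewrite mulr_sumr mulr_suml; apply: eq_bigr => S' _; ring.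
rewrite -sumrB; under eq_bigr do rewrite -sumrB.
apply: (@le_trans _ _ (\sum_(S : {set I}) \sum_(S' : {set I})
   thin a S * thin b S' * (m%:R * link * (m%:R * link + B + m%:R * B ^+ 2
    + m%:R * (`|u S - u0| + `|v S' - v0| + both))))).
  apply: le_trans (ler_norm_sum _ _ _) _; apply: ler_sum => S _.
  apply: le_trans (ler_norm_sum _ _ _) _; apply: ler_sum => S' _.
  by rewrite -mulrBr normrM ger0_norm ?mulr_ge0 ?thin_ge0// ler_wpM2l ?mulr_ge0 ?thin_ge0.
(* The bound is affine in the two fluctuations, so its average over the two independent sets needs
   only the mean of each, which [thin_fluctuation] bounds. *)
pose k := m%:R * link; pose c := m%:R * link + B + m%:R * B ^+ 2 + m%:R * both.
have -> : \sum_(S : {set I}) \sum_(S' : {set I})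
   thin a S * thin b S' * (m%:R * link * (m%:R * link + B + m%:R * B ^+ 2
    + m%:R * (`|u S - u0| + `|v S' - v0| + both))) =
   k * (c + m%:R * (\sum_(S : {set I}) thin a S * `|u S - u0| +
     \sum_(S' : {set I}) thin b S' * `|v S' - v0|)).
  have E1 S : \sum_(S' : {set I})
      thin a S * thin b S' * (m%:R * link * (m%:R * link + B + m%:R * B ^+ 2
      + m%:R * (`|u S - u0| + `|v S' - v0| + both))) =
      thin a S * (k * c) + (thin a S * `|u S - u0|) * (k * m%:R) +
      thin a S * (k * m%:R * \sum_(S' : {set I}) thin b S' * `|v S' - v0|).
    transitivity (\sum_(S' : {set I}) (
      thin b S' * (thin a S * (k * c) + (thin a S * `|u S - u0|) * (k * m%:R))
       + thin a S * (k * m%:R) * (thin b S' * `|v S' - v0|))).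
      by apply: eq_bigr => S' _; rewrite /k /c; ring.
    by rewrite big_split/= -mulr_suml sum_thin -mulr_sumr; ring.
  under eq_bigr do rewrite E1.
  by rewrite !big_split/= -!mulr_suml sum_thin; ring.
have le1 : \sum_(S : {set I}) thin a S * `|u S - u0| <= Num.sqrt k1.
  exact: thin_fluctuation.
have le2 : \sum_(S : {set I}) thin b S * `|v S - v0| <= Num.sqrt k2.
  exact: thin_fluctuation.
have link0 : 0 <= link by exact: mean_ge0.
rewrite /k /c ler_wpM2l ?mulr_ge0// -!addrA -mulrDr !lerD2l ler_wpM2l//; lra.
Qed.

End superposed_layers.

Local Open Scope classical_set_scope.

(** * The law of a layer *)

Lemma ge0_integral_mrestr d (T : measurableType d) (R : realType)
    (mu : {measure set T -> \bar R}) (A D : set T) (mD : measurable D)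
    (f : T -> \bar R) : measurable A -> measurable_fun A f ->
  (forall x, A x -> (0 <= f x)%E) ->
  (\int[mrestr mu mD]_(x in A) f x = \int[mu]_(x in A `&` D) f x)%E.
Proof.
move=> mA mf f0; have mDC := measurableC mD.
have muDC : mrestr mu mD (~` D) = 0%E by rewrite /mrestr setICl measure0.
rewrite (@ge0_negligible_integral _ _ _ _ A (~` D))//.
rewrite setDE setCK; apply: eq_measure_integral => B mB BAD.
by rewrite /mrestr; congr (mu _); apply/setIidPl => x /BAD[].
Qed.

Lemma probability_integrable d (T : measurableType d) (R : realType)
    (P : probability T R) (D : set T) (f : T -> R) (M : R) :
  measurable D -> measurable_fun D f -> (forall x, D x -> `|f x| <= M) ->
  P.-integrable D (EFin \o f).
Proof.
move=> mD mf fM; apply: measurable_bounded_integrable => //.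
  by rewrite (le_lt_trans (probability_le1 _ _))// ltry.
exists M; split; first exact: num_real.
by move=> N MN x Dx; exact: le_trans (fM x Dx) (ltW MN).
Qed.

Lemma measurable_fun_natM (R : realType) (d : measure_display)
    (Y : measurableType d) (D : set (nat * R)) (f : nat * R -> Y) :
  measurable D -> (forall x, measurable_fun setT (fun y => f (x, y))) ->
  measurable_fun D f.
Proof.
move=> mD mf _ B mB; apply: measurableI => //.
rewrite (_ : f @^-1` B = \bigcup_x ([set x] `*` ((fun y => f (x, y)) @^-1` B))).
  apply: bigcup_measurable => x _; apply: measurableX => //.
  by rewrite -[X in measurable X]setTI; exact: mf.
apply/seteqP; split => [[x y] Bxy|[x y] [_ _ [/= -> By]]//].
by exists x.
Qed.

Lemma measurable_strip {R : realType} : measurable (@strip R).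
Proof.
rewrite (_ : strip = setT `*` `[0, 1]); first exact: measurableX.
by apply/seteqP; split => -[x y] /=; rewrite /strip /= in_itv/=; [split|case].
Qed.

Lemma measurable_strip_upto {R : realType} n : measurable (@strip_upto R n).
Proof.
rewrite (_ : strip_upto n = [set x | (x <= n)%N] `*` `[0, 1]).
  exact: measurableX.
by apply/seteqP; split => -[x y] /=; rewrite /strip_upto /= in_itv/=; case.
Qed.

#[local] Hint Extern 0 (measurable _) => solve [exact: measurable_strip] : core.
#[local] Hint Extern 0 (measurable _) =>
  solve [exact: measurable_strip_upto] : core.

Definition edge_weight (R : realType) n (g : lgraph n) (y : R) : R :=
  \prod_(e in node_pairs (nodes g)) (if e \in edges g then y else 1 - y).

Lemma edge_weight_ge0 (R : realType) n (g : lgraph n) (y : R) :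
  0 <= y <= 1 -> 0 <= edge_weight g y.
Proof.
by move=> /andP[y0 y1]; apply: prodr_ge0 => e _; case: ifP; rewrite ?subr_ge0.
Qed.

Lemma measurable_edge_weight (R : realType) n (g : lgraph n) (D : set R) :
  measurable_fun D (edge_weight g).
Proof.
rewrite /edge_weight; under eq_fun do rewrite -big_enum.
apply: measurable_prod => e _.
by case: (e \in edges g) => //; exact: measurable_funB.
Qed.

Definition layer_pmf (R : realType) n (P : probability (nat * R)%type R)
    (g : lgraph n) : R :=
  'C(n, #|nodes g|)%:R^-1 *
  \int[P]_(z in strip) ((z.1 == #|nodes g|)%:R * edge_weight g z.2).

(** Restricting [Pr] to the event that the node set is [nodes g] and pushing it forward to sizes and
    strengths gives, by the uniform law of the node set, a multiple of [P] restricted to a single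
    size. The edge law is then an integral against this measure. *)
Lemma layer_law (R : realType) n d (Omega : measurableType d)
    (Pr : probability Omega R) (L : {mfun Omega >-> (nat * R * lgraph n)%type})
    (P : probability (nat * R)%type R) (g : lgraph n) :
  P strip = 1%E -> size_strength_law Pr L P -> uniform_node_set Pr L ->
  bernoulli_edges Pr L ->
  Pr [set w | (L w).2 = g] = (layer_pmf P g)%:E.
Proof.
move=> Pstrip Llaw Lnodes Ledges.
pose V := nodes g; pose k := #|V|; pose phi := fst \o L.
have mphi : measurable_fun setT phi by exact: measurableT_comp.
have mL2 (A : set (lgraph n)) : measurable [set w | A (L w).2].
  rewrite (_ : [set w | _] = L @^-1` (setT `*` A)).
    by rewrite -[X in measurable X]setTI; apply: measurable_funPT => //; exact: measurableX.
  by apply/seteqP; split => w //= [].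
have mphiB B : measurable B -> measurable (phi @^-1` B).
  by move=> mB; rewrite -[X in measurable X]setTI; exact: mphi.
have mk : measurable [set z : nat * R | z.1 = k].
  rewrite (_ : [set z | _] = [set k] `*` setT); first exact: measurableX.
  by apply/seteqP; split => z //= [].
have mNV : measurable [set w | lnodes L w = V] by exact: (mL2 [set g | nodes g = V]).
(* The added event that the strength lies in [[0, 1]] has probability 1 and makes the edge weights
   nonnegative. *)
have -> : Pr [set w | (L w).2 = g] =
    Pr [set w | [/\ strip (L w).1, lnodes L w = V & ledges L w = edges g]].
  rewrite (_ : [set w | [/\ _, _ & _]] = [set w | (L w).2 = g] `&` phi @^-1` strip).
    rewrite [LHS](measureDI Pr (mL2 [set h | h = g]) (mphiB _ measurable_strip)).
    rewrite [X in (X + _)%E](_ : _ = 0%E) ?add0e//; apply/eqP.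
    rewrite eq_le measure_ge0 andbT; apply: (@le_trans _ _ (Pr (~` (phi @^-1` strip)))).
      apply: le_measure; rewrite ?inE//.
      - exact: (measurableD (mL2 [set h | h = g]) (mphiB _ measurable_strip)).
      - by apply: measurableC; exact: mphiB.
    rewrite probability_setC; last exact: mphiB.
    by rewrite (Llaw strip)// Pstrip subee.
  apply/seteqP; split => w /=.
    move=> [sw Vw Ew]; split => //; apply: val_inj; move: Vw Ew.
    by rewrite /lnodes /ledges /V /nodes /edges; case: (val (L w).2) => a b /= -> ->; case: (val g).
  by move=> [Lg sw]; rewrite /lnodes /ledges Lg.
rewrite (Ledges strip V)//; last exact: (valP g).
transitivity (\int[Pr]_(w in phi @^-1` strip `&` [set w | lnodes L w = V])
  (((fun z => (edge_weight g z.2)%:E) \o phi) w))%E; first by [].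
have ew0 z : strip z -> (0 <= (edge_weight g z.2)%:E :> \bar R)%E.
  by move=> sz; rewrite lee_fin edge_weight_ge0.
have mew (D : set (nat * R)) : measurable D ->
    measurable_fun D (fun z : nat * R => (edge_weight g z.2)%:E).
  by move=> mD; apply: measurable_fun_natM => // x; apply/measurable_EFinP;
    exact: measurable_edge_weight.
rewrite -(@ge0_integral_mrestr _ _ _ Pr _ _ mNV)//; last 3 first.
- exact: mphiB.
- exact: (measurableT_comp (mew _ measurableT) (measurable_funTS mphi)).
- by move=> w /ew0.
rewrite -(@ge0_integral_pushforward _ _ _ _ _ _ mphi)//; last 2 first.
- exact: mew.
- by move=> z /set_mem /ew0.
have c0 : 0 <= ('C(n, k)%:R^-1 : R) by rewrite invr_ge0.
rewrite (@eq_measure_integral _ _ _ _ (mscale (NngNum c0) (mrestr P mk))); last first.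
  move=> A mA _; rewrite /pushforward /mscale /= /mrestr.
  transitivity (Pr [set w | A (L w).1 /\ lnodes L w = V]); first by [].
  rewrite Lnodes//.
  transitivity (\int[Pr]_(w in phi @^-1` A)
     ('C(n, k)%:R^-1%:E * (\1_(phi @^-1` [set z | z.1 = k]) w)%:E))%E.
    apply: eq_integral => w _; rewrite -EFinM indicE; congr EFin.
    case: eqP => [Vk|Vk]; last first.
      by rewrite memNset ?mulr0// => wk; apply: Vk; rewrite -/k -wk.
    by rewrite mem_set ?mulr1 -?Vk//; exact/esym.
  have mpA := mphiB _ mA; have mpk := mphiB _ mk.
  rewrite ge0_integralZl_EFin//; last first.
    by apply/measurable_EFinP; exact: measurable_indic.
  rewrite integral_indic//.
  rewrite -preimage_setI; congr (_ * _)%E.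
  by rewrite [LHS](Llaw _ (measurableI _ _ mk mA)) setIC.
rewrite ge0_integral_mscale//=; last exact: mew.
rewrite ge0_integral_mrestr//; last exact: mew.
rewrite integral_mkcondr /layer_pmf EFinM; congr (_ * _)%E.
rewrite /Rintegral fineK; last first.
  apply: integrable_fin_num => //; apply: (@probability_integrable _ _ _ _ _
    (fun z => (z.1 == #|nodes g|)%:R * edge_weight g z.2) 1) => //.
    apply: measurable_fun_natM => // x.
    by apply: measurable_funM => //; exact: measurable_edge_weight.
  move=> [x y] sxy /=; rewrite ger0_norm ?mulr_ge0 ?edge_weight_ge0//.
  apply: mulr_ile1 => //; rewrite ?edge_weight_ge0 ?lern1 ?leq_b1//.
  apply: prodr_ile1 => e _; have /andP[y0 y1] := sxy.
  by case: ifP => _; rewrite ?y0// subr_ge0 y1 gerBl.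
apply: eq_integral => z _; rewrite patchE.
have [zk|zk] := eqVneq z.1 k; first by rewrite mem_set// mul1r.
by rewrite memNset ?mul0r// => kz; case/eqP: zk.
Qed.

Lemma card_supersets (I : finType) (W : {set I}) k :
  #|[set V : {set I} | (W \subset V) && (#|V| == k + #|W|)%N]%SET| =
  'C(#|I| - #|W|, k).
Proof.
have -> : (#|I| - #|W|)%N = #|(~: W)%SET| by rewrite [RHS]finset.cardsCs finset.setCK.
rewrite -cards_draws.
rewrite -[RHS](card_in_imset (f := fun B : {set I} => (B :|: W)%SET)); last first.
  move=> A B; rewrite !finset.inE => /andP[AW _] /andP[BW _] /= AB.
  have E (C : {set I}) : C \subset (~: W)%SET -> C = ((C :|: W) :\: W)%SET.
    move=> CW; apply/finset.setP => x; rewrite !finset.inE.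
    by case: (boolP (x \in C)) => [/(fintype.subsetP CW)|_]; rewrite ?finset.inE; case: (x \in W).
  by rewrite (E _ AW) (E _ BW) AB.
congr #|pred_of_set _|; apply/finset.setP => V; rewrite !finset.inE; apply/andP/imsetP.
  move=> [WV /eqP Vk]; exists (V :\: W)%SET.
    rewrite !finset.inE finset.subsetDr finset.cardsD (finset.setIidPr WV) Vk.
    by rewrite addnK eqxx.
  apply/finset.setP => x; rewrite !finset.inE.
  by case: (boolP (x \in W)) => [/(fintype.subsetP WV) ->|_]; rewrite ?orbT ?orbF.
move=> [B]; rewrite !finset.inE => /andP[BW /eqP Bk] ->.
split; first exact: finset.subsetUr.
rewrite finset.cardsU (_ : B :&: W = finset.set0)%SET ?cards0 ?subn0 ?Bk//.
by apply/eqP; rewrite finset.setI_eq0 finset.disjoints_subset.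
Qed.

(** Both sides count the [k]-subsets of [n] points together with a sequence of [w] distinct points
    in them. For [k > n] both sides vanish. *)
Lemma bin_ffactM n k w : (w <= k)%N ->
  ('C(n - w, k - w) * n ^_ w = 'C(n, k) * k ^_ w)%N.
Proof.
move=> wk; have [nk|kn] := ltnP n k.
  have [nw|wn] := ltnP n w.
    by rewrite (ffact_small nw) muln0 (bin_small nk).
  by rewrite !bin_small ?mul0n// ltn_sub2r// (leq_ltn_trans wn).
have wn := leq_trans wk kn.
apply/eqP; rewrite -(eqn_pmul2r (fact_gt0 (k - w))) -(eqn_pmul2r (fact_gt0 (n - k))).
have h1 : ('C(n - w, k - w) * (k - w)`! * (n - k)`! = (n - w)`!)%N.
  rewrite -mulnA (_ : (n - k = (n - w) - (k - w))%N) ?bin_fact ?leq_sub2r//.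
  by rewrite subnBA ?subnK.
have h2 : (n ^_ w * (n - w)`! = n`!)%N by rewrite ffact_fact.
have h3 : (k ^_ w * (k - w)`! = k`!)%N by rewrite ffact_fact.
have h4 : ('C(n, k) * (k`! * (n - k)`!) = n`!)%N by rewrite bin_fact.
apply/eqP.
transitivity (n ^_ w * ('C(n - w, k - w) * (k - w)`! * (n - k)`!))%N.
  by rewrite (mulnC 'C(n - w, k - w)) -!mulnA.
by rewrite h1 h2 -h4 -h3 !mulnA.
Qed.

Lemma sum_lgraph (R : realType) n (F : {set 'I_n} -> {set {set 'I_n}} -> R) :
  \sum_(g : lgraph n) F (nodes g) (edges g) =
  \sum_(V : {set 'I_n}) \sum_(E : {set {set 'I_n}} | E \subset node_pairs V) F V E.
Proof.
rewrite pair_big_dep/= [RHS](reindex_omap (fun g : lgraph n => val g) insub)/=; last first.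
  by move=> g /= Pg; rewrite insubT.
by apply: eq_bigl => g; rewrite (valP g) valK eqxx.
Qed.

Lemma sum_subset_prod (R : realType) (I : finType) (A : {set I}) (F G : I -> R) :
  \sum_(E : {set I} | E \subset A) \prod_(e in A) (if e \in E then F e else G e) =
  \prod_(e in A) (F e + G e).
Proof.
(* Outside [A] the values 0 and 1 kill the subsets that leave [A] and do not affect the others. *)
pose F' e := if e \in A then F e else 0; pose G' e := if e \in A then G e else 1.
transitivity (\prod_e (F' e + G' e)).
  rewrite bigA_distr [RHS](bigID (fun E : {set I} => E \subset A))/= [X in _ + X]big1.
    rewrite addr0; apply: eq_big => // E EA; rewrite [LHS]big_mkcond.
    apply: eq_bigr => e _; rewrite /F' /G'; case: ifPn => // eA.
    by case: ifPn => // /(fintype.subsetP EA); rewrite (negbTE eA).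
  move=> E /fintype.subsetPn[e eE eA]; rewrite (bigD1 e)//= eE /F' (negbTE eA).
  by rewrite mul0r.
rewrite [RHS]big_mkcond; apply: eq_bigr => e _; rewrite /F' /G'.
by case: ifP => // _; rewrite add0r.
Qed.

Lemma strip_upto_integral (R : realType) n (P : probability (nat * R)%type R)
    (f : nat * R -> R) : P (strip_upto n) = 1%E -> measurable_fun strip f ->
  \int[P]_(z in strip) f z = \int[P]_(z in strip_upto n) f z.
Proof.
move=> Pn mf; have Pn0 : P (~` strip_upto n) = 0%E.
  by rewrite probability_setC// Pn subee.
rewrite /Rintegral integralE [in RHS]integralE; congr fine.
have E g : measurable_fun strip g -> (forall z, strip z -> (0 <= g z)%E) ->
    (\int[P]_(z in strip) g z = \int[P]_(z in strip_upto n) g z)%E.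
  move=> mg g0; rewrite (ge0_negligible_integral _ _ _ _ Pn0)//; last first.
    exact: measurableC.
  rewrite setDE setCK; congr (integral _ _ _).
  by apply/seteqP; split => [z []//|z sz]; split => //; case: sz.
by congr (_ - _)%E; apply: E => //; [apply: measurable_funepos|
  apply: measurable_funeneg]; exact/measurable_EFinP.
Qed.

Lemma integrable_EFinZl d (T : measurableType d) (R : realType)
    (mu : {measure set T -> \bar R}) (D : set T) (c : R) (f : T -> R) :
  measurable D -> mu.-integrable D (EFin \o f) ->
  mu.-integrable D (EFin \o (fun x => c * f x)).
Proof.
move=> mD intf; rewrite (_ : _ \o _ = (fun x => c%:E * (EFin \o f) x)%E).
  exact: integrableZl.
by apply/funext => x /=; rewrite EFinM.
Qed.

Lemma Rintegral_sum d (T : measurableType d) (R : realType)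
    (mu : {measure set T -> \bar R}) (D : set T) (I : Type) (r : seq I)
    (Q : pred I) (f : I -> T -> R) :
  measurable D -> (forall i, mu.-integrable D (EFin \o f i)) ->
  \int[mu]_(x in D) (\sum_(i <- r | Q i) f i x) =
  \sum_(i <- r | Q i) \int[mu]_(x in D) f i x.
Proof.
move=> mD intf; elim: r => [|i r IH].
  under eq_Rintegral do rewrite big_nil.
  by rewrite big_nil /Rintegral integral0.
under eq_Rintegral do rewrite big_cons; rewrite big_cons; case: ifP => // _.
rewrite RintegralD ?IH//.
rewrite (_ : EFin \o _ = (fun x => \sum_(i <- r | Q i) (f i x)%:E)%E); last first.
  by apply/funext => x /=; rewrite sumEFin.
by apply: integrable_sum => // i' _; exact: intf.
Qed.

(* Summing over the node sets containing [W] turns the uniform law of the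
   node set into the falling factorial of the layer size. *)
Lemma mean_layer_pmf (R : realType) n (P : probability (nat * R)%type R)
    (W : {set 'I_n}) (om om' : {set 'I_n} -> R) (psi : nat -> R -> R) :
  P (strip_upto n) = 1%E ->
  (forall x, measurable_fun setT (psi x)) ->
  (forall x y, 0 <= y <= 1 -> 0 <= psi x y <= 1) ->
  (forall (V : {set 'I_n}) y, W \subset V ->
     \prod_(e in node_pairs V) (y * om e + (1 - y) * om' e) = psi #|V| y) ->
  mean (layer_pmf P) (fun g : lgraph n => (W \subset nodes g)%:R *
    \prod_(e in node_pairs (nodes g)) (if e \in edges g then om e else om' e)) =
  (\int[P]_(z in strip) ((z.1 ^_ #|W|)%:R * psi z.1 z.2)) / (n ^_ #|W|)%:R.
Proof.
move=> Pn mpsi psi01 psiE; set w := #|W|.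
pose I k := \int[P]_(z in strip) ((z.1 == k)%:R * psi k z.2).
have intI k : P.-integrable strip (EFin \o (fun z => (z.1 == k)%:R * psi k z.2)).
  apply: (@probability_integrable _ _ _ _ _ _ 1) => //.
    by apply: measurable_fun_natM => // x; apply: measurable_funM.
  move=> z sz; have /andP[p0 p1] := psi01 k z.2 sz.
  by rewrite ger0_norm ?mulr_ge0// mulr_ile1// lern1 leq_b1.
pose G (V : {set 'I_n}) (E : {set {set 'I_n}}) :=
  'C(n, #|V|)%:R^-1 * \int[P]_(z in strip) ((z.1 == #|V|)%:R *
    \prod_(e in node_pairs V) (if e \in E then z.2 else 1 - z.2)) *
  ((W \subset V)%:R * \prod_(e in node_pairs V) (if e \in E then om e else om' e)).
(* For a fixed node set [V], the sum over the edge sets turns the weights into [psi #|V|]. *)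
transitivity (\sum_(V : {set 'I_n} | W \subset V) 'C(n, #|V|)%:R^-1 * I #|V|).
  rewrite (_ : mean _ _ = \sum_(g : lgraph n) G (nodes g) (edges g))// sum_lgraph.
  rewrite [RHS]big_mkcond; apply: eq_bigr => V _; rewrite /G.
  case: ifP => WV; last first.
    by rewrite big1// => E _; rewrite mul0r mulr0.
  have mE (E : {set {set 'I_n}}) : measurable_fun strip
      (fun z : nat * R => (z.1 == #|V|)%:R *
         \prod_(e in node_pairs V) (if e \in E then z.2 else 1 - z.2)).
    apply: measurable_fun_natM => // x; apply: measurable_funM => //=.
    under eq_fun do rewrite -big_enum; apply: measurable_prod => e _.
    by case: (e \in E) => //; exact: measurable_funB.
  have bE (E : {set {set 'I_n}}) (z : nat * R) : strip z ->
      `|(z.1 == #|V|)%:R * \prod_(e in node_pairs V) (if e \in E then z.2 else 1 - z.2)| <= 1.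
    move=> /andP[z0 z1]; have q01 e : 0 <= (if e \in E then z.2 else 1 - z.2) <= 1.
      by case: ifP => _; lra.
    have p0 : 0 <= \prod_(e in node_pairs V) (if e \in E then z.2 else 1 - z.2).
      by apply: prodr_ge0 => e _; case/andP: (q01 e).
    rewrite ger0_norm ?mulr_ge0// mulr_ile1// ?lern1 ?leq_b1//.
    by apply: prodr_ile1 => e _.
  have intE (E : {set {set 'I_n}}) : P.-integrable strip (EFin \o (fun z : nat * R =>
      (z.1 == #|V|)%:R * \prod_(e in node_pairs V) (if e \in E then z.2 else 1 - z.2))).
    by apply: (@probability_integrable _ _ _ _ _ _ 1) => //; exact: bE.
  pose c (E : {set {set 'I_n}}) := \prod_(e in node_pairs V) (if e \in E then om e else om' e).
  transitivity ('C(n, #|V|)%:R^-1 * \sum_(E : {set {set 'I_n}} | E \subset node_pairs V)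
    \int[P]_(z in strip) (((z.1 == #|V|)%:R *
    \prod_(e in node_pairs V) (if e \in E then z.2 else 1 - z.2)) * c E)).
    rewrite mulr_sumr; apply: eq_bigr => E _.
    by rewrite RintegralZr// mul1r mulrA.
  rewrite -Rintegral_sum//; last first.
    by move=> E; under eq_fun do rewrite mulrC; exact: integrable_EFinZl.
  congr (_ * _); apply: eq_Rintegral => z _.
  rewrite -psiE// -sum_subset_prod mulr_sumr; apply: eq_bigr => E _.
  rewrite -mulrA; congr (_ * _); rewrite -big_split; apply: eq_bigr => e _ /=.
  by case: ifP.
(* Among the node sets of size [k], the fraction [k ^_ w / n ^_ w] contains [W]. *)
transitivity (\sum_(k < n.+1) (k ^_ w)%:R / (n ^_ w)%:R * I k).
  have cardV (V : {set 'I_n}) : (#|V| < n.+1)%N.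
    by rewrite ltnS -[X in (_ <= X)%N](card_ord n) max_card.
  rewrite (partition_big (fun V : {set 'I_n} => Ordinal (cardV V)) xpredT)//=.
  apply: eq_bigr => k _.
  transitivity (\sum_(V in [set V : {set 'I_n} | (W \subset V) && (#|V| == k)%N]%SET)
     ('C(n, k)%:R^-1 * I k)).
    rewrite big_mkcond [RHS]big_mkcond; apply: eq_bigr => V _.
    by rewrite finset.inE -val_eqE/=; case: ifP => // /andP[_ /eqP ->].
  rewrite sumr_const -mulrnAl; congr (_ * _).
  have wn : (w <= n)%N by rewrite -[X in (_ <= X)%N](card_ord n) max_card.
  have kn : (k <= n)%N by rewrite -ltnS.
  have Cn0 : ('C(n, k)%:R : R) != 0 by rewrite pnatr_eq0 -lt0n bin_gt0.
  have nw0 : ((n ^_ w)%:R : R) != 0 by rewrite pnatr_eq0 -lt0n ffact_gt0.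
  have [wk|kw] := leqP w k; last first.
    rewrite (ffact_small kw) mul0r (_ : [set _ | _]%SET = finset.set0) ?cards0 ?mulr0n//.
    apply/finset.setP => V; rewrite !finset.inE; apply/negbTE/negP => /andP[/subset_leq_card].
    by rewrite -/w => wV /eqP Vk; rewrite Vk leqNgt kw in wV.
  have := @card_supersets _ W (k - w); rewrite -/w subnK// card_ord => ->.
  apply/eqP; rewrite -[X in X == _]mulr_natl eqr_div//.
  by rewrite -!natrM bin_ffactM// mulnC.
(* Sizes are at most [n], so the integral splits into finitely many sizes. *)
rewrite (strip_upto_integral Pn); last first.
  apply: measurable_fun_natM => // x; apply: measurable_funM => //=; exact: mpsi.
rewrite [X in _ = X / _](_ : _ = \int[P]_(z in strip_upto n) (\sum_(k < n.+1)
    (k ^_ w)%:R * ((z.1 == k)%:R * psi k z.2))); last first.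
  apply: eq_Rintegral => z /set_mem[zn _].
  rewrite (bigD1 (Ordinal (zn : (z.1 < n.+1)%N)))//= eqxx mul1r.
  rewrite big1 ?addr0// => k; rewrite -val_eqE/= eq_sym => /negbTE ->.
  by rewrite mul0r mulr0.
have sup : strip_upto n `<=` @strip R by move=> z [].
have intI' k : P.-integrable (strip_upto n)
    (EFin \o (fun z => (z.1 == k)%:R * psi k z.2)).
  exact: integrableS (intI k).
rewrite Rintegral_sum//; last first.
  by move=> k; exact: integrable_EFinZl.
rewrite mulr_suml; apply: eq_bigr => k _; rewrite RintegralZl// mulrAC.
congr (_ * _ / _); rewrite /I (strip_upto_integral Pn)//.
by apply: measurable_fun_natM => // x; apply: measurable_funM.
Qed.

Lemma probability_strip (R : realType) n (P : probability (nat * R)%type R) :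
  P (strip_upto n) = 1%E -> P strip = 1%E.
Proof.
move=> Pn; apply/eqP; rewrite eq_le probability_le1//= -Pn le_measure ?inE//.
by move=> z [].
Qed.

(** * Neighbourhoods in a single layer *)

Section layer_neighbours.
Variables (R : realType) (n : nat).
Implicit Types (u v w : 'I_n) (Z V : {set 'I_n}) (F : {set {set 'I_n}}).
Implicit Types (g : lgraph n).

(** [Z] holds the nodes that are not counted: the other end of the conditioning edge, or none when
    all neighbours count. *)
Definition nbrs F Z u : {set 'I_n} :=
  [set w | [&& w != u, w \notin Z & [set u; w]%SET \in F]]%SET.

Lemma card2_mem (e : {set 'I_n}) u : #|e| = 2%N -> u \in e ->
  exists2 w, w != u & e = [set u; w]%SET.
Proof.
move=> e2 ue; have /eqP : #|(e :\ u)%SET| = 1%N.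
  by move: e2; rewrite (cardsD1 u) ue => -[].
move=> /cards1P[w ew]; have : w \in (e :\ u)%SET by rewrite ew finset.set11.
rewrite !finset.inE => /andP[wu we]; exists w => //.
by rewrite -(finset.setD1K ue) ew.
Qed.

(** A power of the number of neighbours becomes a product of pair weights, the form in which
    [mean_layer_pmf] averages over edges. Edges at [u] correspond to their other ends. *)
Lemma prod_star F Z u (a : R) : (forall e, e \in F -> #|e| = 2%N) -> u \notin Z ->
  \prod_(e in F) (if (u \in e) && [disjoint e & Z] then a else 1) =
  a ^+ #|nbrs F Z u|.
Proof.
move=> F2 uZ; rewrite -big_mkcondr/=.
rewrite (eq_bigl [in [set [set u; w]%SET | w in nbrs F Z u]%SET]).
  rewrite prodr_const card_in_imset// => w w'; rewrite !finset.inE.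
  move=> /and3P[wu _ _] /and3P[w'u _ _] /finset.setP/(_ w).
  by rewrite !finset.inE (negbTE wu) eqxx/= => /esym/eqP.
move=> e; apply/idP/imsetP.
  move=> /and3P[eF ue eZ]; have [w wu eE] := card2_mem (F2 _ eF) ue.
  exists w => //; rewrite finset.inE wu -eE eF andbT/=.
  by apply: contraL eZ => wZ; apply/pred0Pn; exists w; rewrite /= wZ eE !finset.inE eqxx orbT.
move=> [w]; rewrite finset.inE => /and3P[wu wZ wF] ->; rewrite wF.
rewrite !finset.inE eqxx/=; apply/pred0P => x /=; rewrite !finset.inE.
by apply/negP => /andP[/orP[] /eqP -> //]; apply/negP.
Qed.

Lemma edges_card2 g e : e \in edges g -> #|e| = 2%N.
Proof.
by move=> /(fintype.subsetP (valP g)); rewrite finset.inE => /andP[_ /eqP].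
Qed.

Lemma edges_sub_nodes g e : e \in edges g -> e \subset nodes g.
Proof. by move=> /(fintype.subsetP (valP g)); rewrite finset.inE => /andP[]. Qed.

Lemma node_pairs_card2 V e : e \in node_pairs V -> #|e| = 2%N.
Proof. by rewrite finset.inE => /andP[_ /eqP]. Qed.

Lemma nbrs_node_pairs V Z u : u \in V ->
  nbrs (node_pairs V) Z u = (V :\ u :\: Z)%SET.
Proof.
move=> uV; apply/finset.setP => w; have [->|wu] := eqVneq w u.
  by rewrite !finset.inE eqxx/= andbF.
rewrite !finset.inE wu finset.subUset !finset.sub1set uV cards2.
by rewrite (eq_sym u w) wu/= andbT.
Qed.

Lemma set2_in_node_pairs V u v : u != v ->
  ([set u; v]%SET \in node_pairs V) = (u \in V) && (v \in V).
Proof.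
by move=> uv; rewrite finset.inE finset.subUset !finset.sub1set cards2 uv andbT.
Qed.

Variables (P : probability (nat * R)%type R) (Pn : P (strip_upto n) = 1%E).
Notation pmf := (@layer_pmf R n P).

Lemma mean_nodes (W : {set 'I_n}) :
  mean pmf (fun g => (W \subset nodes g)%:R) =
  (\int[P]_(z in strip) (z.1 ^_ #|W|)%:R) / (n ^_ #|W|)%:R.
Proof.
have := @mean_layer_pmf R n P W (fun=> 1) (fun=> 1) (fun _ _ => 1) Pn.
rewrite (@eq_mean _ _ _ _ (fun g => (W \subset nodes g)%:R)); last first.
  by move=> g; rewrite [X in _ * X]big1 ?mulr1// => e _; case: ifP.
move=> ->//.
- by congr (_ / _); apply: eq_Rintegral => z _; rewrite mulr1.
- by move=> x y _; rewrite ler01 lexx.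
- by move=> V y _; rewrite big1// => e _; rewrite !mulr1 addrC subrK.
Qed.

(** [1 - y * (1 - a)] is the generating function at [a] of a Bernoulli variable of parameter [y],
    here the presence of one edge. *)
Lemma retention_itv (a y : R) : 0 <= a <= 1 -> 0 <= y <= 1 ->
  0 <= 1 - y * (1 - a) <= 1.
Proof. by move=> a01 y01; nra. Qed.

Lemma measurable_retention (a : R) k :
  measurable_fun setT (fun y : R => (1 - y * (1 - a)) ^+ k).
Proof.
by apply: measurable_funX; apply: measurable_funB => //; apply: measurable_funM.
Qed.

Lemma mean_degree u (a : R) : 0 <= a <= 1 ->
  mean pmf (fun g => (u \in nodes g)%:R * a ^+ #|nbrs (edges g) finset.set0 u|) =
  (\int[P]_(z in strip) (z.1%:R * (1 - z.2 * (1 - a)) ^+ (z.1 - 1))) / n%:R.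
Proof.
move=> a01.
pose om (e : {set 'I_n}) := if (u \in e) && [disjoint e & finset.set0] then a else 1 : R.
have := @mean_layer_pmf R n P [set u]%SET om (fun=> 1)
  (fun x y => (1 - y * (1 - a)) ^+ (x - 1)) Pn.
rewrite (@eq_mean _ _ _ _ (fun g => (u \in nodes g)%:R *
  a ^+ #|nbrs (edges g) finset.set0 u|)); last first.
  move=> g; rewrite finset.sub1set; congr (_ * _).
  rewrite -prod_star ?finset.inE//; last by move=> e; exact: edges_card2.
  rewrite [LHS]big_mkcond [RHS]big_mkcond; apply: eq_bigr => e _.
  case: (boolP (e \in edges g)) => [eg|eg]; last by case: ifP.
  by rewrite (fintype.subsetP (valP g) _ eg).
move=> ->.
- rewrite cards1 ffactn1; congr (_ / _).
  by apply: eq_Rintegral => z _; rewrite ffactn1.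
- by move=> x; exact: measurable_retention.
- move=> x y y01; have /andP[r0 r1] := retention_itv a01 y01.
  by rewrite exprn_ge0// exprn_ile1.
move=> V y; rewrite finset.sub1set => uV.
transitivity (\prod_(e in node_pairs V)
    (if (u \in e) && [disjoint e & finset.set0] then 1 - y * (1 - a) else 1)).
  by apply: eq_bigr => e _; rewrite /om; case: ifP => _; ring.
rewrite prod_star ?finset.inE//; last by move=> e; exact: node_pairs_card2.
rewrite nbrs_node_pairs// finset.setD0; congr (_ ^+ _).
by rewrite (cardsD1 u V) uV add1n subn1.
Qed.

(** The weight 0 of an absent [W] forces the link, and [W] counts for neither neighbourhood since
    each excludes the other end. Every other pair contains at most one of [u] and [v], so the two
    degrees contribute separate factors. *)
Lemma mean_link_degrees u v (a b : R) : u != v -> 0 <= a <= 1 -> 0 <= b <= 1 ->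
  mean pmf (fun g => a ^+ #|nbrs (edges g) [set v]%SET u| *
      b ^+ #|nbrs (edges g) [set u]%SET v| * ([set u; v]%SET \in edges g)%:R) =
  (\int[P]_(z in strip) ((z.1 ^_ 2)%:R * (z.2 * (1 - z.2 * (1 - a)) ^+ (z.1 - 2)
     * (1 - z.2 * (1 - b)) ^+ (z.1 - 2)))) / (n ^_ 2)%:R.
Proof.
move=> uv a01 b01; set W := [set u; v]%SET.
have W2 : #|W| = 2%N by rewrite cards2 uv.
have uNv : u \notin [set v]%SET by rewrite finset.inE.
have vNu : v \notin [set u]%SET by rewrite finset.inE eq_sym.
pose star (a b : R) (e : {set 'I_n}) :=
  (if (u \in e) && [disjoint e & [set v]%SET] then a else 1) *
  (if (v \in e) && [disjoint e & [set u]%SET] then b else 1) : R.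
have starW (a' b' : R) : star a' b' W = 1.
  rewrite /star; have -> : [disjoint W & [set v]%SET]%B = false.
    by apply/negbTE/pred0Pn; exists v; rewrite /= !finset.inE eqxx orbT.
  have -> : [disjoint W & [set u]%SET]%B = false.
    by apply/negbTE/pred0Pn; exists u; rewrite /= !finset.inE eqxx.
  by rewrite !andbF mulr1.
have := @mean_layer_pmf R n P W (star a b) (fun e => (e != W)%:R)
  (fun x y => y * (1 - y * (1 - a)) ^+ (x - 2) * (1 - y * (1 - b)) ^+ (x - 2)) Pn.
rewrite (@eq_mean _ _ _ _ (fun g => a ^+ #|nbrs (edges g) [set v]%SET u| *
      b ^+ #|nbrs (edges g) [set u]%SET v| * (W \in edges g)%:R)); last first.
  move=> g; have [Wg|Wg] := boolP (W \in edges g); last first.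
    rewrite mulr0; have [WV|] := boolP (W \subset nodes g); last by rewrite mul0r.
    rewrite (bigD1 W)/=; last by rewrite finset.inE WV W2.
    by rewrite (negbTE Wg) eqxx mul0r mulr0.
  rewrite (edges_sub_nodes Wg) mul1r mulr1 -!prod_star//;
    try by move=> e; exact: edges_card2.
  rewrite -big_split/= [LHS]big_mkcond [RHS]big_mkcond; apply: eq_bigr => e _.
  case: (boolP (e \in edges g)) => [eg|eg].
    by rewrite (fintype.subsetP (valP g) _ eg).
  by case: ifP => // _; rewrite (_ : e != W)//; apply: contraNneq eg => ->.
rewrite W2; move=> ->//.
- move=> x; apply: measurable_funM; last exact: measurable_retention.
  by apply: measurable_funM => //; exact: measurable_retention.
- move=> x y y01; have /andP[y0 y1] := y01.
  have /andP[r0 r1] := retention_itv a01 y01.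
  have /andP[s0 s1] := retention_itv b01 y01.
  rewrite !mulr_ge0 ?exprn_ge0//=.
  by rewrite !mulr_ile1 ?mulr_ge0 ?exprn_ge0 ?exprn_ile1.
move=> V y WV.
have /andP[uV vV] : (u \in V) && (v \in V) by rewrite -!finset.sub1set -finset.subUset.
have WnV : W \in node_pairs V by rewrite set2_in_node_pairs// uV.
transitivity (\prod_(e in node_pairs V)
    ((if e == W then y else 1) * star (1 - y * (1 - a)) (1 - y * (1 - b)) e)).
  apply: eq_bigr => e /node_pairs_card2 e2; have [->|eW] := eqVneq e W.
    by rewrite !starW /=; ring.
  rewrite /star /=.
  have [ue|ue] := boolP (u \in e); have [ve|ve] := boolP (v \in e) => /=.
  - case/eqP: eW; have [w wu eE] := card2_mem e2 ue.
    move: ve; rewrite eE !finset.inE => /orP[/eqP vu|/eqP vw].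
      by rewrite vu eqxx in uv.
    by rewrite /W vw.
  - by case: ifP => _; ring.
  - by case: ifP => _; ring.
  - by ring.
rewrite big_split/= (bigD1 W)//= eqxx big1 ?mulr1; last first.
  by move=> e /andP[_ /negbTE ->].
rewrite big_split/= !prod_star//; try by move=> e; exact: node_pairs_card2.
rewrite mulrA !nbrs_node_pairs//; congr (_ * _ ^+ _ * _ ^+ _).
- rewrite (cardsD1 u V) uV add1n (cardsD1 v (V :\ u)%SET) !finset.inE vV eq_sym uv.
  by rewrite add1n subn2.
- rewrite (cardsD1 v V) vV add1n (cardsD1 u (V :\ v)%SET) !finset.inE uV uv.
  by rewrite add1n subn2.
Qed.

Lemma mean_link u v : u != v ->
  mean pmf (fun g => ([set u; v]%SET \in edges g)%:R) =
  (\int[P]_(z in strip) ((z.1 ^_ 2)%:R * z.2)) / (n ^_ 2)%:R.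
Proof.
move=> uv; have := @mean_link_degrees u v 1 1 uv.
rewrite lexx ler01 => /(_ isT isT) h.
rewrite (_ : mean _ _ = mean pmf (fun g => 1 ^+ #|nbrs (edges g) [set v]%SET u| *
      1 ^+ #|nbrs (edges g) [set u]%SET v| * ([set u; v]%SET \in edges g)%:R)).
  rewrite h; congr (_ / _); apply: eq_Rintegral => z _.
  by rewrite subrr mulr0 subr0 !expr1n !mulr1.
by apply: eq_mean => g; rewrite !expr1n !mul1r.
Qed.

Lemma layer_pmf_ge0 g : 0 <= pmf g.
Proof.
rewrite mulr_ge0 ?invr_ge0//; apply: Rintegral_ge0 => z sz.
by rewrite mulr_ge0// edge_weight_ge0.
Qed.

Lemma sum_layer_pmf : \sum_g pmf g = 1.
Proof.
have := mean_nodes finset.set0; rewrite cards0 ffactn0 divr1.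
under eq_Rintegral do rewrite ffactn0.
rewrite Rintegral_cst// mul1r [X in fine X](probability_strip Pn).
by rewrite /= => <-; apply: eq_bigr => g _; rewrite finset.sub0set mulr1.
Qed.

End layer_neighbours.

Lemma nbrs_bigcup n (K : finType) (F : K -> {set {set 'I_n}}) Z u :
  nbrs (\bigcup_k F k)%SET Z u = (\bigcup_k nbrs (F k) Z u)%SET.
Proof.
apply/finset.setP => w; rewrite !finset.inE; apply/idP/finset.bigcupP.
  move=> /and3P[wu wZ /finset.bigcupP[k _ wF]]; exists k => //.
  by rewrite finset.inE wu wZ.
move=> [k _]; rewrite finset.inE => /and3P[-> -> wF] /=.
by apply/finset.bigcupP; exists k.
Qed.

Lemma linkedE n (E : {set {set 'I_n}}) (u v : 'I_n) :
  linked E u.+1 v.+1 = ([set u; v]%SET \in E).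
Proof.
apply/existsP/idP => [[u' /existsP[v' /and3P[/eqP[uu] /eqP[vv]]]]|uvE].
  by rewrite (val_inj uu) (val_inj vv).
by exists u; apply/existsP; exists v; rewrite !eqxx.
Qed.

(** The extra unit is the edge to [v]. It yields the factor [a * b] of the generating functions, and
    thus corresponds to [delta_(1,1)] in the limit law. *)
Lemma degreeE n (E : {set {set 'I_n}}) (u v : 'I_n) : u != v ->
  (forall e, e \in E -> #|e| = 2%N) -> [set u; v]%SET \in E ->
  degree E u.+1 = #|nbrs E [set v]%SET u|.+1.
Proof.
move=> uv E2 uvE; rewrite /degree (cardsD1 v) finset.inE linkedE uvE add1n.
congr _.+1; apply: eq_card => w; rewrite !finset.inE linkedE.
have [->|wu] := eqVneq w u; last by [].
(* Here [w = u], and the singleton [[set u; u]] is not an edge. *)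
rewrite /=; apply/negbTE; rewrite negb_and negbK; apply/orP; right.
by apply/negP => /E2; rewrite finset.setUid cards1.
Qed.

(** * The model as a function of its layer graphs *)

Section model.
Variables (R : realType) (n m : nat) (d : measure_display).
Variables (Omega : measurableType d) (Pr : probability Omega R).
Variable (L : 'I_m -> {mfun Omega >-> (nat * R * lgraph n)%type}).
Variables (P : probability (nat * R)%type R).
Hypotheses (Pn : P (strip_upto n) = 1%E) (modL : layer_model Pr L P).
Notation pmf := (@layer_pmf R n P).

Definition layer_graphs (w : Omega) : {ffun 'I_m -> lgraph n} :=
  [ffun k => (L k w).2].

Lemma layer_graphs_preimage G : layer_graphs @^-1` [set G] =
  \bigcap_(k in [set` [fset k | k in 'I_m]%fset]) (L k @^-1` (setT `*` [set G k])).
Proof.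
apply/seteqP; split => [w /= <- k _ /=|w wG]; first by rewrite ffunE.
by apply/ffunP => k; rewrite ffunE; have [] := wG k _; rewrite /= ?inE.
Qed.

Lemma measurable_layer_graphs G : measurable (layer_graphs @^-1` [set G]).
Proof.
rewrite layer_graphs_preimage; apply: fin_bigcap_measurable => // k _.
rewrite -[X in measurable X]setTI; apply: measurable_funPT => //.
exact: measurableX.
Qed.

Lemma layer_graphs_law G :
  Pr (layer_graphs @^-1` [set G]) = (\prod_k pmf (G k))%:E.
Proof.
have Pstrip := probability_strip Pn.
rewrite layer_graphs_preimage (layers_independent modL _ (B := fun k => setT `*` [set G k])).
  rewrite (perm_big (index_enum 'I_m))/=; last first.
    apply: uniq_perm; rewrite ?fset_uniq ?index_enum_uniq// => k.
    by rewrite mem_index_enum !inE.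
  rewrite (eq_bigr (fun k => (pmf (G k))%:E)) ?prodEFin// => k _.
  rewrite -(layer_law _ Pstrip (layer_size_strength modL k) (layer_nodes modL k)
    (layer_edges modL k)).
  by congr (Pr _); apply/seteqP; split => w //= [].
by move=> k; exact: measurableX.
Qed.

Lemma integral_layer_graphs (F : {ffun 'I_m -> lgraph n} -> R) :
  (forall G, 0 <= F G) ->
  (\int[Pr]_w (F (layer_graphs w))%:E =
   (\sum_(G : {ffun 'I_m -> lgraph n}) (\prod_k pmf (G k)) * F G)%:E)%E.
Proof.
move=> F0; transitivity (\int[Pr]_w (\sum_(G : {ffun 'I_m -> lgraph n}) ((F G)%:E *
    (\1_(layer_graphs @^-1` [set G]) w)%:E)))%E.
  apply: eq_integral => w _; rewrite (bigD1 (layer_graphs w))//= big1.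
    by rewrite adde0 indicE mem_set// mule1.
  move=> G /eqP GL; rewrite indicE memNset ?mule0//= => GL'.
  by apply: GL; rewrite GL'.
rewrite ge0_integral_sum//; last 2 first.
- move=> G; apply: measurable_funeM; apply/measurable_EFinP.
  exact/measurable_indic/measurable_layer_graphs.
- by move=> G w _; rewrite mule_ge0// lee_fin.
rewrite -sumEFin; apply: eq_bigr => G _; rewrite ge0_integralZl_EFin//; last first.
  by apply/measurable_EFinP/measurable_indic/measurable_layer_graphs.
rewrite integral_indic//; last exact: measurable_layer_graphs.
by rewrite setIT [X in (_ * X)%E](layer_graphs_law G) -EFinM mulrC.
Qed.

Lemma superpositionE w :
  superposition L w = (\bigcup_k edges (layer_graphs w k))%SET.
Proof. by apply: eq_bigr => k _; rewrite ffunE. Qed.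

Variables (u v : 'I_n).
Hypotheses (u0 : val u = 0%N) (v1 : val v = 1%N).

Definition model_mean (a b : R) : R :=
  superposed_mean m pmf (fun g => nbrs (edges g) [set v]%SET u)
    (fun g => nbrs (edges g) [set u]%SET v)
    (fun g => [set u; v]%SET \in edges g) a b.

Lemma node12_neq : u != v.
Proof. by rewrite -val_eqE u0 v1. Qed.

Lemma integral_linked12 (a b : R) : 0 <= a -> 0 <= b ->
  (\int[Pr]_(w in linked12 L) (a ^+ (bidegree L w).1 * b ^+ (bidegree L w).2)%:E
   = (a * b * model_mean a b)%:E)%E.
Proof.
move=> a0 b0; rewrite integral_mkcond.
pose U (G : {ffun 'I_m -> lgraph n}) := (\bigcup_k edges (G k))%SET.
pose F (G : {ffun 'I_m -> lgraph n}) :=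
  a * b * (a ^+ #|nbrs (U G) [set v]%SET u| * b ^+ #|nbrs (U G) [set u]%SET v|
   * [exists k, [set u; v]%SET \in edges (G k)]%:R).
have UE G : ([set u; v]%SET \in U G) = [exists k, [set u; v]%SET \in edges (G k)].
  by apply/finset.bigcupP/existsP => [[k _ h]|[k h]]; exists k.
transitivity (\int[Pr]_w (F (layer_graphs w))%:E)%E.
  apply: eq_integral => w _; rewrite patchE.
  have link12 : linked (superposition L w) 1 2 = ([set u; v]%SET \in U (layer_graphs w)).
    by rewrite -linkedE u0 v1 superpositionE.
  have [uvU|uvU] := boolP ([set u; v]%SET \in U (layer_graphs w)); last first.
    rewrite memNset; last by rewrite /linked12 /= link12; exact/negP.
    by rewrite /F -UE (negbTE uvU) !mulr0.
  rewrite mem_set; last by rewrite /linked12 /= link12.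
  have U2 e : e \in U (layer_graphs w) -> #|e| = 2%N.
    by move=> /finset.bigcupP[k _]; exact: edges_card2.
  rewrite /F -UE uvU mulr1 /bidegree superpositionE -/(U (layer_graphs w)) /=.
  have -> : degree (U (layer_graphs w)) 1 = #|nbrs (U (layer_graphs w)) [set v]%SET u|.+1.
    by rewrite -(degreeE node12_neq U2 uvU) u0.
  have -> : degree (U (layer_graphs w)) 2 = #|nbrs (U (layer_graphs w)) [set u]%SET v|.+1.
    rewrite -(@degreeE _ _ v u _ U2) ?v1//; first by rewrite eq_sym node12_neq.
    by rewrite finset.setUC.
  by rewrite !exprS mulrACA.
rewrite integral_layer_graphs; last first.
  by move=> G; rewrite !mulr_ge0 ?exprn_ge0.
rewrite /model_mean /superposed_mean mulr_sumr; congr EFin; apply: eq_bigr => G _.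
by rewrite /F /U !nbrs_bigcup mulrCA.
Qed.

Lemma model_bidegree_mean (a b : R) : 0 <= a -> 0 <= b -> 0 < model_mean 1 1 ->
  \int[model_bidegree Pr L]_st (a ^+ st.1 * b ^+ st.2) =
  a * b * model_mean a b / model_mean 1 1.
Proof.
move=> a0 b0 A0; rewrite /Rintegral.
have PrE : Pr (linked12 L) = (model_mean 1 1)%:E.
  have := integral_linked12 ler01 ler01; rewrite mulr1 mul1r => <-.
  under eq_integral do rewrite !expr1n mulr1.
  by rewrite integral_cst ?mul1e//; exact: measurable_linked12.
have mf (D : set (nat * nat)) (f : nat * nat -> R) : measurable_fun D f.
  by move=> _ B _; exact: measurable_nat2.
rewrite ge0_integral_distribution//; last 2 first.
- exact/measurable_EFinP.
- by move=> st; rewrite lee_fin mulr_ge0// exprn_ge0.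
have c0 : 0 <= (model_mean 1 1)^-1 by rewrite invr_ge0 ltW.
have mbi : measurable_fun (linked12 L) (fun w =>
    (a ^+ (bidegree L w).1 * b ^+ (bidegree L w).2)%:E).
  apply/measurable_EFinP; apply: measurable_funTS.
  by apply: (measurableT_comp (mf _ (fun st => a ^+ st.1 * b ^+ st.2))); exact: measurable_bidegree.
have mbT : measurable_fun setT (fun w =>
    (a ^+ (bidegree L w).1 * b ^+ (bidegree L w).2)%:E).
  apply/measurable_EFinP.
  by apply: (measurableT_comp (mf _ (fun st => a ^+ st.1 * b ^+ st.2))); exact: measurable_bidegree.
rewrite (@eq_measure_integral _ _ _ _
  (mscale (NngNum c0) (mrestr Pr (measurable_linked12 L)))); last first.
  move=> A mA _; rewrite /= /mnormalize /mscale /= /mrestr !setTI PrE /=.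
  (* The conditioning event has positive probability, so [mnormalize] divides by it instead of
     falling back on [Pr]. *)
  by rewrite eqe (gt_eqF A0) /= muleC.
rewrite ge0_integral_mscale//=; last first.
  by move=> w _; rewrite lee_fin mulr_ge0// exprn_ge0.
rewrite ge0_integral_mrestr//; last first.
  by move=> w _; rewrite lee_fin mulr_ge0// exprn_ge0.
rewrite setTI integral_linked12//=.
by rewrite mulrC.
Qed.

End model.

(** * Limit of the model *)

Section weak_limits.
Variables (R : realType).
Implicit Types (f h : nat * R -> R).

(** The first coordinate is discrete, so only the slices matter. *)
Lemma continuous_strip f : (forall x, continuous (fun y => f (x, y))) ->
  {within strip, continuous f}.
Proof.
move=> fc; apply: continuous_subspaceT => -[x y] B /fc fB.
exists ([set x], (fun y' => f (x, y')) @^-1` B) => /=.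
  by split => //; exact: discrete_set1.
by move=> [x' y'] /= [->].
Qed.

Lemma measurable_slices f D : measurable D ->
  (forall x, continuous (fun y => f (x, y))) -> measurable_fun D f.
Proof.
by move=> mD fc; apply: measurable_fun_natM => // x; exact: continuous_measurable_fun.
Qed.

Lemma truncated_integral d (T : measurableType d) (mu : {measure set T -> \bar R})
    (D : set T) (f : T -> R) (r : \bar R) :
  measurable D -> measurable_fun D f -> (forall z, D z -> 0 <= f z) ->
  (r < \int[mu]_(z in D) (f z)%:E)%E ->
  exists K : nat, (r < \int[mu]_(z in D) (Num.min (f z) K%:R)%:E)%E.
Proof.
move=> mD mf f0 rf; apply: contrapT => /forallNP hK.
suff : (\int[mu]_(z in D) (f z)%:E <= r)%E by rewrite leNgt rf.
pose g (K : nat) z := (Num.min (f z) K%:R)%:E.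
have mg K : measurable_fun D (g K) by apply/measurable_EFinP; exact: measurable_minr.
have g0 K z : D z -> (0 <= g K z)%E by move=> Dz; rewrite lee_fin le_min f0//=.
have ndg z : D z -> {homo g ^~ z : a b / (a <= b)%N >-> (a <= b)%E}.
  by move=> _ a b ab; rewrite lee_fin le_min ge_min lexx ge_min ler_nat ab orbT.
have cg := @cvg_monotone_convergence _ T R mu D mD g mg g0 ndg.
have gE : (\int[mu]_(z in D) limn (g^~ z) = \int[mu]_(z in D) (f z)%:E)%E.
  apply: eq_integral => z _; apply/cvg_lim => //; apply: cvg_near_cst.
  near=> K; rewrite /g; congr EFin; apply: min_idPl.
  by near: K; exact: nbhs_infty_ger.
rewrite -gE; move/cvg_lim : cg => <- //.
apply: lime_le; last by apply: nearW => K; rewrite leNgt; apply/negP/hK.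
apply: ereal_nondecreasing_is_cvgn => a b ab.
by apply: ge0_le_integral => // z Dz; [exact: g0|exact: ndg].
Unshelve. all: by end_near. Qed.

Lemma eventually_gt (u : nat -> \bar R) (l r : \bar R) :
  u n @[n --> \oo] --> l -> (r < l)%E -> \forall n \near \oo, (r < u n)%E.
Proof.
move=> ul rl; apply: (ul [set x | (r < x)%E]); apply: open_nbhs_nbhs; split => //.
exact: open_ereal_gt_ereal.
Qed.

Lemma eventually_lt (u : nat -> \bar R) (l r : \bar R) :
  u n @[n --> \oo] --> l -> (l < r)%E -> \forall n \near \oo, (u n < r)%E.
Proof.
move=> ul rl; apply: (ul [set x | (x < r)%E]); apply: open_nbhs_nbhs; split => //.
exact: open_ereal_lt_ereal.
Qed.

Variables (Pn : nat -> probability (nat * R)%type R) (P : probability (nat * R)%type R).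
Hypothesis PnP : weakly_converges Pn P.

(** A Fatou lemma for weak convergence: truncation at a large [K] gives a bounded test function
    whose integral under [P] still exceeds [r]. *)
Lemma weak_liminf f (r : \bar R) :
  (forall x, continuous (fun y => f (x, y))) -> (forall z, strip z -> 0 <= f z) ->
  (r < \int[P]_(z in strip) (f z)%:E)%E ->
  \forall n \near \oo, (r < \int[Pn n]_(z in strip) (f z)%:E)%E.
Proof.
move=> fc f0 rf.
have mf : measurable_fun strip f by exact: measurable_slices.
have [K rK] := truncated_integral measurable_strip mf f0 rf.
have mc x : continuous (fun y => Num.min (f (x, y)) K%:R).
  by move=> y; have := @continuous_min R R (fun y => f (x, y)) (fun=> K%:R) y (fc x y)
    (@cst_continuous R R^o K%:R y).
have cK : (\int[Pn n]_(z in strip) (Num.min (f z) K%:R)%:E @[n --> \oo] -->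
    \int[P]_(z in strip) (Num.min (f z) K%:R)%:E)%E.
  apply: PnP; first exact: continuous_strip.
  exists K%:R => z sz; rewrite ger0_norm ?ge_min ?lexx ?orbT//.
  by rewrite le_min f0/=.
near=> n; have : (r < \int[Pn n]_(z in strip) (Num.min (f z) K%:R)%:E)%E.
  by near: n; exact: (eventually_gt cK).
move=> /lt_le_trans; apply; apply: ge0_le_integral => //.
- by move=> z sz; rewrite lee_fin le_min f0/=.
- by apply/measurable_EFinP; apply: measurable_minr.
- exact/measurable_EFinP.
- by move=> z sz; rewrite lee_fin ge_min lexx.
Unshelve. all: by end_near. Qed.

(** As in the passage from Fatou to dominated convergence, the lower bound applies to [f] and to
    [h - f], and the convergence of the integrals of [h] turns the second into an upper bound for
    [f]. *)
Lemma dominated_weak_limit f h :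
  (forall x, continuous (fun y => f (x, y))) ->
  (forall x, continuous (fun y => h (x, y))) ->
  (forall z, strip z -> 0 <= f z <= h z) ->
  (\int[P]_(z in strip) (h z)%:E < +oo)%E ->
  (\int[Pn n]_(z in strip) (h z)%:E @[n --> \oo] --> \int[P]_(z in strip) (h z)%:E)%E ->
  \int[Pn n]_(z in strip) f z @[n --> \oo] --> \int[P]_(z in strip) f z.
Proof.
move=> fc hc fh Ph hlim.
have mf : measurable_fun strip f by exact: measurable_slices.
have mh : measurable_fun strip h by exact: measurable_slices.
have f0 z : strip z -> 0 <= f z by move=> /fh/andP[].
have h0 z : strip z -> 0 <= h z by move=> /fh/andP[/le_trans]; apply.
have hf0 z : strip z -> 0 <= h z - f z by move=> /fh/andP[_]; rewrite subr_ge0.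
have intgr (Q : probability (nat * R)%type R) :
    (\int[Q]_(z in strip) (h z)%:E < +oo)%E ->
    Q.-integrable strip (EFin \o h) /\ Q.-integrable strip (EFin \o f).
  move=> Qh; have ih : Q.-integrable strip (EFin \o h).
    apply/integrableP; split; first exact/measurable_EFinP.
    rewrite (eq_integral (fun z => (h z)%:E))// => z /set_mem sz /=.
    by rewrite ger0_norm ?h0.
  split => //; apply: (le_integrable measurable_strip _ _ ih).
    exact/measurable_EFinP.
  move=> z sz /=; have /andP[a b] := fh z sz.
  by rewrite lee_fin !ger0_norm// h0.
have [ih if_] := intgr _ Ph.
have hfc x : continuous (fun y => h (x, y) - f (x, y)).
  by move=> y; apply: continuousB; [exact: hc|exact: fc].
have EI (Q : probability (nat * R)%type R) (k : nat * R -> R) :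
    Q.-integrable strip (EFin \o k) ->
    (\int[Q]_(z in strip) (k z)%:E = (\int[Q]_(z in strip) k z)%:E)%E.
  by move=> ik; rewrite /Rintegral fineK//; exact: integrable_fin_num.
apply/cvgrPdist_lt => e e0.
have e20 : 0 < e / 2 by rewrite divr_gt0.
have lowf := @weak_liminf f (\int[P]_(z in strip) f z - e / 2)%:E fc f0.
have lowhf := @weak_liminf (fun z => h z - f z)
  (\int[P]_(z in strip) (h z - f z) - e / 2)%:E hfc hf0.
have {}lowf : \forall n \near \oo,
    ((\int[P]_(z in strip) f z - e / 2)%:E < \int[Pn n]_(z in strip) (f z)%:E)%E.
  by apply: lowf; rewrite EI// lte_fin ltrBlDr ltrDl.
have ihf : P.-integrable strip (EFin \o (fun z => h z - f z)).
  by apply: (integrableB measurable_strip ih if_).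
have {}lowhf : \forall n \near \oo,
    ((\int[P]_(z in strip) (h z - f z) - e / 2)%:E <
     \int[Pn n]_(z in strip) (h z - f z)%:E)%E.
  by apply: lowhf; rewrite EI// lte_fin ltrBlDr ltrDl.
have uph : \forall n \near \oo, (\int[Pn n]_(z in strip) (h z)%:E <
    (\int[P]_(z in strip) h z + e / 2)%:E)%E.
  by apply: (eventually_lt hlim); rewrite EI// lte_fin ltrDl.
near=> n.
have hn : (\int[Pn n]_(z in strip) (h z)%:E < (\int[P]_(z in strip) h z + e / 2)%:E)%E.
  by near: n.
have [inh inf_] := intgr (Pn n) (lt_trans hn (ltry _)).
have inhf : (Pn n).-integrable strip (EFin \o (fun z => h z - f z)).
  by apply: (integrableB measurable_strip inh inf_).
have fn : ((\int[P]_(z in strip) f z - e / 2)%:E < \int[Pn n]_(z in strip) (f z)%:E)%E.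
  by near: n.
have hfn : ((\int[P]_(z in strip) (h z - f z) - e / 2)%:E <
     \int[Pn n]_(z in strip) (h z - f z)%:E)%E by near: n.
move: hn fn hfn; rewrite !EI// !lte_fin !RintegralB// => hn fn hfn.
rewrite ltr_norml; apply/andP; split; lra.
Unshelve. all: by end_near. Qed.

End weak_limits.

Lemma cvg_invn (R : realType) : (n%:R^-1 : R) @[n --> \oo] --> 0.
Proof. by rewrite -cvg_shiftS; exact: cvg_harmonic. Qed.

Section weak_limits_size.
Variables (R : realType).
Variables (Pn : nat -> probability (nat * R)%type R) (P : probability (nat * R)%type R).
Hypotheses (PnP : weakly_converges Pn P) (Pn1 : forall n, Pn n (strip_upto n) = 1%E).

(** For [X <= n], [X ^ 2 <= K X + n (X - min (X, K))]. After division by [n] the first term vanishes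
    for fixed [K], and the second tends to the mean excess over [K] of the limiting size, which is
    small for large [K]. *)
Lemma size_square_negligible :
  (\int[P]_(z in strip) (z.1%:R)%:E < +oo)%E ->
  (\int[Pn n]_(z in strip) (z.1%:R)%:E @[n --> \oo] -->
     \int[P]_(z in strip) (z.1%:R)%:E)%E ->
  (\int[Pn n]_(z in strip) (z.1 ^_ 2)%:R) / n%:R @[n --> \oo] --> (0 : R).
Proof.
move=> Px Pnx; pose h (z : nat * R) : R := z.1%:R.
have ch x : continuous (fun y => h (x, y)) by move=> y; exact: cst_continuous.
have mh D : measurable D -> measurable_fun D h.
  by move=> mD; exact: measurable_slices.
have h0 z : 0 <= h z by [].
have hlim : \int[Pn n]_(z in strip) h z @[n --> \oo] --> \int[P]_(z in strip) h z.
  by apply: (dominated_weak_limit PnP ch ch) => // z _; rewrite h0 lexx.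
have ih : P.-integrable strip (EFin \o h).
  apply/integrableP; split; first by apply/measurable_EFinP; exact: mh.
  rewrite (eq_integral (fun z => (h z)%:E))// => z _ /=.
  by rewrite ger0_norm.
apply/cvgrPdist_lt => e e0; have e20 : 0 < e / 2 by rewrite divr_gt0.
have [K PK] : exists K : nat, ((\int[P]_(z in strip) h z - e / 2)%:E <
    \int[P]_(z in strip) (Num.min (h z) K%:R)%:E)%E.
  apply: truncated_integral => //; first exact: mh.
  rewrite -[ltRHS]fineK; last exact: (integrable_fin_num measurable_strip ih).
  by rewrite lte_fin ltrBlDr ltrDl.
pose t (z : nat * R) : R := Num.min (h z) K%:R; pose f z := h z - t z.
have ct x : continuous (fun y => t (x, y)) by move=> y; exact: cst_continuous.
have cf x : continuous (fun y => f (x, y)) by move=> y; exact: cst_continuous.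
have t0 z : 0 <= t z by rewrite le_min h0/=.
have th z : t z <= h z by rewrite ge_min lexx.
have tK z : t z <= K%:R by rewrite ge_min lexx orbT.
have f0 z : 0 <= f z by rewrite subr_ge0.
have fh z : f z <= h z by rewrite gerBl.
have flim : \int[Pn n]_(z in strip) f z @[n --> \oo] --> \int[P]_(z in strip) f z.
  by apply: (dominated_weak_limit PnP cf ch) => // z _; rewrite f0 fh.
have it : P.-integrable strip (EFin \o t).
  apply: (@probability_integrable _ _ _ _ _ _ K%:R) => //; first exact: measurable_slices.
  by move=> z _; rewrite ger0_norm.
have Pf : \int[P]_(z in strip) f z < e / 2.
  rewrite RintegralB//; move: PK.
  rewrite -[ltRHS]fineK; last exact: (integrable_fin_num measurable_strip it).
  by rewrite lte_fin -/(Rintegral _ _ _) -/t; lra.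
have bound n : (0 < n)%N -> (\int[Pn n]_(z in strip) (z.1 ^_ 2)%:R) / n%:R <=
    (\int[Pn n]_(z in strip) h z) * K%:R / n%:R + \int[Pn n]_(z in strip) f z.
  move=> n0; have n0' : 0 < n%:R :> R by rewrite ltr0n.
  have mff : measurable_fun strip f by exact: measurable_slices.
  have mfact (D : set (nat * R)) : measurable D -> measurable_fun D
      (fun z : nat * R => (z.1 ^_ 2)%:R : R).
    by move=> mD; apply: measurable_slices => // x y; exact: cst_continuous.
  rewrite !(strip_upto_integral (Pn1 n))//; [|exact: mh|exact: mfact].
  have ibnd (k : nat * R -> R) (M : R) : (forall x, continuous (fun y => k (x, y))) ->
      (forall z, strip_upto n z -> `|k z| <= M) ->
      (Pn n).-integrable (strip_upto n) (EFin \o k).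
    by move=> ck kM; apply: probability_integrable kM => //; exact: measurable_slices.
  have ihn : (Pn n).-integrable (strip_upto n) (EFin \o h).
    apply: (ibnd _ n%:R) => // z [zn _]; rewrite ger0_norm//.
    by rewrite ler_nat.
  have ifn : (Pn n).-integrable (strip_upto n) (EFin \o f).
    apply: (ibnd _ n%:R) => // z [zn _]; rewrite ger0_norm//.
    by rewrite (le_trans (fh z))// ler_nat.
  have i1 : (Pn n).-integrable (strip_upto n) (EFin \o (fun z => K%:R * h z)).
    exact: integrable_EFinZl.
  have i2 : (Pn n).-integrable (strip_upto n) (EFin \o (fun z => n%:R * f z)).
    exact: integrable_EFinZl.
  have -> : (\int[Pn n]_(z in strip_upto n) h z) * K%:R / n%:R +
      \int[Pn n]_(z in strip_upto n) f z =
      (\int[Pn n]_(z in strip_upto n) (K%:R * h z + n%:R * f z)) / n%:R.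
    rewrite (RintegralD (measurable_strip_upto n) i1 i2) !RintegralZl// mulrDl (mulrC K%:R); congr (_ + _).
    by rewrite mulrC mulKf// gt_eqF.
  rewrite ler_pM2r ?invr_gt0//; apply: le_Rintegral => //.
  - apply: (ibnd _ (n%:R * n%:R)) => [x y|z [zn _]]; first exact: cst_continuous.
    rewrite ger0_norm// -natrM ler_nat ffactnSr ffactn1.
    by rewrite leq_mul// (leq_trans (leq_subr _ _)).
  - exact: (integrableD (measurable_strip_upto n) i1 i2).
  move=> z [zn _]; rewrite /f; apply: (@le_trans _ _ (h z * h z)).
    by rewrite /h -natrM ler_nat ffactnSr ffactn1 leq_mul// leq_subr.
  have hn : h z <= n%:R by rewrite ler_nat.
  have hz := h0 z; have tz := th z; have tKz := tK z.
  by move: (h z) (t z) hn hz tz tKz => a b *; nra.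
have b1 : (\int[Pn n]_(z in strip) h z) * K%:R / n%:R +
    \int[Pn n]_(z in strip) f z @[n --> \oo] -->
    (\int[P]_(z in strip) h z) * K%:R * 0 + \int[P]_(z in strip) f z.
  apply: cvgD => //; apply: cvgM; first by apply: cvgM => //; exact: cvg_cst.
  exact: cvg_invn.
rewrite mulr0 add0r in b1.
have b2 : \forall n \near \oo, (\int[Pn n]_(z in strip) h z) * K%:R / n%:R +
    \int[Pn n]_(z in strip) f z < e / 2 by apply: cvgr_lt b1 _ Pf.
near=> n; have n0 : (0 < n)%N by near: n; exact: nbhs_infty_gt.
rewrite sub0r normrN ger0_norm; last first.
  by rewrite divr_ge0//; apply: Rintegral_ge0.
apply: (le_lt_trans (bound n n0)); apply: (@lt_trans _ _ (e / 2)); last by lra.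
by near: n.
Unshelve. all: by end_near. Qed.

End weak_limits_size.

(** * Error bounds in terms of the moments of one layer *)

Section model_bound.
Variables (R : realType) (n m : nat).
Variables (P : probability (nat * R)%type R).
Hypothesis (Pn : P (strip_upto n) = 1%E).
Variables (u v : 'I_n).
Hypothesis uv : u != v.
Notation pmf := (@layer_pmf R n P).
Notation N1 := (fun g : lgraph n => nbrs (edges g) [set v]%SET u).
Notation N2 := (fun g : lgraph n => nbrs (edges g) [set u]%SET v).

Let pmf_ge0 := @layer_pmf_ge0 R n P.
Let pmf_sum1 := sum_layer_pmf Pn.

Lemma nbrs_subset (F : {set {set 'I_n}}) Z w :
  nbrs F Z w \subset nbrs F finset.set0 w.
Proof.
apply/fintype.subsetP => x; rewrite !finset.inE => /and3P[-> _ ->].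
by rewrite andbT.
Qed.

Lemma nbrs_node g Z (w : 'I_n) : nbrs (edges g) Z w != finset.set0 -> w \in nodes g.
Proof.
move=> /finset.set0Pn[x]; rewrite finset.inE => /and3P[_ _ /edges_sub_nodes].
by rewrite finset.subUset finset.sub1set => /andP[].
Qed.

(** Being a neighbour requires a link, and a layer links every pair of distinct nodes with the same
    probability. *)
Lemma mean_nbrs_sq (w z : 'I_n) : w != z ->
  \sum_x mean pmf (fun g => (x \in nbrs (edges g) [set z]%SET w)%:R) ^+ 2 <=
  n%:R * ((\int[P]_(s in strip) ((s.1 ^_ 2)%:R * s.2)) / (n ^_ 2)%:R) ^+ 2.
Proof.
move=> wz; rewrite mulr_natl -[X in _ *+ X]card_ord -sumr_const; apply: ler_sum => x _.
have l0 : 0 <= (\int[P]_(s in strip) ((s.1 ^_ 2)%:R * s.2)) / (n ^_ 2)%:R.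
  by rewrite -(mean_link Pn wz) mean_ge0.
rewrite ler_pXn2r ?nnegrE ?mean_ge0//.
have [->|xw] := eqVneq x w.
  rewrite (@eq_mean _ _ _ _ (fun=> 0)) ?mean_cst// => g.
  by rewrite finset.inE eqxx.
rewrite eq_sym in xw; rewrite -(mean_link Pn xw); apply: le_mean => // g.
by rewrite ler_nat finset.inE; case: (_ \in edges g); rewrite ?andbF ?leq_b1.
Qed.

(** Without the exclusion of [z] the mean is exact, by [mean_degree]; the exclusion changes the
    neighbourhood only if the layer links [w] and [z]. *)
Lemma mean_escape (w z : 'I_n) (a : R) : w != z -> 0 <= a <= 1 ->
  `|mean pmf (fun g => 1 - a ^+ #|nbrs (edges g) [set z]%SET w|) -
    ((\int[P]_(s in strip) s.1%:R) -
     (\int[P]_(s in strip) (s.1%:R * (1 - s.2 * (1 - a)) ^+ (s.1 - 1)))) / n%:R|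
  <= (\int[P]_(s in strip) ((s.1 ^_ 2)%:R * s.2)) / (n ^_ 2)%:R.
Proof.
move=> wz a01; have /andP[a0 a1] := a01.
have -> : ((\int[P]_(s in strip) s.1%:R) -
     (\int[P]_(s in strip) (s.1%:R * (1 - s.2 * (1 - a)) ^+ (s.1 - 1)))) / n%:R =
    mean pmf (fun g => 1 - a ^+ #|nbrs (edges g) finset.set0 w|).
  rewrite mulrBl -(mean_degree Pn w a01).
  have := mean_nodes Pn [set w]%SET; rewrite cards1 ffactn1.
  under eq_Rintegral do rewrite ffactn1.
  move=> <-; rewrite -meanB; apply: eq_mean => g; rewrite finset.sub1set.
  have [wg|wg] := boolP (w \in nodes g); first by rewrite mul1r.
  (* A node outside the layer has no neighbours, so its power is 1 and the difference vanishes. *)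
  suff -> : nbrs (edges g) finset.set0 w = finset.set0.
    by rewrite cards0 expr0 mulr1 !subrr.
  by apply/eqP; apply: contraNT wg => /nbrs_node.
have E (A A0 : R) : 1 - A - (1 - A0) = A0 - A by ring.
rewrite -meanB -(mean_link Pn wz) ler_norml; apply/andP; split; last first.
  apply: le_mean => // g; rewrite E; apply: (@le_trans _ _ 0) => //.
  rewrite subr_le0; apply: ler_wiXn2l => //.
  exact: subset_leq_card (nbrs_subset _ _ _).
rewrite lerNl -[leLHS]sub0r -{1}(mean_cst pmf_sum1 0) -meanB; apply: le_mean => // g.
rewrite E sub0r opprB.
have [wzg|wzg] := boolP ([set w; z]%SET \in edges g).
  by rewrite lerBlDr (le_trans (exprn_ile1 _ a0 a1))// lerDl exprn_ge0.
suff -> : nbrs (edges g) finset.set0 w = nbrs (edges g) [set z]%SET w.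
  by rewrite subrr.
apply/finset.setP => x; rewrite !finset.inE.
have [->|] := eqVneq x z; last by [].
by rewrite (negbTE wzg) !andbF.
Qed.

(** The generic errors are rewritten in moments. Of the three copies of [m l], one comes from the
    expansion in [w], and two from [mean_escape], one for each node. *)
Lemma model_mean_approx (a b : R) : 0 <= a <= 1 -> 0 <= b <= 1 ->
  let l := (\int[P]_(z in strip) ((z.1 ^_ 2)%:R * z.2)) / (n ^_ 2)%:R in
  let h := (\int[P]_(z in strip) ((z.1 ^_ 2)%:R * (z.2 *
     (1 - z.2 * (1 - a)) ^+ (z.1 - 2) * (1 - z.2 * (1 - b)) ^+ (z.1 - 2))))
     / (n ^_ 2)%:R in
  let x := \int[P]_(z in strip) z.1%:R in
  let G a := \int[P]_(z in strip) (z.1%:R * (1 - z.2 * (1 - a)) ^+ (z.1 - 1)) in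
  let B := 2 * x / n%:R in
  let r := (\int[P]_(z in strip) (z.1 ^_ 2)%:R) / (n ^_ 2)%:R in
  (`|model_mean m P u v a b -
     m%:R * h * expR (- (m%:R / n%:R * ((x - G a) + (x - G b))))| <=
   m%:R * l * (3 * (m%:R * l) + B + m%:R * B ^+ 2 +
     m%:R * (2 * (Num.sqrt n%:R * l) + r)) : Prop).
Proof.
move=> a01 b01 l h x G B r; have /andP[a0 a1] := a01; have /andP[b0 b1] := b01.
have vu : v != u by rewrite eq_sym.
have := @superposed_mean_approx R _ _ m pmf N1 N2
  (fun g => [set u; v]%SET \in edges g) pmf_ge0 pmf_sum1 a b a01 b01.
rewrite /= (mean_link Pn uv) (mean_link_degrees Pn uv a01 b01) -/l -/h.
set lam := mean pmf (fun g => 1 - a ^+ #|N1 g|) + mean pmf (fun g => 1 - b ^+ #|N2 g|).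
set B' := mean pmf (fun g => (N1 g != finset.set0)%:R) +
  mean pmf (fun g => (N2 g != finset.set0)%:R).
set k1 := (X in Num.sqrt X + _); set k2 := (X in _ + Num.sqrt X); set r' := mean _ _.
rewrite -/(model_mean m P u v a b) => approx.
have l0 : 0 <= l by rewrite /l -(mean_link Pn uv) mean_ge0.
have h0 : 0 <= h.
  rewrite /h -(mean_link_degrees Pn uv a01 b01); apply: mean_ge0 => // g.
  by rewrite !mulr_ge0// exprn_ge0.
have hl : h <= l.
  rewrite /h -(mean_link_degrees Pn uv a01 b01) /l -(mean_link Pn uv).
  apply: le_mean => // g; rewrite ler_piMl// mulr_ile1 ?exprn_ge0//;
  by rewrite exprn_ile1.
have m0 : 0 <= m%:R :> R by [].
have nodeE (w : 'I_n) : mean pmf (fun g => (w \in nodes g)%:R) = x / n%:R.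
  have := mean_nodes Pn [set w]%SET; rewrite cards1 ffactn1.
  under eq_Rintegral do rewrite ffactn1.
  by move=> <-; apply: eq_mean => g; rewrite finset.sub1set.
have BB : B' <= B.
  rewrite /B -mulrA mulr_natl mulr2n; apply: lerD; [rewrite -(nodeE u)|rewrite -(nodeE v)];
    by apply: le_mean => // g; rewrite ler_nat; case: (boolP (_ == _)) => //= /nbrs_node ->.
have B'0 : 0 <= B' by rewrite addr_ge0 ?mean_ge0.
(* Two nonempty neighbourhoods require both nodes in the layer, an event of probability [r]. *)
have rr : r' <= r.
  rewrite /r -(_ : #|[set u; v]%SET| = 2%N); last by rewrite cards2 uv.
  rewrite -(mean_nodes Pn); apply: le_mean => // g; rewrite ler_nat.
  rewrite finset.subUset !finset.sub1set.
  have [/=|/nbrs_node ->] := eqVneq (nbrs (edges g) [set v]%SET u) finset.set0; first by [].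
  by have [/=|/nbrs_node ->] := eqVneq (nbrs (edges g) [set u]%SET v) finset.set0.
have r'0 : 0 <= r' by rewrite mean_ge0.
have sq (k : R) : k <= n%:R * l ^+ 2 -> Num.sqrt k <= Num.sqrt n%:R * l.
  by move=> /ler_wsqrtr/le_trans; apply; rewrite sqrtrM// sqrtr_sqr ger0_norm.
have s1 : Num.sqrt k1 <= Num.sqrt n%:R * l by apply/sq/mean_nbrs_sq.
have s2 : Num.sqrt k2 <= Num.sqrt n%:R * l by apply/sq/mean_nbrs_sq.
set lam' := (x - G a) + (x - G b).
have lamE : `|lam - lam' / n%:R| <= 2 * l.
  rewrite /lam' mulrDl opprD addrACA; apply: le_trans (ler_normD _ _) _.
  rewrite mulr_natl mulr2n; apply: lerD; first exact: mean_escape.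
  by apply: le_trans (mean_escape vu b01) _.
have lam0 : 0 <= lam.
  by rewrite addr_ge0 ?mean_ge0// => g; rewrite subr_ge0 exprn_ile1.
have Gx (c : R) : 0 <= c <= 1 -> 0 <= (x - G c) / n%:R.
  move=> c01; have /andP[c0 c1] := c01.
  rewrite mulrBl -(nodeE u) -(mean_degree Pn u c01) -meanB mean_ge0// => g.
  case: (u \in nodes g); last by rewrite mul0r subrr.
  by rewrite mul1r subr_ge0 exprn_ile1.
have lam'0 : 0 <= lam' / n%:R by rewrite mulrDl addr_ge0// Gx.
have -> : m%:R / n%:R * lam' = m%:R * (lam' / n%:R) by rewrite mulrAC mulrA.
have step2 : `|m%:R * h * expR (- (m%:R * lam)) -
    m%:R * h * expR (- (m%:R * (lam' / n%:R)))| <= m%:R * l * (2 * (m%:R * l)).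
  rewrite -mulrBr normrM (ger0_norm (mulr_ge0 m0 h0)); apply: ler_pM => //.
  - exact: mulr_ge0.
  - by rewrite ler_wpM2l.
  apply: le_trans (norm_expRN_sub (mulr_ge0 m0 lam0) (mulr_ge0 m0 lam'0)) _.
  by rewrite -mulrBr normrM ger0_norm// mulrCA ler_wpM2l.
apply: le_trans (ler_distD (m%:R * h * expR (- (m%:R * lam))) _ _) _.
apply: le_trans (lerD approx step2) _.
rewrite -mulrDr; apply: ler_wpM2l; first exact: mulr_ge0.
have B2 : m%:R * B' ^+ 2 <= m%:R * B ^+ 2.
  by rewrite ler_wpM2l// ler_pXn2r// nnegrE// (le_trans B'0).
have sr : m%:R * (Num.sqrt k1 + Num.sqrt k2 + r') <=
    m%:R * (2 * (Num.sqrt n%:R * l) + r) by rewrite ler_wpM2l// mulr_natl mulr2n !lerD.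
have E (p q s t : R) : 3 * p + q + s + t = p + q + s + t + 2 * p by ring.
by rewrite [leRHS]E lerD2r !lerD.
Qed.

End model_bound.

(** * Convergence of the generating function of the model *)

Section model_limit.
Variables (R : realType) (mu : R) (m : nat -> nat).
Variables (Pn : nat -> probability (nat * R)%type R) (P : probability (nat * R)%type R).
Variables (d : nat -> measure_display) (Omega : forall n, measurableType (d n)).
Variables (Pr : forall n, probability (Omega n) R).
Variables (L : forall n, 'I_(m n) -> {mfun (Omega n) >-> (nat * R * lgraph n)%type}).
Hypotheses (mn : (m n)%:R / n%:R @[n --> \oo] --> mu)
  (Pn1 : forall n, Pn n (strip_upto n) = 1%E) (PnP : weakly_converges Pn P)
  (P10n : cross_moment (Pn n) 1 0 @[n --> \oo] --> cross_moment P 1 0)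
  (P21n : cross_moment (Pn n) 2 1 @[n --> \oo] --> cross_moment P 2 1)
  (P10y : (cross_moment P 1 0 < +oo)%E) (P21y : (cross_moment P 2 1 < +oo)%E)
  (modL : forall n, layer_model (Pr n) (@L n) (Pn n)).

Definition mean_size (Q : probability (nat * R)%type R) : R :=
  \int[Q]_(z in strip) z.1%:R.

Definition mean_edges (Q : probability (nat * R)%type R) : R :=
  \int[Q]_(z in strip) ((z.1 ^_ 2)%:R * z.2).

(** Divided by [mean_size], this is the generating function of the summand law [g]; likewise
    [edge_biased_pgf] divided by [mean_edges] is that of [f_2']. *)
Definition size_biased_pgf (Q : probability (nat * R)%type R) (a : R) : R :=
  \int[Q]_(z in strip) (z.1%:R * (1 - z.2 * (1 - a)) ^+ (z.1 - 1)).

Definition edge_biased_pgf (Q : probability (nat * R)%type R) (a b : R) : R :=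
  \int[Q]_(z in strip) ((z.1 ^_ 2)%:R * (z.2 *
    (1 - z.2 * (1 - a)) ^+ (z.1 - 2) * (1 - z.2 * (1 - b)) ^+ (z.1 - 2))).

Lemma cross_moment10 (Q : probability (nat * R)%type R) :
  cross_moment Q 1 0 = (\int[Q]_(z in strip) (z.1%:R)%:E)%E.
Proof. by apply: eq_integral => z _; rewrite ffactn1 expr0 mulr1. Qed.

Lemma cross_moment21 (Q : probability (nat * R)%type R) :
  cross_moment Q 2 1 = (\int[Q]_(z in strip) ((z.1 ^_ 2)%:R * z.2)%:E)%E.
Proof. by apply: eq_integral => z _; rewrite expr1. Qed.

Lemma continuous_retention (a : R) k : continuous (fun y : R => (1 - y * (1 - a)) ^+ k).
Proof.
move=> y; apply: (@continuous_comp R R R (fun y => 1 - y * (1 - a)) (fun t => t ^+ k)).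
  apply: continuousB; first exact: cst_continuous.
  by apply: continuousM; [exact: cvg_id|exact: cst_continuous].
exact: exprn_continuous.
Qed.

Let dom10 (f : nat * R -> R) (fc : forall x, continuous (fun y : R => f (x, y)))
  (f01 : forall z : nat * R, strip z -> 0 <= f z <= z.1%:R) :
  \int[Pn n]_(z in strip) f z @[n --> \oo] --> \int[P]_(z in strip) f z.
Proof.
apply: (dominated_weak_limit PnP fc (h := fun z : nat * R => z.1%:R)) => //.
- by move=> x y; exact: cst_continuous.
- by rewrite -cross_moment10.
- by rewrite -cross_moment10; under eq_fun do rewrite -cross_moment10.
Qed.

Lemma mean_size_limit : mean_size (Pn n) @[n --> \oo] --> mean_size P.
Proof. by apply: dom10 => [x y|z _]; [exact: cst_continuous|rewrite lexx ler0n]. Qed.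

Lemma mean_size2_limit :
  (\int[Pn n]_(z in strip) (z.1 ^_ 2)%:R) / n%:R @[n --> \oo] --> (0 : R).
Proof.
apply: (size_square_negligible PnP Pn1); first by rewrite -cross_moment10.
by rewrite -cross_moment10; under eq_fun do rewrite -cross_moment10.
Qed.

Lemma size_biased_pgf_limit (a : R) : 0 <= a <= 1 ->
  size_biased_pgf (Pn n) a @[n --> \oo] --> size_biased_pgf P a.
Proof.
move=> a01; apply: dom10 => [x|z sz].
  by move=> /= y; apply: cvgM; [exact: cvg_cst|exact: continuous_retention].
have /andP[r0 r1] := retention_itv a01 sz.
by rewrite mulr_ge0 ?exprn_ge0//= ler_piMr// exprn_ile1.
Qed.

Lemma edge_biased_pgf_limit (a b : R) : 0 <= a <= 1 -> 0 <= b <= 1 ->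
  edge_biased_pgf (Pn n) a b @[n --> \oo] --> edge_biased_pgf P a b.
Proof.
move=> a01 b01.
apply: (dominated_weak_limit PnP (h := fun z : nat * R => (z.1 ^_ 2)%:R * z.2)).
- move=> x /= y; apply: cvgM; first exact: cvg_cst.
  apply: cvgM; last exact: continuous_retention.
  by apply: cvgM; [exact: cvg_id|exact: continuous_retention].
- by move=> x /= y; apply: cvgM; [exact: cvg_cst|exact: cvg_id].
- move=> z sz; have /andP[z0 z1] := sz.
  have /andP[r0 r1] := retention_itv a01 sz; have /andP[s0 s1] := retention_itv b01 sz.
  rewrite !mulr_ge0 ?exprn_ge0//= ler_wpM2l// -mulrA ler_piMr//.
  by rewrite mulr_ile1 ?exprn_ge0// exprn_ile1.
- by rewrite -cross_moment21.
- by rewrite -cross_moment21; under eq_fun do rewrite -cross_moment21.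
Qed.

Lemma edge_biased_pgf1 (Q : probability (nat * R)%type R) :
  edge_biased_pgf Q 1 1 = mean_edges Q.
Proof.
by apply: eq_Rintegral => z _; rewrite subrr mulr0 subr0 !expr1n !mulr1.
Qed.

Lemma mean_edges_limit : mean_edges (Pn n) @[n --> \oo] --> mean_edges P.
Proof.
rewrite -edge_biased_pgf1; under eq_fun do rewrite -edge_biased_pgf1.
by apply: edge_biased_pgf_limit; rewrite lexx ler01.
Qed.

Definition linked_pgf n (a b : R) : R :=
  fine (\int[Pr n]_(w in linked12 (@L n))
    (a ^+ (bidegree (@L n) w).1 * b ^+ (bidegree (@L n) w).2)%:E)%E.

(** The factors stand for the edge that links the pair, for the layer that contains it, and for the
    compound Poisson numbers of neighbours in the other layers. At [a = b = 1] the value is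
    [mu * mean_edges P], the limit of [n] times the probability of the link. *)
Definition linked_pgf_lim (a b : R) : R :=
  a * b * (mu * edge_biased_pgf P a b * expR (- (mu *
    ((mean_size P - size_biased_pgf P a) + (mean_size P - size_biased_pgf P b))))).

Lemma two_nodes n : (1 < n)%N -> exists u v : 'I_n, val u = 0%N /\ val v = 1%N.
Proof. by move=> n1; exists (Ordinal (ltnW n1)), (Ordinal n1). Qed.

Lemma linked_pgf_limit (a b : R) : 0 <= a <= 1 -> 0 <= b <= 1 ->
  n%:R * linked_pgf n a b @[n --> \oo] --> linked_pgf_lim a b.
Proof.
move=> a01 b01; have /andP[a0 a1] := a01; have /andP[b0 b1] := b01.
(* [c n] is the ratio of [n ^ 2] to [(n)_2], so that [m / (n)_2 = k c / n]. *)
pose k n : R := (m n)%:R / n%:R; pose c n : R := (1 - n%:R^-1)^-1.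
pose x n := mean_size (Pn n); pose s n := mean_edges (Pn n).
pose t n : R := (\int[Pn n]_(z in strip) (z.1 ^_ 2)%:R) / n%:R.
pose main n : R := a * b * (k n * c n * edge_biased_pgf (Pn n) a b *
  expR (- (k n * ((x n - size_biased_pgf (Pn n) a) + (x n - size_biased_pgf (Pn n) b))))).
(* This is [n] times the bound of [model_mean_approx]: the prefactor [m l] absorbs the [n], and the
   bracket tends to 0, its last term because of [mean_size2_limit]. *)
pose err n : R := k n * c n * s n * (3 * (k n * c n * s n * n%:R^-1) +
  2 * x n * n%:R^-1 + k n * (2 * x n) ^+ 2 * n%:R^-1 +
  (2 * (k n * c n * s n * Num.sqrt n%:R^-1) + k n * c n * t n)).
have invn := @cvg_invn R.
have clim : c n @[n --> \oo] --> (1 : R).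
  rewrite [X in _ --> X](_ : _ = (1 - 0)^-1); last by rewrite subr0 invr1.
  apply: cvgV; first by rewrite subr0 oner_neq0.
  by apply: cvgB => //; exact: cvg_cst.
have slim := mean_edges_limit; have xlim := mean_size_limit.
have klim : k n @[n --> \oo] --> mu by [].
have kcs : k n * c n * s n @[n --> \oo] --> mu * 1 * mean_edges P.
  by apply: cvgM => //; exact: cvgM.
have sqn : Num.sqrt (n%:R^-1 : R) @[n --> \oo] --> (0 : R).
  rewrite -[X in _ --> X](@sqrtr0 R).
  by apply: (cvg_comp _ _ invn); exact: sqrt_continuous.
have errlim : err n @[n --> \oo] --> (0 : R).
  rewrite [X in _ --> X](_ : _ = mu * 1 * mean_edges P * (
    3 * (mu * 1 * mean_edges P * 0) + 2 * mean_size P * 0 +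
    mu * (2 * mean_size P) ^+ 2 * 0 + (2 * (mu * 1 * mean_edges P * 0) + mu * 1 * 0))); last by ring.
  apply: cvgM => //; apply: cvgD; last first.
    apply: cvgD; last by apply: cvgM mean_size2_limit; exact: cvgM.
    by apply: cvgM; [exact: cvg_cst|exact: cvgM].
  apply: cvgD.
    apply: cvgD; first by apply: cvgM; [exact: cvg_cst|exact: cvgM].
    by apply: cvgM => //; apply: cvgM => //; exact: cvg_cst.
  apply: cvgM => //; apply: cvgM => //.
  by rewrite !expr2; under eq_fun do rewrite expr2;
     apply: cvgM; apply: cvgM => //; exact: cvg_cst.
have mainlim : main n @[n --> \oo] --> linked_pgf_lim a b.
  rewrite /linked_pgf_lim -[X in X * edge_biased_pgf P a b]mulr1.
  apply: cvgM; first exact: cvg_cst.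
  apply: cvgM; first by apply: cvgM; [exact: cvgM|exact: edge_biased_pgf_limit].
  apply: continuous_cvg; first exact: continuous_expR.
  apply: cvgN; apply: cvgM => //.
  by apply: cvgD; apply: cvgB => //; exact: size_biased_pgf_limit.
have bnd : \forall n \near \oo, `|n%:R * linked_pgf n a b - main n| <= err n.
  near=> n; have n1 : (1 < n)%N by near: n; exact: nbhs_infty_gt.
  have [u [v [u0 v1]]] := two_nodes n1.
  have uv := node12_neq u0 v1.
  rewrite /linked_pgf (integral_linked12 (Pn1 n) (modL n) u0 v1)//=.
  have n0 : n%:R != 0 :> R by rewrite pnatr_eq0 -lt0n ltnW.
  have n0' : 0 < n%:R :> R by rewrite ltr0n ltnW.
  have n1' : 1 - n%:R^-1 != 0 :> R.
    by rewrite subr_eq0 eq_sym invr_eq1 pnatr_eq1 gtn_eqF.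
  have ffE : (n ^_ 2)%:R = n%:R ^+ 2 * (1 - n%:R^-1) :> R.
    rewrite ffactnSr ffactn1 natrM natrB// ?(ltnW n1)// expr2.
    by rewrite -[RHS]mulrA; congr (_ * _); rewrite mulrBr mulr1 divff.
  have sE (q : R) : (m n)%:R * (q / (n ^_ 2)%:R) = k n * c n * q * n%:R^-1.
    by rewrite ffE /k /c; field; rewrite n0 subr_eq0 pnatr_eq1 gtn_eqF.
  have := model_mean_approx (m n) (Pn1 n) uv a01 b01; rewrite /= !sE.
  rewrite -/(edge_biased_pgf (Pn n) a b) -/(mean_edges (Pn n)) -/(mean_size (Pn n)).
  rewrite -/(size_biased_pgf (Pn n) a) -/(size_biased_pgf (Pn n) b) -/(s n) -/(x n) -/(k n).
  set e1 := expR _ => approx.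
  have -> : n%:R * (a * b * model_mean (m n) (Pn n) u v a b) - main n =
      a * b * (n%:R * (model_mean (m n) (Pn n) u v a b -
        k n * c n * edge_biased_pgf (Pn n) a b / n%:R * e1)).
    rewrite /main -/e1; clearbody e1; clear approx.
    by move: (model_mean _ _ _ _ _ _) (edge_biased_pgf _ _ _) e1 => M E f; field.
  have ab1 : a * b <= 1 by rewrite mulr_ile1.
  rewrite normrM ger0_norm ?mulr_ge0// normrM (ger0_norm (ltW n0')).
  apply: (@le_trans _ _ (1 * (n%:R * `|model_mean (m n) (Pn n) u v a b -
        k n * c n * edge_biased_pgf (Pn n) a b / n%:R * e1|))).
    by rewrite ler_wpM2r// mulr_ge0// ltW.
  rewrite mul1r; apply: le_trans (ler_wpM2l (ltW n0') approx) _.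
  rewrite /err le_eqVlt; apply/orP; left; apply/eqP.
  have -> : (m n)%:R * (2 * (Num.sqrt n%:R * (s n / (n ^_ 2)%:R)) +
      (\int[Pn n]_(z in strip) (z.1 ^_ 2)%:R) / (n ^_ 2)%:R) =
      2 * (k n * c n * s n * Num.sqrt n%:R^-1) + k n * c n * t n.
    rewrite mulrDr sE mulrCA (mulrCA (m n)%:R) sE /t.
    have q0 : Num.sqrt n%:R != 0 :> R by rewrite gt_eqF// sqrtr_gt0.
    have <- : Num.sqrt n%:R * n%:R^-1 = Num.sqrt n%:R^-1 :> R.
      rewrite sqrtrV ?ltW//; apply: (mulfI q0).
      by rewrite mulrA -expr2 sqr_sqrtr ?ltW// !divff.
    by congr (_ + _); [congr (_ * _); rewrite mulrCA|rewrite -mulrA].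
  have -> : (m n)%:R * (2 * x n / n%:R) ^+ 2 = k n * (2 * x n) ^+ 2 * n%:R^-1.
    by rewrite /k; field.
  by rewrite [LHS]mulrA; congr (_ * _); rewrite mulrCA divff ?mulr1.
have : n%:R * linked_pgf n a b - main n @[n --> \oo] --> (0 : R).
  have nerr : - err n @[n --> \oo] --> (0 : R).
    by rewrite -[X in _ --> X]oppr0; apply: cvgN.
  apply: (squeeze_cvgr _ nerr errlim).
  by apply: filterS bnd => n; rewrite ler_norml.
move=> /cvgD/(_ mainlim); rewrite add0r.
by rewrite [X in X @ _ --> _](_ : _ = fun n => n%:R * linked_pgf n a b)//;
  apply/funext => n /=; rewrite subrK.
Unshelve. all: by end_near. Qed.

Hypotheses (mu0 : 0 < mu) (P21gt0 : 0 < mean_edges P).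

Lemma linked_pgf_lim1 : linked_pgf_lim 1 1 = mu * mean_edges P.
Proof.
rewrite /linked_pgf_lim edge_biased_pgf1 (_ : size_biased_pgf P 1 = mean_size P).
  by rewrite subrr addr0 mulr0 oppr0 expR0 !mulr1 mul1r.
by apply: eq_Rintegral => z _; rewrite subrr mulr0 subr0 expr1n mulr1.
Qed.

Lemma model_bidegree_pgf_limit (a b : R) : 0 <= a <= 1 -> 0 <= b <= 1 ->
  \int[model_bidegree (Pr n) (@L n)]_st (a ^+ st.1 * b ^+ st.2) @[n --> \oo] -->
  linked_pgf_lim a b / linked_pgf_lim 1 1.
Proof.
move=> a01 b01; have lim11 : 0 <= (1 : R) <= 1 by rewrite lexx ler01.
have lim1_gt0 : 0 < linked_pgf_lim 1 1 by rewrite linked_pgf_lim1 mulr_gt0.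
have l1 := linked_pgf_limit lim11 lim11; have lab := linked_pgf_limit a01 b01.
have ratio : (n%:R * linked_pgf n a b) / (n%:R * linked_pgf n 1 1) @[n --> \oo] -->
    linked_pgf_lim a b / linked_pgf_lim 1 1.
  exact: (cvgM lab (cvgV (lt0r_neq0 lim1_gt0) l1)).
apply: cvg_trans ratio; apply: near_eq_cvg; near=> n.
have n1 : (1 < n)%N by near: n; exact: nbhs_infty_gt.
(* For large [n] the link has positive probability, so the conditional law is genuine; the factors
   [n] cancel in the ratio. *)
have pos : 0 < n%:R * linked_pgf n 1 1.
  by near: n; exact: (cvgr_gt _ l1 _ lim1_gt0).
have [u [v [u0 v1]]] := two_nodes n1.
have n0 : 0 < n%:R :> R by rewrite ltr0n ltnW.
have LE (a' b' : R) : 0 <= a' -> 0 <= b' ->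
    linked_pgf n a' b' = a' * b' * model_mean (m n) (Pn n) u v a' b'.
  by move=> a'0 b'0; rewrite /linked_pgf (integral_linked12 (Pn1 n) (modL n) u0 v1).
have pos' : 0 < model_mean (m n) (Pn n) u v 1 1.
  by move: pos; rewrite LE// !mul1r pmulr_rgt0.
have /andP[a0 _] := a01; have /andP[b0 _] := b01.
rewrite (model_bidegree_mean (Pn1 n) (modL n) u0 v1)// !LE// !mul1r.
by rewrite -mulf_div divff ?gt_eqF// mul1r.
Unshelve. all: by end_near. Qed.

End model_limit.

(** * Generating function of the limiting law *)

Lemma ge0_integral_fibers d (T : measurableType d) (R : realType)
    (mu : {measure set T -> \bar R}) (D : set T) (f : T -> \bar R) (X : T -> nat) :
  (forall k, measurable (D `&` X @^-1` [set k])) -> measurable_fun D f ->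
  (forall x, D x -> (0 <= f x)%E) ->
  (\int[mu]_(x in D) f x = \sum_(k <oo) \int[mu]_(x in D `&` X @^-1` [set k]) f x)%E.
Proof.
move=> mDX mf f0; rewrite -ge0_integral_bigcup//.
- congr (integral _ _ _); apply/seteqP; split => [x Dx|x [k _ []]//].
  by exists (X x).
- rewrite (_ : \bigcup_k _ = D)//; apply/seteqP; split => [x [k _ []]//|x Dx].
  by exists (X x).
- by move=> x [k _ [Dx _]]; exact: f0.
- by move=> i j _ _ [x [[_ /= <-] [_ /= <-]]].
Qed.

Lemma integral_set1_measure d (T : measurableType d) (R : realType)
    (mu : {measure set T -> \bar R}) (f : T -> \bar R) (x : T) :
  measurable [set x] -> (\int[mu]_(y in [set x]) f y = f x * mu [set x])%E.
Proof.
move=> mx; rewrite -integral_cst//; apply: eq_integral => y.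
by rewrite inE => ->.
Qed.

Lemma ge0_integral_nat (R : realType) (mu : {measure set nat -> \bar R})
    (f : nat -> \bar R) : (forall k, (0 <= f k)%E) ->
  (\int[mu]_k f k = \sum_(k <oo) f k * mu [set k])%E.
Proof.
move=> f0; rewrite (@ge0_integral_fibers _ _ _ mu setT f id)//.
by apply: eq_eseriesr => k _; rewrite setTI integral_set1_measure.
Qed.

Lemma ge0_integral_nat2 (R : realType) (mu : {measure set (nat * nat) -> \bar R})
    (f : nat * nat -> \bar R) : (forall st, (0 <= f st)%E) ->
  (\int[mu]_st f st = \sum_(s <oo) \sum_(t <oo) f (s, t) * mu [set (s, t)])%E.
Proof.
move=> f0.
have mf (D : set (nat * nat)) : measurable_fun D f by move=> _ B _; exact: measurable_nat2.
rewrite (@ge0_integral_fibers _ _ _ mu setT f fst)//; last by move=> k; exact: measurable_nat2.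
apply: eq_eseriesr => s _; rewrite (@ge0_integral_fibers _ _ _ mu _ f snd)//; last first.
  by move=> k; exact: measurable_nat2.
apply: eq_eseriesr => t _; rewrite -integral_set1_measure; last exact: measurable_nat2.
congr (integral _ _ _); apply/seteqP; split => [[s' t'] /= [[_ ->] ->]//|[s' t'] /= [-> ->]].
by [].
Qed.

Lemma binomial_pgf (R : realType) (a y : R) n :
  (\sum_(s <oo) (a ^+ s * binomial_pmf n y s)%:E = ((1 - y * (1 - a)) ^+ n)%:E)%E.
Proof.
have -> : 1 - y * (1 - a) = (1 - y) + y * a by ring.
rewrite exprDn; apply/cvg_lim => //; apply: cvg_near_cst; near=> k.
rewrite sumEFin; congr EFin.
have nk : (n.+1 <= k)%N by near: k; exact: nbhs_infty_ge.
rewrite (@big_cat_nat _ _ _ n.+1)//= [X in _ + X]big1_seq ?addr0; last first.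
  move=> i /andP[_]; rewrite mem_index_iota => /andP[ni _].
  by rewrite /binomial_pmf bin_small// mulr0n mulr0.
rewrite big_mkord; apply: eq_bigr => i _; rewrite /binomial_pmf exprMn mulrnAr.
by rewrite mulrA mulrC (mulrC (a ^+ i)).
Unshelve. all: by end_near. Qed.

Lemma poisson_pgf (R : realType) (r c : R) : 0 < r -> 0 <= c ->
  (\sum_(l <oo) (poisson_pmf r l * c ^+ l)%:E = (expR (- (r * (1 - c))))%:E)%E.
Proof.
move=> r0 c0.
under eq_eseriesr.
  move=> l _.
  rewrite (_ : poisson_pmf r l * c ^+ l = expR (- r) * (l`!%:R^-1 * (r * c) ^+ l)).
    rewrite EFinM; over.
  by rewrite /poisson_pmf r0 exprMn; ring.
rewrite /= nneseriesZl/=; last first.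
  by move=> n _; rewrite lee_fin mulr_ge0 ?invr_ge0// exprn_ge0// mulr_ge0// ltW.
have -> : - (r * (1 - c)) = - r + r * c by ring.
rewrite expRD EFinM; congr *%E; rewrite expRE -EFin_lim; last first.
  rewrite /pseries/=; under eq_fun do rewrite mulrC.
  exact: is_cvg_series_exp_coeff.
apply/congr_lim/funext => n/=.
by rewrite /pseries/= /series/= -sumEFin.
Qed.

Lemma measurable_binomial_pmf_prob (R : realType) n s (D : set R) :
  measurable_fun D (fun y : R => binomial_pmf n y s).
Proof.
rewrite /binomial_pmf; under eq_fun do rewrite -mulr_natl.
apply: measurable_funM => //; apply: measurable_funM; apply: measurable_funX => //.
exact: measurable_funB.
Qed.

(** * Size-biased and edge-biased mixtures of binomials *)

Section limit_pgf.
Variables (R : realType) (mu : R) (P : probability (nat * R)%type R).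
Hypotheses (P10 : (0 < cross_moment P 1 0 < +oo)%E) (P21 : (0 < cross_moment P 2 1 < +oo)%E).

Lemma fine_cross_moment10 : fine (cross_moment P 1 0) = mean_size P.
Proof. by rewrite cross_moment10. Qed.

Lemma fine_cross_moment21 : fine (cross_moment P 2 1) = mean_edges P.
Proof. by rewrite cross_moment21. Qed.

Lemma mean_size_gt0 : 0 < mean_size P.
Proof. by rewrite -fine_cross_moment10 fine_gt0. Qed.

Lemma mean_edges_gt0 : 0 < mean_edges P.
Proof. by rewrite -fine_cross_moment21 fine_gt0. Qed.

Lemma strip_integral_fin (f h : nat * R -> R) :
  measurable_fun strip f -> measurable_fun strip h ->
  (forall z, strip z -> 0 <= f z <= h z) ->
  (\int[P]_(z in strip) (h z)%:E < +oo)%E ->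
  (\int[P]_(z in strip) (f z)%:E = (\int[P]_(z in strip) f z)%:E)%E.
Proof.
move=> mf mh fh hoo; rewrite /Rintegral fineK// ge0_fin_numE; last first.
  by apply: integral_ge0 => z /fh/andP[]; rewrite lee_fin.
apply: le_lt_trans hoo; apply: ge0_le_integral => //.
- by move=> z /fh/andP[]; rewrite lee_fin.
- exact/measurable_EFinP.
- exact/measurable_EFinP.
- by move=> z /fh/andP[]; rewrite lee_fin.
Qed.

Lemma measurable_retention_strip (a : R) (k : nat -> nat) (w : nat -> R -> R) :
  (forall x, measurable_fun setT (w x)) ->
  measurable_fun strip (fun z : nat * R => w z.1 z.2 * (1 - z.2 * (1 - a)) ^+ k z.1).
Proof.
move=> mw; apply: measurable_fun_natM => // x /=.
by apply: measurable_funM; [exact: mw|exact: measurable_retention].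
Qed.

Lemma summand_pgf (a : R) : 0 <= a <= 1 ->
  (\sum_(s <oo) (a ^+ s)%:E * summand_pmf P s =
   (size_biased_pgf P a / mean_size P)%:E)%E.
Proof.
move=> a01; have /andP[a0 a1] := a01; have x0 := mean_size_gt0.
pose F s (z : nat * R) : R := (z.1%:R / mean_size P) * (a ^+ s * binomial_pmf (z.1 - 1) z.2 s).
have F0 s z : strip z -> 0 <= F s z.
  by move=> sz; rewrite !mulr_ge0 ?exprn_ge0 ?binomial_pmf_ge0// invr_ge0 ltW.
have mF s : measurable_fun strip (F s).
  apply: measurable_fun_natM => // x; rewrite /F /=; apply: measurable_funM => //.
  by apply: measurable_funM => //; exact: measurable_binomial_pmf_prob.
transitivity (\sum_(s <oo) \int[P]_(z in strip) (F s z)%:E)%E.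
  apply: eq_eseriesr => s _; rewrite /summand_pmf fine_cross_moment10.
  rewrite -ge0_integralZl_EFin ?exprn_ge0//.
  - by apply: eq_integral => z _; rewrite -EFinM; congr EFin; rewrite /F; ring.
  - move=> z sz; rewrite lee_fin mulr_ge0 ?binomial_pmf_ge0// divr_ge0// ltW//.
  - apply/measurable_EFinP; apply: measurable_fun_natM => // x /=.
    by apply: measurable_funM => //; exact: measurable_binomial_pmf_prob.
rewrite -integral_nneseries//; last by move=> s; apply/measurable_EFinP.
transitivity (\int[P]_(z in strip) ((mean_size P)^-1%:E *
    (z.1%:R * (1 - z.2 * (1 - a)) ^+ (z.1 - 1))%:E))%E.
  apply: eq_integral => z /set_mem sz; rewrite /F.
  under eq_eseriesr do rewrite EFinM.
  rewrite nneseriesZl; last first.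
    by move=> s _; rewrite lee_fin mulr_ge0 ?exprn_ge0// binomial_pmf_ge0.
  by rewrite binomial_pgf -!EFinM; congr EFin; ring.
have mG : measurable_fun strip (fun z : nat * R => z.1%:R * (1 - z.2 * (1 - a)) ^+ (z.1 - 1)).
  exact: (@measurable_retention_strip a (fun x => x - 1)%N (fun x _ => x%:R)).
have G0 z : strip z -> 0 <= z.1%:R * (1 - z.2 * (1 - a)) ^+ (z.1 - 1) <= z.1%:R.
  move=> sz; have /andP[r0 r1] := retention_itv a01 sz.
  by rewrite mulr_ge0 ?exprn_ge0//= ler_piMr// exprn_ile1.
rewrite ge0_integralZl_EFin//; last 3 first.
- by move=> z /G0/andP[]; rewrite lee_fin.
- exact/measurable_EFinP.
- by rewrite invr_ge0 ltW.
rewrite (strip_integral_fin mG _ G0); last 2 first.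
- by apply: measurable_fun_natM => // x; exact: measurable_cst.
- by rewrite -cross_moment10; case/andP: P10.
by rewrite -EFinM mulrC.
Qed.

(** Under the integral the two coordinates are independent binomials, so the sums over [t] and then
    over [s] are instances of [binomial_pgf]. *)
Lemma joint_pgf (a b : R) : 0 <= a <= 1 -> 0 <= b <= 1 ->
  (\int[joint_measure P]_st (a ^+ st.1 * b ^+ st.2)%:E =
   (edge_biased_pgf P a b / mean_edges P)%:E)%E.
Proof.
move=> a01 b01; have /andP[a0 a1] := a01; have /andP[b0 b1] := b01.
have x0 := mean_edges_gt0.
pose W (z : nat * R) : R := (z.1 ^_ 2)%:R * z.2 / mean_edges P.
have W0 z : strip z -> 0 <= W z.
  by move=> /andP[z0 _]; rewrite divr_ge0 ?mulr_ge0// ltW.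
have mW x : measurable_fun setT (fun y => W (x, y)).
  by rewrite /W /=; apply: measurable_funM => //; apply: measurable_funM.
pose B c s (z : nat * R) : R := c ^+ s * binomial_pmf (z.1 - 2) z.2 s.
have B0 c s z : 0 <= c -> strip z -> 0 <= B c s z.
  by move=> c0 sz; rewrite mulr_ge0 ?exprn_ge0 ?binomial_pmf_ge0.
have mB c s x : measurable_fun setT (fun y => B c s (x, y)).
  by rewrite /B /=; apply: measurable_funM => //; exact: measurable_binomial_pmf_prob.
pose E c (z : nat * R) : R := (1 - z.2 * (1 - c)) ^+ (z.1 - 2).
have mE c x : measurable_fun setT (fun y => E c (x, y)) by exact: measurable_retention.
have E01 c z : 0 <= c <= 1 -> strip z -> 0 <= E c z <= 1.
  move=> c01 sz; have /andP[r0 r1] := retention_itv c01 sz.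
  by rewrite exprn_ge0// exprn_ile1.
rewrite ge0_integral_nat2; last by move=> st; rewrite lee_fin mulr_ge0// exprn_ge0.
transitivity (\sum_(s <oo) \int[P]_(z in strip) (W z * B a s z * E b z)%:E)%E.
  apply: eq_eseriesr => s _.
  transitivity (\sum_(t <oo) \int[P]_(z in strip) (W z * B a s z * B b t z)%:E)%E.
    apply: eq_eseriesr => t _; rewrite /= /joint_measure esum_set1; last exact: joint_pmf_ge0.
    rewrite /joint_pmf fine_cross_moment21 -ge0_integralZl_EFin ?mulr_ge0 ?exprn_ge0//=.
    - by apply: eq_integral => z _; rewrite -EFinM; congr EFin; rewrite /W /B; ring.
    - move=> z sz; rewrite lee_fin; apply: mulr_ge0; last exact: (W0 z).
      by apply: mulr_ge0; exact: binomial_pmf_ge0.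
    - apply/measurable_EFinP; apply: measurable_fun_natM => // x /=.
      apply: measurable_funM; last exact: (mW x).
      by apply: measurable_funM; exact: measurable_binomial_pmf_prob.
  rewrite -integral_nneseries//; last 2 first.
  - move=> t; apply/measurable_EFinP; apply: measurable_fun_natM => // x.
    by apply: measurable_funM; [apply: measurable_funM; [exact: mW|exact: mB]|exact: mB].
  - move=> t z sz; rewrite lee_fin; apply: mulr_ge0; last exact: B0.
    by apply: mulr_ge0; [exact: W0|exact: B0].
  apply: eq_integral => z /set_mem sz.
  under eq_eseriesr do rewrite EFinM.
  rewrite nneseriesZl; last by move=> t _; rewrite lee_fin B0.
  by rewrite binomial_pgf -EFinM.
rewrite -integral_nneseries//; last 2 first.
- move=> t; apply/measurable_EFinP; apply: measurable_fun_natM => // x.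
  by apply: measurable_funM; [apply: measurable_funM; [exact: mW|exact: mB]|exact: mE].
- move=> t z sz; have /andP[e0 _] := E01 b z b01 sz; rewrite lee_fin.
  by apply: mulr_ge0 => //; apply: mulr_ge0; [exact: W0|exact: B0].
pose T (z : nat * R) : R := (z.1 ^_ 2)%:R * (z.2 * E a z * E b z).
transitivity (\int[P]_(z in strip) ((mean_edges P)^-1%:E * (T z)%:E))%E.
  apply: eq_integral => z /set_mem sz.
  rewrite (eq_eseriesr (g := fun s => ((W z * E b z)%:E * (B a s z)%:E)%E)); last first.
    by move=> s _; rewrite -EFinM; congr EFin; ring.
  rewrite nneseriesZl; last by move=> t _; rewrite lee_fin B0.
  by rewrite binomial_pgf -!EFinM; congr EFin; rewrite /T /W /E; ring.
have mT : measurable_fun strip T.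
  apply: measurable_fun_natM => // x; rewrite /T /=; apply: measurable_funM => //.
  by apply: measurable_funM; [apply: measurable_funM => //; exact: mE|exact: mE].
have T0 z : strip z -> 0 <= T z <= (z.1 ^_ 2)%:R * z.2.
  move=> sz; have /andP[z0 z1] := sz.
  have /andP[r0 r1] := E01 _ _ a01 sz; have /andP[s0 s1] := E01 _ _ b01 sz.
  rewrite /T; apply/andP; split.
    by apply: mulr_ge0 => //; apply: mulr_ge0 => //; exact: mulr_ge0.
  by apply: ler_wpM2l => //; rewrite -mulrA; apply: ler_piMr => //; exact: mulr_ile1.
rewrite ge0_integralZl_EFin//; last 3 first.
- by move=> z /T0/andP[]; rewrite lee_fin.
- exact/measurable_EFinP.
- by rewrite invr_ge0 ltW.
rewrite (strip_integral_fin mT _ T0); last 2 first.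
- by apply: measurable_fun_natM => // x /=; apply: measurable_funM.
- by rewrite -cross_moment21; case/andP: P21.
by rewrite -EFinM mulrC.
Qed.

(** The total mass is the generating function at [(1, 1)], which is 1. *)
Lemma joint_lawE A : joint_law P A = joint_measure P A.
Proof.
have T1 : joint_measure P setT = 1%E.
  have := @joint_pgf 1 1; rewrite lexx ler01 => /(_ isT isT).
  rewrite edge_biased_pgf1 divff ?gt_eqF ?mean_edges_gt0// => <-.
  under eq_integral do rewrite !expr1n mulr1.
  by rewrite integral_cst// mul1e.
rewrite /joint_law /= /mnormalize [X in X == 0%E]T1 [X in X == +oo%E]T1.
by rewrite onee_eq0/= [X in fine X]T1 /= invr1 mule1.
Qed.

End limit_pgf.

(** * Compound Poisson sums *)

Section random_sum_pgf.
Variables (R : realType) (mu : R) (P : probability (nat * R)%type R).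
Variables (d : measure_display) (Omega : measurableType d) (Q : probability Omega R).
Variables (Lambda : {mfun Omega >-> nat}) (H : nat -> {mfun Omega >-> nat}).
Hypotheses (P10 : (0 < cross_moment P 1 0 < +oo)%E) (mu0 : 0 < mu).
Hypothesis sumQ : random_sum_model mu P Q Lambda H.

Let count (i : option nat) : {mfun Omega >-> nat} :=
  if i is Some k then H k else Lambda.

Let count_set (l : nat) (B : nat -> set nat) (i : option nat) : set nat :=
  if i is Some k then B k else [set l].

(** The summands of index below [j] stay free: they are the ones in the integrand of
    [event_integral]. *)
Let event (l j : nat) (B : nat -> set nat) : set Omega :=
  [set w | Lambda w = l /\ forall k, (j <= k < l)%N -> B k (H k w)].

Lemma event_bigcap l j B : event l j B =
  \bigcap_(i in [set` [fset i | i in None :: map Some (index_iota j l)]%fset])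
   (count i @^-1` count_set l B i).
Proof.
apply/seteqP; split => [w [wl wB] [k|] /=|w wB].
- rewrite !inE /= mem_map; last by move=> ? ? [].
  by rewrite mem_index_iota; exact: wB.
- by rewrite wl.
split; first by apply: (wB None); rewrite /= !inE.
move=> k jkl; apply: (wB (Some k)).
by rewrite /= !inE mem_map ?mem_index_iota// => ? ? [].
Qed.

Lemma measurable_event l j B : measurable (event l j B).
Proof.
rewrite event_bigcap; apply: fin_bigcap_measurable => // -[k|] _;
by rewrite -[X in measurable X]setTI; apply: measurable_funPT.
Qed.

Lemma event_law l j B : Q (event l j B) =
  (Q (Lambda @^-1` [set l]) * \prod_(j <= k < l) Q (H k @^-1` B k))%E.
Proof.
rewrite event_bigcap.
have ind : mutually_independent Q count := counts_independent sumQ.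
rewrite (ind _ (count_set l B))//.
rewrite (perm_big (None :: map Some (index_iota j l)))/=; last first.
  apply: uniq_perm; rewrite ?fset_uniq//.
    have Some_inj : injective (@Some nat) by move=> ? ? [].
    rewrite /= (map_inj_uniq Some_inj) iota_uniq andbT.
    by apply/negP => /mapP[x _].
  by move=> i; rewrite !inE.
by rewrite big_cons big_map.
Qed.

(** Independence is given for events only, so the summands are integrated one at a time: on the
    fibre where [H j = h] the factor [a ^+ h] leaves the integral, and [h] becomes the constraint on
    the index [j]. For this the induction keeps [B] arbitrary. *)
Lemma event_integral (a g : R) l j B : 0 <= a ->
  (forall k, (\sum_(h <oo) (a ^+ h)%:E * Q (H k @^-1` [set h]) = g%:E)%E) ->
  (j <= l)%N ->
  (\int[Q]_(w in event l j B) (a ^+ (\sum_(k < j) H k w))%:E =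
   (g ^+ j)%:E * (Q (Lambda @^-1` [set l]) * \prod_(j <= k < l) Q (H k @^-1` B k)))%E.
Proof.
move=> a0 gE; elim: j B => [|j IH] B jl.
  under eq_integral do rewrite big_ord0 expr0.
  rewrite integral_cst; last exact: measurable_event.
  by rewrite mul1e expr0 mul1e; exact: event_law.
have mS j' : measurable_fun [set: Omega] (fun w => \sum_(k < j') H k w)%N.
  elim: j' => [|j' IHj].
    by under eq_fun do rewrite big_ord0; exact: measurable_cst.
  under eq_fun do rewrite big_ord_recr/=.
  have mD : measurable_fun [set: nat * nat] (fun st => st.1 + st.2)%N.
    by move=> _ A _; exact: measurable_nat2.
  have mH : measurable_fun [set: Omega] (H j') by [].
  exact: (measurableT_comp mD (measurable_fun_pair IHj mH)).
have maS j' (D : set Omega) : measurable_fun D (fun w => (a ^+ (\sum_(k < j') H k w))%:E).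
  apply/measurable_EFinP; apply: measurable_funTS.
  have ma : measurable_fun [set: nat] (fun s => a ^+ s) by [].
  exact: (measurableT_comp ma (mS j')).
have evI h : event l j.+1 B `&` H j @^-1` [set h] =
    event l j (fun k => if k == j then [set h] else B k).
  apply/seteqP; split => [w /= [[wl wB] wh]|w /= [wl wB]].
    split => // k /andP[jk kl]; case: eqP => [->//|/eqP kj]; apply: wB.
    by rewrite kl ltn_neqAle eq_sym kj jk.
  split; last by have := wB j; rewrite eqxx leqnn jl; apply.
  split => // k /andP[jk kl]; have := wB k; rewrite (gtn_eqF jk) kl ltnW//.
  by apply.
rewrite (@ge0_integral_fibers _ _ _ Q _ _ (H j))//; last 2 first.
- by move=> h; rewrite evI; exact: measurable_event.
- by move=> w _; rewrite lee_fin exprn_ge0.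
pose C : \bar R := ((g ^+ j)%:E * (Q (Lambda @^-1` [set l]) *
  \prod_(j.+1 <= k < l) Q (H k @^-1` B k)))%E.
have Cfin : C \is a fin_num.
  rewrite /C fin_numM// fin_numM ?fin_num_measure//.
    by rewrite -[X in measurable X]setTI; exact: measurable_funPT.
  rewrite prode_fin_num// => k _; rewrite fin_num_measure//.
  by rewrite -[X in measurable X]setTI; exact: measurable_funPT.
transitivity (\sum_(h <oo) (C * ((a ^+ h)%:E * Q (H j @^-1` [set h]))))%E.
  apply: eq_eseriesr => h _; rewrite evI.
  transitivity (\int[Q]_(w in event l j (fun k => if k == j then [set h] else B k))
     ((a ^+ h)%:E * (a ^+ (\sum_(k < j) H k w))%:E))%E.
    apply: eq_integral => w /set_mem[wl wB]; rewrite -EFinM big_ord_recr /= exprD.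
    suff -> : H j w = h by rewrite mulrC.
    by have := wB j; rewrite eqxx leqnn jl; apply.
  rewrite ge0_integralZl_EFin ?exprn_ge0//; last 2 first.
  - exact: measurable_event.
  - by move=> w _; rewrite lee_fin exprn_ge0.
  rewrite IH ?(ltnW jl)// (big_ltn jl) eqxx.
  rewrite (eq_big_nat _ _ (F2 := fun k => Q (H k @^-1` B k))); last first.
    by move=> k /andP[jk _]; rewrite (gtn_eqF jk).
  rewrite /C muleCA -[RHS]muleA; congr (_ * _)%E.
  rewrite muleCA -[RHS]muleA; congr (_ * _)%E.
  by rewrite [RHS]muleC muleA.
rewrite -(fineK Cfin) nneseriesZl; last first.
  by move=> h _; rewrite mule_ge0// lee_fin exprn_ge0.
by rewrite gE (fineK Cfin) /C muleC muleA -EFinM exprS.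
Qed.

Lemma random_sum_pgf (a : R) : 0 <= a <= 1 ->
  (\int[random_sum_law Q Lambda H]_s (a ^+ s)%:E =
   (expR (- (mu * (mean_size P - size_biased_pgf P a))))%:E)%E.
Proof.
move=> a01; have /andP[a0 a1] := a01; have x0 := mean_size_gt0 P10.
rewrite ge0_integral_distribution//=; last by move=> s; rewrite lee_fin exprn_ge0.
have ma : measurable_fun setT (fun w => (a ^+ random_sum Lambda H w)%:E).
  apply/measurable_EFinP; have ma : measurable_fun [set: nat] (fun s => a ^+ s) by [].
  exact: (measurableT_comp ma (measurable_random_sum Lambda H)).
rewrite (@ge0_integral_fibers _ _ _ Q _ _ Lambda)//; last 2 first.
- by move=> l; rewrite setTI -[X in measurable X]setTI; exact: measurable_funPT.
- by move=> w _; rewrite lee_fin exprn_ge0.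
pose g := size_biased_pgf P a / mean_size P.
have gE k : (\sum_(h <oo) (a ^+ h)%:E * Q (H k @^-1` [set h]) = g%:E)%E.
  rewrite -(summand_pgf P10 a01); apply: eq_eseriesr => h _.
  by rewrite (summand_law sumQ).
have g0 : 0 <= g.
  rewrite divr_ge0 ?(ltW x0)// /size_biased_pgf; apply: Rintegral_ge0 => z sz.
  by have /andP[r0 _] := retention_itv a01 sz; rewrite mulr_ge0 ?exprn_ge0.
transitivity (\sum_(l <oo) (poisson_pmf (mu * mean_size P) l * g ^+ l)%:E)%E; last first.
  rewrite poisson_pgf ?mulr_gt0//; congr (expR (- _))%:E.
  by rewrite -mulrA mulrBr mulr1 /g mulrCA divff ?mulr1 ?gt_eqF.
apply: eq_eseriesr => l _.
(* With [j = l] all summands are in the integrand and no constraint remains. *)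
have := @event_integral a g l l (fun=> setT) a0 gE (leqnn l).
rewrite big_geq// mule1 (count_law sumQ) fine_cross_moment10 -EFinM mulrC => <-.
rewrite (_ : setT `&` _ = event l l (fun=> setT)).
  by apply: eq_integral => w /set_mem[wl _]; rewrite /random_sum wl.
by apply/seteqP; split => w /= [].
Qed.

End random_sum_pgf.

Lemma convolution_pgf (R : realType) (f g : probability (nat * nat)%type R) (a b : R) :
  0 <= a -> 0 <= b ->
  (\int[convolution f g]_st (a ^+ st.1 * b ^+ st.2)%:E =
   \int[f]_st (a ^+ st.1 * b ^+ st.2)%:E * \int[g]_st (a ^+ st.1 * b ^+ st.2)%:E)%E.
Proof.
move=> a0 b0; pose F (st : nat * nat) : R := a ^+ st.1 * b ^+ st.2.
have F0 st : 0 <= F st by rewrite mulr_ge0// exprn_ge0.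
have mF : measurable_fun setT F by move=> _ B _; exact: measurable_nat2.
have mFE : measurable_fun setT (fun st => (F st)%:E) by exact/measurable_EFinP.
have FE0 st : (0 <= (F st)%:E)%E by rewrite lee_fin.
rewrite (ge0_integral_distribution _ mFE FE0).
have mFa := measurableT_comp mFE measurable_add_pair.
rewrite (fubini_tonelli1 _ mFa (fun z => FE0 (Defs.add_pair z))).
transitivity (\int[f]_x ((F x)%:E * \int[g]_y (F y)%:E))%E.
  apply: eq_integral => x _; rewrite /fubini_F -ge0_integralZl_EFin//.
  apply: eq_integral => y _; rewrite -EFinM /F /=; congr EFin.
  by rewrite !exprD; ring.
rewrite ge0_integralZr//.
by apply: integral_ge0 => y _; exact: FE0.
Qed.

Section limit_bidegree_pgf.
Variables (R : realType) (mu : R) (P : probability (nat * R)%type R).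
Variables (d : measure_display) (Omega : measurableType d) (Q : probability Omega R).
Variables (Lambda : {mfun Omega >-> nat}) (H : nat -> {mfun Omega >-> nat}).
Hypotheses (P10 : (0 < cross_moment P 1 0 < +oo)%E)
  (P21 : (0 < cross_moment P 2 1 < +oo)%E) (mu0 : 0 < mu).
Hypothesis sumQ : random_sum_model mu P Q Lambda H.

Lemma limit_bidegree_pgf (a b : R) : 0 <= a <= 1 -> 0 <= b <= 1 ->
  \int[limit_bidegree P Q Lambda H]_st (a ^+ st.1 * b ^+ st.2) =
  linked_pgf_lim mu P a b / linked_pgf_lim mu P 1 1.
Proof.
move=> a01 b01; have /andP[a0 a1] := a01; have /andP[b0 b1] := b01.
have s0 := mean_edges_gt0 P21.
rewrite /Rintegral /limit_bidegree !convolution_pgf//.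
rewrite integral_dirac//=; last first.
  by apply/measurable_EFinP => _ B _; exact: measurable_nat2.
rewrite diracT mul1e !expr1.
rewrite fubini_tonelli1/=; last 2 first.
- by apply/measurable_EFinP => _ B _; exact: measurable_nat2.
- by move=> st; rewrite lee_fin mulr_ge0// exprn_ge0.
rewrite (eq_integral (fun x => ((a ^+ x)%:E *
    \int[random_sum_law Q Lambda H]_y (b ^+ y)%:E)%E)); last first.
  move=> x _; rewrite /fubini_F -ge0_integralZl_EFin ?exprn_ge0//.
  by move=> y _; rewrite lee_fin exprn_ge0.
rewrite ge0_integralZr//; last 2 first.
- by move=> x _; rewrite lee_fin exprn_ge0.
- by apply: integral_ge0 => y _; rewrite lee_fin exprn_ge0.
rewrite !(random_sum_pgf P10 mu0 sumQ)//.
rewrite (@eq_measure_integral _ _ _ _ (joint_measure P)); last first.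
  by move=> A _ _; exact: (joint_lawE P21).
rewrite joint_pgf// -!EFinM /=.
have E (x y : R) : expR (- (mu * (x + y))) = expR (- (mu * x)) * expR (- (mu * y)).
  by rewrite -expRD -opprD -mulrDr.
rewrite linked_pgf_lim1 /linked_pgf_lim (E (mean_size P - size_biased_pgf P a)).
by move: (expR _) (expR _) => e1 e2; field; rewrite !gt_eqF.
Qed.

End limit_bidegree_pgf.

(** * From generating functions to point masses and means *)

Section means_on_nat2.
Variable R : realType.
Implicit Types (mu : probability (nat * nat)%type R) (f g : nat * nat -> R).

Lemma measurable_nat2_fun (D : set (nat * nat)) f : measurable_fun D f.
Proof. by move=> _ B _; exact: measurable_nat2. Qed.

Lemma integrable_nat2 mu f (M : R) : (forall p, `|f p| <= M) ->
  mu.-integrable setT (EFin \o f).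
Proof.
move=> fM; apply: (@probability_integrable _ _ _ _ _ _ M) => //.
exact: measurable_nat2_fun.
Qed.

Lemma le_mean_nat2 mu f g (M : R) : (forall p, `|f p| <= M) ->
  (forall p, `|g p| <= M) -> (forall p, f p <= g p) ->
  \int[mu]_p f p <= \int[mu]_p g p.
Proof.
move=> fM gM fg; apply: le_Rintegral => //.
- exact: integrable_nat2 fM.
- exact: integrable_nat2 gM.
Qed.

Lemma mean_nat2_cst mu (c : R) : \int[mu]_p c = c.
Proof. by rewrite Rintegral_cst// [X in fine X](@probability_setT _ _ _ mu) mulr1. Qed.

Lemma norm_mean_nat2 mu f (M : R) : (forall p, `|f p| <= M) ->
  `|\int[mu]_p f p| <= M.
Proof.
move=> fM; apply: le_trans (le_normr_Rintegral _ (integrable_nat2 mu fM)) _ => //.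
rewrite -[leRHS](mean_nat2_cst mu); apply: (@le_mean_nat2 _ _ _ M) => // p.
  by rewrite normr_id.
by rewrite ger0_norm// (le_trans _ (fM p)).
Qed.

Lemma mean_pred mu (b : pred (nat * nat)) :
  \int[mu]_p (b p)%:R = fine (mu [set p | b p]).
Proof.
rewrite /Rintegral; congr fine.
rewrite (eq_integral (fun p => (\1_[set p | b p] p)%:E)).
  by rewrite integral_indic ?setIT//; exact: measurable_nat2.
move=> p _; rewrite indicE; congr ((nat_of_bool _)%:R)%:E.
by apply/idP/idP => [bp|/set_mem//]; rewrite mem_set.
Qed.

Definition atom mu (q : nat * nat) : R := \int[mu]_p (p == q)%:R.

Lemma atomE mu q : atom mu q = fine (mu [set q]).
Proof.
rewrite /atom (mean_pred mu (pred1 q)); congr (fine (mu _)).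
by apply/seteqP; split => p /= /eqP.
Qed.

Lemma atom_ge0 mu q : 0 <= atom mu q.
Proof. by apply: Rintegral_ge0 => p _. Qed.

Lemma natr_bool_le1 (b : bool) : `|b%:R| <= 1 :> R.
Proof. by case: b; rewrite ?normr1 ?normr0. Qed.

Lemma mean_atom_mul mu f q : \int[mu]_p (f q * (p == q)%:R) = f q * atom mu q.
Proof.
rewrite RintegralZl//.
by apply: (@integrable_nat2 _ _ 1) => p; exact: natr_bool_le1.
Qed.

Definition box (N : nat) : seq (nat * nat) :=
  [seq (i, j) | i <- iota 0 N, j <- iota 0 N].

Lemma mem_box N p : (p \in box N) = (p.1 < N)%N && (p.2 < N)%N.
Proof.
case: p => i j; apply/allpairsP/andP => /= [[[i' j'] /= [iN jN [-> ->]]]|[iN jN]].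
  by move: iN jN; rewrite !mem_iota.
by exists (i, j); rewrite /= !mem_iota.
Qed.

Lemma box_uniq N : uniq (box N).
Proof. by apply: allpairs_uniq; rewrite ?iota_uniq// => -[? ?] [? ?]. Qed.

Lemma mean_box_split mu g (K : R) N : (forall p, `|g p| <= K) ->
  \int[mu]_p g p = \sum_(q <- box N) g q * atom mu q +
    \int[mu]_p (g p * (p \notin box N)%:R).
Proof.
move=> gK; have gp p : g p = \sum_(q <- box N) g q * (p == q)%:R +
    g p * (p \notin box N)%:R.
  have [pN|pN] := boolP (p \in box N).
    rewrite (bigD1_seq p)//= ?box_uniq// eqxx mulr1 mulr0 addr0.
    by rewrite big1 ?addr0// => q; rewrite eq_sym => /negbTE ->; rewrite mulr0.
  rewrite mulr1 big1_seq ?add0r// => q /andP[_ qN].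
  by have [pq|] := eqVneq p q; rewrite ?mulr0//; rewrite pq qN in pN.
have igq q : mu.-integrable setT (EFin \o (fun p => g q * (p == q)%:R)).
  apply: (@integrable_nat2 _ _ K) => p; rewrite normrM -[leRHS]mulr1.
  by apply: ler_pM => //; exact: natr_bool_le1.
rewrite (eq_Rintegral _ _ (g := fun p => \sum_(q <- box N) g q * (p == q)%:R +
    g p * (p \notin box N)%:R)); last by move=> p _; exact: gp.
rewrite RintegralD//; last 2 first.
- rewrite (_ : _ \o _ = (fun p => \sum_(q <- box N) (g q * (p == q)%:R)%:E)%E).
    by apply: integrable_sum => // q _; exact: igq.
  by apply/funext => p /=; rewrite sumEFin.
- apply: (@integrable_nat2 _ _ K) => p; rewrite normrM -[leRHS]mulr1.
  by apply: ler_pM => //; exact: natr_bool_le1.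
rewrite Rintegral_sum//; congr (_ + _).
by apply: eq_bigr => q _; rewrite mean_atom_mul.
Qed.

Lemma box_complement mu N :
  \int[mu]_p (p \notin box N)%:R = 1 - \sum_(q <- box N) atom mu q.
Proof.
have norm1 (p : nat * nat) : `|1 : R| <= 1 by rewrite normr1.
have E1 := mean_box_split mu N norm1; rewrite mean_nat2_cst in E1.
rewrite [X in X - _]E1; under [in RHS]eq_bigr do rewrite mul1r.
by rewrite addrAC subrr add0r; apply: eq_Rintegral => p _; rewrite mul1r.
Qed.

Lemma mean_box mu f (M : R) N : (forall p, `|f p| <= M) ->
  `|\int[mu]_p f p - \sum_(q <- box N) f q * atom mu q| <=
  M * (1 - \sum_(q <- box N) atom mu q).
Proof.
move=> fM; rewrite (mean_box_split mu N fM) addrAC subrr add0r -box_complement.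
have iD : mu.-integrable setT (EFin \o (fun p => (p \notin box N)%:R)).
  by apply: (@integrable_nat2 _ _ 1) => p; exact: natr_bool_le1.
rewrite -RintegralZl//.
have fD p : `|f p * (p \notin box N)%:R| <= M.
  by rewrite normrM -[leRHS]mulr1; apply: ler_pM => //; exact: natr_bool_le1.
apply: le_trans (le_normr_Rintegral _ (integrable_nat2 mu fD)) _ => //.
have M0 : 0 <= M by apply: le_trans (fM (0%N, 0%N)).
apply: (@le_mean_nat2 _ _ _ M) => p; rewrite ?normr_id//.
  by rewrite normrM (ger0_norm M0) -[leRHS]mulr1 ler_wpM2l//; exact: natr_bool_le1.
by rewrite normrM (@ger0_norm _ (_)%:R)// ler_wpM2r.
Qed.

Lemma box_mass mu : \sum_(q <- box N) atom mu q @[N --> \oo] --> (1 : R).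
Proof.
pose F N := [set p : nat * nat | p \notin box N].
have mF N : measurable (F N) by exact: measurable_nat2.
have bE N : \sum_(q <- box N) atom mu q = 1 - fine (mu (F N)).
  rewrite -(mean_pred mu (fun p => p \notin box N)).
  by rewrite box_complement opprB addrC subrK.
have F0 : mu (F N) @[N --> \oo] --> 0%E.
  have I0 : \bigcap_N F N = set0.
    apply/seteqP; split => // -[i j] /(_ (maxn i j).+1 Logic.I).
    by rewrite /F /= mem_box /= !ltnS leq_maxl leq_maxr.
  rewrite -(measure0 mu) -I0; apply: nonincreasing_cvg_mu => //.
  - by rewrite -ge0_fin_numE ?fin_num_measure.
  - by rewrite I0.
  move=> a b ab; apply/subsetPset => p; rewrite /F /= !mem_box.
  by apply: contraNN => /andP[pa pb]; rewrite !(leq_trans _ ab).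
have : 1 - fine (mu (F N)) @[N --> \oo] --> (1 - 0 : R).
  by apply: cvgB; [exact: cvg_cst|exact: fine_cvg].
by rewrite subr0; under eq_fun do rewrite -bE.
Qed.

Lemma exists_atom (nu : probability (nat * nat)%type R) : exists q, 0 < atom nu q.
Proof.
apply: contrapT => nq.
have a0 q : atom nu q = 0.
  apply/eqP; rewrite eq_le atom_ge0 andbT leNgt.
  by apply/negP => qp; apply: nq; exists q.
have := box_mass nu; under eq_fun do under eq_bigr do rewrite a0.
under eq_fun do rewrite big1//.
move=> /cvg_lim => /(_ (@norm_hausdorff _ _)); rewrite lim_cst// => /esym/eqP.
by rewrite oner_eq0.
Qed.

Lemma atom_gt0 (nu : probability (nat * nat)%type R) q :
  (0 < atom nu q) = (0 < nu [set q])%E.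
Proof. by rewrite atomE -lte_fin fineK// fin_num_measure//; exact: measurable_nat2. Qed.

(** Because the limit is a probability, no mass escapes: a finite box that carries almost all of
    [mu] eventually carries almost all of [mun n], and on it the integral is a finite sum. The
    integrand may vary with [n], as do the midranks and the inner integral of a double one. *)
Lemma mean_limit (mun : nat -> probability (nat * nat)%type R) mu
    (fn : nat -> nat * nat -> R) f (M : R) :
  (forall q, atom (mun n) q @[n --> \oo] --> atom mu q) ->
  (forall q, fn n q @[n --> \oo] --> f q) -> (forall n q, `|fn n q| <= M) ->
  \int[mun n]_p fn n p @[n --> \oo] --> \int[mu]_p f p.
Proof.
move=> mul fnf fnM.
have fM q : `|f q| <= M.
  have nf : `|fn n q| @[n --> \oo] --> `|f q| by apply: cvg_norm; exact: fnf.
  by apply: (cvgr_to_le nf); apply: nearW => n; exact: fnM.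
have M0 : 0 <= M by apply: le_trans (fM (0%N, 0%N)).
apply/cvgrPdist_lt => e e0.
(* [M + 1] avoids a zero denominator. The error is at most [e / 4] outside the box under [mu],
   [e / 2] outside it under [mun n], and less than [e / 4] on it. *)
have d0 : 0 < e / (4 * (M + 1)) by rewrite divr_gt0// mulr_gt0//; lra.
have /cvgrPdist_lt/(_ _ d0)[N _ /(_ N (leqnn N))] := box_mass mu.
rewrite /= => massN.
pose Sn n := \sum_(q <- box N) fn n q * atom (mun n) q.
pose S := \sum_(q <- box N) f q * atom mu q.
have sum_cvg (gn : nat -> nat * nat -> R) g : (forall q, gn n q @[n --> \oo] --> g q) ->
    \sum_(q <- box N) gn n q @[n --> \oo] --> \sum_(q <- box N) g q.
  move=> gng; elim: (box N) => [|q s IH].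
    by rewrite big_nil; under eq_fun do rewrite big_nil; exact: cvg_cst.
  by rewrite big_cons; under eq_fun do rewrite big_cons; exact: cvgD.
have SnS : Sn n @[n --> \oo] --> S.
  by apply: sum_cvg => q; apply: cvgM; [exact: fnf|exact: mul].
have massn : \sum_(q <- box N) atom (mun n) q @[n --> \oo] -->
    \sum_(q <- box N) atom mu q by exact: sum_cvg.
have e4 : 0 < e / 4 by rewrite divr_gt0.
have ev1 := @cvgr_dist_lt _ _ _ _ _ _ _ SnS _ e4.
have ev2 := @cvgr_dist_lt _ _ _ _ _ _ _ massn _ d0.
near=> n.
have h1 : `|S - Sn n| < e / 4 by near: n; exact: ev1.
have h2 : `|\sum_(q <- box N) atom mu q - \sum_(q <- box N) atom (mun n) q| <
    e / (4 * (M + 1)) by near: n; exact: ev2.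
have b1 := mean_box mu N fM; have b2 := mean_box (mun n) N (fnM n).
have Md : M * (e / (4 * (M + 1))) <= e / 4.
  have M1 : 0 < M + 1 by lra.
  rewrite (_ : e / (4 * (M + 1)) = (e / 4) / (M + 1)); last by field; lra.
  rewrite mulrCA ler_piMr ?(ltW e4)// ler_pdivrMr//; lra.
have arith (s sn i i_n p pn d : R) : M * d <= e / 4 ->
    `|i - s| <= M * (1 - p) -> `|i_n - sn| <= M * (1 - pn) -> `|s - sn| < e / 4 ->
    `|p - pn| < d -> `|1 - p| < d -> `|i - i_n| < e.
  rewrite !ltr_norml !ler_norml.
  move=> Md' /andP[a1 a2] /andP[a3 a4] /andP[a5 a6] /andP[a7 a8] /andP[a9 a10].
  have q1 : M * (1 - p) <= M * d by rewrite ler_wpM2l// ltW.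
  have q2 : M * (p - pn) <= M * d by rewrite ler_wpM2l// ltW.
  have E : M * (1 - pn) = M * (1 - p) + M * (p - pn) by ring.
  by apply/andP; split; lra.
exact: (arith _ _ _ _ _ _ _ Md b1 b2 h1 h2 massN).
Unshelve. all: by end_near. Qed.

End means_on_nat2.

Section pgf_to_atoms.
Variable R : realType.

(* By induction the coefficients below [k] converge; the tail above [k],
   divided by [a ^+ k], is at most [a], which can be taken arbitrarily small. *)
Lemma coefficient_limit (mun : nat -> probability (nat * nat)%type R)
    (mu : probability (nat * nat)%type R) (X : nat * nat -> nat) (Y : nat * nat -> R) :
  (forall p, 0 <= Y p <= 1) ->
  (forall a, 0 < a < 1 -> \int[mun n]_p (a ^+ X p * Y p) @[n --> \oo] -->
     \int[mu]_p (a ^+ X p * Y p)) ->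
  forall k, \int[mun n]_p ((X p == k)%:R * Y p) @[n --> \oo] -->
     \int[mu]_p ((X p == k)%:R * Y p).
Proof.
move=> Y01 pgf k; elim/ltn_ind: k => k IH.
have Y0 p : 0 <= Y p by case/andP: (Y01 p).
have Y1 p : Y p <= 1 by case/andP: (Y01 p).
pose c (nu : probability (nat * nat)%type R) i := \int[nu]_p ((X p == i)%:R * Y p).
pose r a (nu : probability (nat * nat)%type R) :=
  \int[nu]_p (a ^+ X p * (k < X p)%N%:R * Y p).
pose T a (nu : probability (nat * nat)%type R) :=
  (\int[nu]_p (a ^+ X p * Y p)) - \sum_(i <- iota 0 k) a ^+ i * c nu i.
have bnd (b : bool) p : `|b%:R * Y p| <= 1.
  by rewrite ger0_norm ?mulr_ge0// mulr_ile1//; case: b.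
have rE a nu : 0 < a < 1 -> T a nu = a ^+ k * c nu k + r a nu.
  move=> /andP[a0 a1]; have a0' := ltW a0; have a1' := ltW a1.
  have split p : a ^+ X p * Y p = \sum_(i <- iota 0 k.+1) a ^+ i * ((X p == i)%:R * Y p) +
      a ^+ X p * (k < X p)%N%:R * Y p.
    have [kX|Xk] := ltnP k (X p).
      rewrite mulr1 big1_seq ?add0r// => i /andP[_]; rewrite mem_iota add0n ltnS => ik.
      by rewrite gtn_eqF ?mul0r ?mulr0// (leq_ltn_trans ik).
    rewrite mulr0 mul0r addr0 (bigD1_seq (X p)) ?iota_uniq ?mem_iota ?add0n ?ltnS ?Xk//=.
    rewrite eqxx mul1r big1 ?addr0// => i; rewrite eq_sym => /negbTE ->.
    by rewrite mul0r mulr0.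
  have iI i : nu.-integrable setT (EFin \o (fun p => a ^+ i * ((X p == i)%:R * Y p))).
    apply: (@integrable_nat2 _ _ _ 1) => p; rewrite normrM -[leRHS]mulr1.
    by apply: ler_pM => //; rewrite ger0_norm ?exprn_ge0// exprn_ile1.
  have ir : nu.-integrable setT (EFin \o (fun p => a ^+ X p * (k < X p)%N%:R * Y p)).
    apply: (@integrable_nat2 _ _ _ 1) => p; rewrite -mulrA normrM -[leRHS]mulr1.
    by apply: ler_pM => //; rewrite ger0_norm ?exprn_ge0// exprn_ile1.
  rewrite /T /r (eq_Rintegral _ _ (g := fun p =>
     \sum_(i <- iota 0 k.+1) a ^+ i * ((X p == i)%:R * Y p) +
      a ^+ X p * (k < X p)%N%:R * Y p)); last by move=> p _; exact: split.
  rewrite RintegralD//; last first.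
    rewrite (_ : _ \o _ = (fun p => \sum_(i <- iota 0 k.+1)
        (a ^+ i * ((X p == i)%:R * Y p))%:E)%E).
      by apply: integrable_sum => // i _; exact: iI.
    by apply/funext => p /=; rewrite sumEFin.
  rewrite Rintegral_sum//.
  have -> : \sum_(i <- iota 0 k.+1) \int[nu]_p (a ^+ i * ((X p == i)%:R * Y p)) =
      \sum_(i <- iota 0 k.+1) a ^+ i * c nu i.
    apply: eq_bigr => i _; rewrite RintegralZl//.
    by apply: (@integrable_nat2 _ _ _ 1) => p; exact: bnd.
  rewrite -[in iota 0 k.+1]addn1 iotaD big_cat/= big_seq1 add0n.
  have E (A B C : R) : A + B + C - A = B + C by ring.
  exact: E.
have r0 a nu : 0 < a < 1 -> 0 <= r a nu <= a ^+ k.+1.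
  move=> /andP[a0 a1]; have a0' := ltW a0; have a1' := ltW a1.
  apply/andP; split.
    by apply: Rintegral_ge0 => p _; rewrite !mulr_ge0 ?exprn_ge0.
  rewrite -[leRHS](mean_nat2_cst nu); apply: (@le_mean_nat2 _ _ _ _ 1) => p.
  - rewrite -mulrA normrM -[leRHS]mulr1.
    by apply: ler_pM => //; rewrite ger0_norm ?exprn_ge0// exprn_ile1.
  - by rewrite ger0_norm ?exprn_ge0// exprn_ile1.
  have [kX|_] := ltnP k (X p); last by rewrite mulr0 mul0r exprn_ge0.
  rewrite mulr1 -[leRHS]mulr1 ler_pM ?exprn_ge0//.
  by rewrite ler_wiXn2l.
have Tlim a : 0 < a < 1 -> T a (mun n) @[n --> \oo] --> T a mu.
  move=> a01; apply: cvgB; first exact: pgf.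
  have sum_cvg (s : seq nat) : (forall i, i \in s -> (i < k)%N) ->
      \sum_(i <- s) a ^+ i * c (mun n) i @[n --> \oo] --> \sum_(i <- s) a ^+ i * c mu i.
    elim: s => [|i s IHs] sk.
      by rewrite big_nil; under eq_fun do rewrite big_nil; exact: cvg_cst.
    rewrite big_cons; under eq_fun do rewrite big_cons; apply: cvgD.
      by apply: cvgM; [exact: cvg_cst|apply: IH; apply: sk; rewrite inE eqxx].
    by apply: IHs => j js; apply: sk; rewrite inE js orbT.
  by apply: sum_cvg => i; rewrite mem_iota.
apply/cvgrPdist_lt => e e0.
(* After division by [a ^+ k] the tails differ by at most [a <= e / 2]; the bound [1 / 2] keeps [a]
   below 1. *)
pose a : R := Num.min (e / 2) (1 / 2).
have a01 : 0 < a < 1.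
  by rewrite lt_min !divr_gt0//= gt_min; apply/orP; right; lra.
have ae : a <= e / 2 by rewrite ge_min lexx.
have /andP[a0 a1] := a01; have ak0 : 0 < a ^+ k by rewrite exprn_gt0.
have d0 : 0 < a ^+ k * (e / 2) by rewrite mulr_gt0// divr_gt0.
have ev := @cvgr_dist_lt _ _ _ _ _ _ _ (Tlim a a01) _ d0.
near=> n.
have h : `|T a mu - T a (mun n)| < a ^+ k * (e / 2) by near: n; exact: ev.
have rn := r0 a (mun n) a01; have rm := r0 a mu a01.
move: h; rewrite !rE//; rewrite exprS in rn rm.
rewrite -/(c mu k) -/(c (mun n) k).
move: (c mu k) (c (mun n) k) (r a mu) (r a (mun n)) (a ^+ k) rn rm ak0 => x y u v z.
move=> /andP[u1 u2] /andP[v1 v2] z0; rewrite !ltr_norml => /andP[l1 l2].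
have az : a * z <= (e / 2) * z by rewrite ler_wpM2r// ltW.
by apply/andP; split; rewrite -(ltr_pM2l z0); lra.
Unshelve. all: by end_near. Qed.

(** Coefficients are extracted one variable at a time: first in [p.1] with the weight [b ^+ p.2],
    then in [p.2] with the indicator of [p.1 = i] as weight. *)
Lemma pgf_atom_limit (mun : nat -> probability (nat * nat)%type R)
    (mu : probability (nat * nat)%type R) :
  (forall a b, 0 <= a <= 1 -> 0 <= b <= 1 ->
     \int[mun n]_p (a ^+ p.1 * b ^+ p.2) @[n --> \oo] -->
     \int[mu]_p (a ^+ p.1 * b ^+ p.2)) ->
  forall q, atom (mun n) q @[n --> \oo] --> atom mu q.
Proof.
move=> pgf [i j].
have h b : 0 < b < 1 -> \int[mun n]_p ((p.1 == i)%:R * b ^+ p.2) @[n --> \oo] -->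
    \int[mu]_p ((p.1 == i)%:R * b ^+ p.2).
  move=> /andP[b0 b1].
  apply: (@coefficient_limit mun mu fst (fun p => b ^+ p.2)) => [p|a /andP[a0 a1]].
    by rewrite exprn_ge0 ?exprn_ile1// ltW.
  by apply: pgf; rewrite !ltW.
have E (nu : probability (nat * nat)%type R) :
    atom nu (i, j) = \int[nu]_p ((p.2 == j)%:R * (p.1 == i)%:R).
  by apply: eq_Rintegral => -[s t] _; rewrite xpair_eqE mulrC -natrM mulnb.
rewrite E; under eq_fun do rewrite E.
apply: (@coefficient_limit mun mu snd (fun p => (p.1 == i)%:R)) => [p|a a01].
  by rewrite ler0n lern1 leq_b1.
rewrite (eq_Rintegral _ _ (g := fun p => (p.1 == i)%:R * a ^+ p.2)); last first.
  by move=> p _; rewrite mulrC.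
under eq_fun do under eq_Rintegral do rewrite mulrC.
exact: h.
Qed.

Lemma atom_le_mean (mu : probability (nat * nat)%type R) (f : nat * nat -> R) (M : R) q :
  (forall p, 0 <= f p <= M) -> f q * atom mu q <= \int[mu]_p f p.
Proof.
move=> fM; have fM' p : `|f p| <= M.
  by have /andP[f0 ?] := fM p; rewrite ger0_norm.
rewrite -mean_atom_mul; apply: (@le_mean_nat2 _ _ _ _ M) => // p.
  rewrite normrM -[leRHS]mulr1; apply: ler_pM => //; exact: natr_bool_le1.
have /andP[f0 _] := fM p; have [->|_] := eqVneq p q; first by rewrite mulr1.
by rewrite mulr0.
Qed.

End pgf_to_atoms.

(** * Correlations *)

Section correlations.
Variable R : realType.

Lemma correlation_bounded d (T : measurableType d) (Pr : probability T R)
    (X Y : T -> R) (M N : R) :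
  measurable_fun setT X -> measurable_fun setT Y ->
  (forall t, `|X t| <= M) -> (forall t, `|Y t| <= N) ->
  correlation Pr X Y =
  ((\int[Pr]_t (X t * Y t)) - (\int[Pr]_t X t) * (\int[Pr]_t Y t)) /
  (Num.sqrt ((\int[Pr]_t (X t * X t)) - (\int[Pr]_t X t) * (\int[Pr]_t X t)) *
   Num.sqrt ((\int[Pr]_t (Y t * Y t)) - (\int[Pr]_t Y t) * (\int[Pr]_t Y t))).
Proof.
have covE (U V : T -> R) (A B : R) : measurable_fun setT U -> measurable_fun setT V ->
    (forall t, `|U t| <= A) -> (forall t, `|V t| <= B) ->
    fine (covariance Pr U V) =
    (\int[Pr]_t (U t * V t)) - (\int[Pr]_t U t) * (\int[Pr]_t V t).
  move=> mU mV UA VB.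
  have iU : Pr.-integrable setT (EFin \o U).
    by apply: (@probability_integrable _ _ _ _ _ _ A).
  have iV : Pr.-integrable setT (EFin \o V).
    by apply: (@probability_integrable _ _ _ _ _ _ B).
  have iUV : Pr.-integrable setT (EFin \o (fun t => U t * V t)).
    apply: (@probability_integrable _ _ _ _ _ _ (A * B)) => //.
      exact: measurable_funM.
    by move=> t _; rewrite normrM ler_pM.
  have lU := (Lfun1_integrable Pr U).2 iU.
  have lV := (Lfun1_integrable Pr V).2 iV.
  have lUV : (U * V)%R \in Lfun Pr 1 by apply/Lfun1_integrable; exact: iUV.
  rewrite covarianceE// fineB ?fin_numM ?expectation_fin_num//.
  by rewrite fineM ?expectation_fin_num// unlock.
move=> mX mY XM YN; rewrite /correlation /variance.
by rewrite (covE _ _ M N)// (covE _ _ M M)// (covE _ _ N N).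
Qed.

Lemma cvg_correlation_ratio (xy x y xx yy : nat -> R) (lxy lx ly lxx lyy : R) :
  xy n @[n --> \oo] --> lxy -> x n @[n --> \oo] --> lx -> y n @[n --> \oo] --> ly ->
  xx n @[n --> \oo] --> lxx -> yy n @[n --> \oo] --> lyy ->
  0 < lxx - lx * lx -> 0 < lyy - ly * ly ->
  (xy n - x n * y n) /
    (Num.sqrt (xx n - x n * x n) * Num.sqrt (yy n - y n * y n)) @[n --> \oo] -->
  (lxy - lx * ly) / (Num.sqrt (lxx - lx * lx) * Num.sqrt (lyy - ly * ly)).
Proof.
move=> hxy hx hy hxx hyy vx vy.
have cD (a b c : nat -> R) (la lb lc : R) : a n @[n --> \oo] --> la ->
    b n @[n --> \oo] --> lb -> c n @[n --> \oo] --> lc ->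
    a n - b n * c n @[n --> \oo] --> la - lb * lc.
  by move=> ha hb hc; apply: cvgB => //; exact: cvgM.
have cS (a : nat -> R) (la : R) : a n @[n --> \oo] --> la ->
    Num.sqrt (a n) @[n --> \oo] --> Num.sqrt la.
  by move=> ha; apply: (continuous_cvg _ (@sqrt_continuous R la)) ha.
apply: cvgM; first exact: cD.
apply: cvgV; first by rewrite mulf_neq0// gt_eqF// sqrtr_gt0.
by apply: cvgM; apply: cS; exact: cD.
Qed.

Lemma variance_sqr (mu : probability (nat * nat)%type R) (f : nat * nat -> R) (M : R) :
  (forall p, `|f p| <= M) ->
  (\int[mu]_t (f t * f t)) - (\int[mu]_t f t) * (\int[mu]_t f t) =
  \int[mu]_t ((f t - \int[mu]_p f p) ^+ 2).
Proof.
move=> fM; set e := \int[mu]_t f t.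
have M0 : 0 <= M by apply: le_trans (fM (0, 0)%N).
have eM : `|e| <= M by exact: norm_mean_nat2.
have fi : mu.-integrable setT (EFin \o f) by exact: integrable_nat2 fM.
have ffM t : `|f t * f t| <= M * M by rewrite normrM ler_pM.
have hM t : `|2 * e * f t| <= 2 * (M * M).
  by rewrite !normrM (ger0_norm (_ : 0 <= 2))// -mulrA ler_pM2l// ler_pM.
rewrite [RHS](eq_Rintegral _ _ (g := fun t => f t * f t - 2 * e * f t + e * e)); last first.
  by move=> t _; ring.
rewrite RintegralD//; last 2 first.
- apply: (@integrable_nat2 _ _ _ (3 * (M * M))) => t.
  apply: le_trans (ler_normB _ _) _; move: (ffM t) (hM t); lra.
- by apply: (@integrable_nat2 _ _ _ (M * M)) => t; rewrite normrM ler_pM.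
rewrite RintegralB//; last 2 first.
- exact: integrable_nat2 ffM.
- exact: integrable_nat2 hM.
by rewrite RintegralZl// mean_nat2_cst -/e; ring.
Qed.

Lemma variance_ge0 (mu : probability (nat * nat)%type R) (f : nat * nat -> R) (M : R) :
  (forall p, `|f p| <= M) ->
  0 <= (\int[mu]_t (f t * f t)) - (\int[mu]_t f t) * (\int[mu]_t f t).
Proof.
by move=> fM; rewrite (variance_sqr mu fM); apply: Rintegral_ge0 => t _; exact: sqr_ge0.
Qed.

(** Two atoms with different values cannot both lie at the mean, and one off the mean contributes a
    positive term. *)
Lemma variance_gt0 (mu : probability (nat * nat)%type R) (f : nat * nat -> R) (M : R) p q :
  (forall p, `|f p| <= M) -> 0 < atom mu p -> 0 < atom mu q -> f p != f q ->
  0 < (\int[mu]_t (f t * f t)) - (\int[mu]_t f t) * (\int[mu]_t f t).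
Proof.
move=> fM p0 q0 fpq; rewrite (variance_sqr mu fM); set e := \int[mu]_t f t.
have eM : `|e| <= M by exact: norm_mean_nat2.
have sqM t : 0 <= (f t - e) ^+ 2 <= (2 * M) * (2 * M).
  rewrite sqr_ge0/= -real_normK ?num_real// expr2.
  have ? : `|f t - e| <= 2 * M by apply: le_trans (ler_normB _ _) _; move: (fM t) eM; lra.
  by rewrite ler_pM.
have lb t := @atom_le_mean _ mu _ _ t sqM.
have [fpe|fpe] := eqVneq (f p) e.
  apply: lt_le_trans (lb q); rewrite mulr_gt0// exprn_even_gt0//= subr_eq0.
  by rewrite -fpe eq_sym.
by apply: lt_le_trans (lb p); rewrite mulr_gt0// exprn_even_gt0//= subr_eq0.
Qed.

(** By the law of total variance, the variance for two independent points is at least the mean over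
    [s] of the variance of [F s], to which the atom [p] contributes a positive term. *)
Lemma double_variance_gt0 (mu : probability (nat * nat)%type R)
    (F : nat * nat -> nat * nat -> R) (M : R) p q :
  (forall p q, `|F p q| <= M) -> 0 < atom mu p -> 0 < atom mu q -> F p p != F p q ->
  0 < (\int[mu]_s (\int[mu]_t (F s t * F s t))) -
      (\int[mu]_s (\int[mu]_t F s t)) * (\int[mu]_s (\int[mu]_t F s t)).
Proof.
move=> FM p0 q0 Fpq.
have M0 : 0 <= M by apply: le_trans (FM p p).
pose f s := \int[mu]_t F s t; pose g s := \int[mu]_t (F s t * F s t).
have fM s : `|f s| <= M by exact: norm_mean_nat2.
have gM s : `|g s| <= M * M by apply: norm_mean_nat2 => t; rewrite normrM ler_pM.
have ffM t : `|f t * f t| <= M * M by rewrite normrM ler_pM.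
have v0 s : 0 <= g s - f s * f s by exact: variance_ge0 (FM s).
have vp : 0 < g p - f p * f p by exact: (variance_gt0 (FM p)) p0 q0 Fpq.
have vM s : 0 <= g s - f s * f s <= 2 * (M * M).
  rewrite v0/= (le_trans (ler_norm _))// (le_trans (ler_normB _ _))//.
  by move: (gM s) (ffM s); lra.
have := atom_le_mean mu p vM; rewrite RintegralB//; last 2 first.
- exact: integrable_nat2 gM.
- exact: integrable_nat2 ffM.
have := variance_ge0 mu fM.
have : 0 < (g p - f p * f p) * atom mu p by rewrite mulr_gt0.
rewrite -/(f _) -/(g _); lra.
Qed.

End correlations.

(** * Rank correlations of laws on pairs of integers *)

Section real_laws.
Variable R : realType.
Implicit Type mu : probability (nat * nat)%type R.

Lemma real_law_mean mu (g : R * R -> R) (M : R) :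
  measurable_fun setT g -> (forall x, `|g x| <= M) ->
  \int[real_law mu]_x g x = \int[mu]_p g (real_pair R p).
Proof.
move=> mg gM; rewrite /Rintegral; congr fine; rewrite integral_distribution//.
  exact/measurable_EFinP.
exact: (@integrable_nat2 _ mu (fun p => g (real_pair R p)) M).
Qed.

Lemma real_law_mean2 mu (g : (R * R) * (R * R) -> R) (M : R) :
  measurable_fun setT g -> (forall x, `|g x| <= M) ->
  \int[(real_law mu \x real_law mu)%E]_x g x =
  \int[mu]_p (\int[mu]_q g (real_pair R p, real_pair R q)).
Proof.
move=> mg gM.
have ig : (real_law mu \x real_law mu)%E.-integrable setT (EFin \o g).
  exact: (@probability_integrable _ _ _ _ _ _ M).
have igx x : (real_law mu).-integrable setT (EFin \o (fun y => g (x, y))).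
  apply: (@probability_integrable _ _ _ _ _ _ M) => //.
  exact: measurableT_comp mg (pair1_measurable x).
pose G x := \int[real_law mu]_y g (x, y).
have GE x : (\int[real_law mu]_y (g (x, y))%:E)%E = (G x)%:E.
  by rewrite fineK//; apply: integrable_fin_num (igx x).
have mG : measurable_fun setT G.
  apply/measurable_EFinP; have := measurable_fubini_F ig.
  by apply: eq_measurable_fun => x _; exact: GE.
have Gq x : G x = \int[mu]_q g (x, real_pair R q).
  apply: (@real_law_mean mu (fun y => g (x, y)) M) => //.
  exact: measurableT_comp mg (pair1_measurable x).
have GM x : `|G x| <= M by rewrite Gq; exact: norm_mean_nat2.
transitivity (\int[real_law mu]_x G x).
  rewrite /Rintegral; congr fine; rewrite -(integral12_prod_meas1 ig).
  by apply: eq_integral => x _; exact: GE.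
by rewrite (real_law_mean mu mG GM); apply: eq_Rintegral => p _; exact: Gq.
Qed.

Lemma measurable_sg : measurable_fun setT (@Num.sg R).
Proof.
apply: nondecreasing_measurable => // x y xy.
have [x0|x0|x0] := ltgtP x 0; have [y0|y0|y0] := ltgtP y 0; rewrite ?x0 ?y0 ?sgr0
  ?(ltr0_sg x0) ?(ltr0_sg y0) ?(gtr0_sg x0) ?(gtr0_sg y0); lra.
Qed.

Lemma norm_sg_le1 (x : R) : `|Num.sg x| <= 1.
Proof. by rewrite normr_sg; case: (x == 0) => /=; rewrite ?lexx ?ler01. Qed.

Lemma kendall_limit (mun : nat -> probability (nat * nat)%type R) mu p q :
  (forall q, atom (mun n) q @[n --> \oo] --> atom mu q) ->
  0 < atom mu p -> 0 < atom mu q -> p.1 != q.1 -> p.2 != q.2 ->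
  kendall (real_law (mun n)) @[n --> \oo] --> kendall (real_law mu).
Proof.
move=> lim p0 q0 pq1 pq2.
pose F1 (z : (R * R) * (R * R)) := Num.sg (z.1.1 - z.2.1).
pose F2 (z : (R * R) * (R * R)) := Num.sg (z.1.2 - z.2.2).
have mF1 : measurable_fun setT F1.
  apply: measurableT_comp; first exact: measurable_sg.
  by apply: measurable_funB; apply: measurableT_comp => //.
have mF2 : measurable_fun setT F2.
  apply: measurableT_comp; first exact: measurable_sg.
  by apply: measurable_funB; apply: measurableT_comp => //.
have F1M z : `|F1 z| <= 1 by exact: norm_sg_le1.
have F2M z : `|F2 z| <= 1 by exact: norm_sg_le1.
have FM (F G : (R * R) * (R * R) -> R) : (forall z, `|F z| <= 1) ->
    (forall z, `|G z| <= 1) -> forall z, `|F z * G z| <= 1.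
  by move=> hF hG z; rewrite normrM -[leRHS]mulr1 ler_pM.
have cv (F : (R * R) * (R * R) -> R) : measurable_fun setT F -> (forall z, `|F z| <= 1) ->
    \int[(real_law (mun n) \x real_law (mun n))%E]_z F z @[n --> \oo] -->
    \int[(real_law mu \x real_law mu)%E]_z F z.
  move=> mF hF; rewrite (real_law_mean2 mu mF hF).
  under eq_fun do rewrite (real_law_mean2 _ mF hF).
  (* The outer integrand is the inner integral, which depends on [n] and converges by a second use
     of [mean_limit]. *)
  apply: (mean_limit lim (M := 1)) => [s|n s]; last exact: norm_mean_nat2.
  by apply: (mean_limit lim (M := 1)) => // t; exact: cvg_cst.
rewrite /kendall (correlation_bounded _ mF1 mF2 F1M F2M).
under eq_fun do rewrite (correlation_bounded _ mF1 mF2 F1M F2M).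
(* With the first point at [p], the sign is 0 when the second is at [p] and nonzero when it is at
   [q]. *)
have dif (i j : nat) : i != j -> Num.sg (i%:R - i%:R : R) != Num.sg (i%:R - j%:R).
  by move=> ij; rewrite subrr sgr0 eq_sym sgr_eq0 subr_eq0 eqr_nat.
apply: cvg_correlation_ratio.
- by apply: cv; [exact: measurable_funM|exact: FM].
- exact: cv.
- exact: cv.
- by apply: cv; [exact: measurable_funM|exact: FM].
- by apply: cv; [exact: measurable_funM|exact: FM].
- rewrite (real_law_mean2 mu (measurable_funM mF1 mF1) (FM _ _ F1M F1M)).
  rewrite (real_law_mean2 mu mF1 F1M).
  by apply: (double_variance_gt0 (M := 1)) p0 q0 _ => //; exact: dif.
- rewrite (real_law_mean2 mu (measurable_funM mF2 mF2) (FM _ _ F2M F2M)).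
  rewrite (real_law_mean2 mu mF2 F2M).
  by apply: (double_variance_gt0 (M := 1)) p0 q0 _ => //; exact: dif.
Qed.

(** The mean of this function is the midrank at [i]; in this form midranks are expectations to which
    [mean_limit] applies. *)
Definition midcount (k : nat * nat -> nat) i (p : nat * nat) : R :=
  ((k p < i)%N%:R + (k p <= i)%N%:R) / 2.

Lemma midcount01 k i p : 0 <= midcount k i p <= 1.
Proof. by rewrite /midcount; case: (_ < _)%N; case: (_ <= _)%N => /=; lra. Qed.

Lemma norm_midcount k i p : `|midcount k i p| <= 1.
Proof. by have /andP[? ?] := midcount01 k i p; rewrite ger0_norm. Qed.

Lemma midrank_pushforward mu (g : R * R -> R) k i :
  (forall p, g (real_pair R p) = (k p)%:R) ->
  midrank (pushforward (real_law mu) g) i%:R = \int[mu]_p midcount k i p.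
Proof.
move=> gk.
have iP (b : pred (nat * nat)) : mu.-integrable setT (EFin \o (fun p => (b p)%:R : R)).
  by apply: (@integrable_nat2 _ _ _ 1) => p; exact: natr_bool_le1.
rewrite /midcount; under eq_Rintegral do rewrite mulrDl.
under eq_Rintegral do rewrite mulrC [X in _ + X]mulrC.
rewrite RintegralD//; last 2 first.
- by apply: (@integrable_nat2 _ _ _ 1) => p; case: (_ < _)%N => /=; rewrite ger0_norm; lra.
- by apply: (@integrable_nat2 _ _ _ 1) => p; case: (_ <= _)%N => /=; rewrite ger0_norm; lra.
rewrite !RintegralZl//= !mean_pred /midrank -mulrDr mulrC; congr (_ * (fine _ + fine _)).
  rewrite /pushforward /= /distribution /pushforward; congr (mu _).
  by apply/seteqP; split => p /=; rewrite in_itv/= gk ltr_nat.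
rewrite /pushforward /= /distribution /pushforward; congr (mu _).
by apply/seteqP; split => p /=; rewrite in_itv/= gk ler_nat.
Qed.

Lemma midrank01 (nu : probability (R * R)%type R) (g : R * R -> R) x :
  measurable_fun setT g -> 0 <= midrank (pushforward nu g) x <= 1.
Proof.
move=> mg.
have h (A : set R) : measurable A -> 0 <= fine (pushforward nu g A) <= 1.
  move=> mA; have mgA : measurable (g @^-1` A) by rewrite -[X in measurable X]setTI; exact: mg.
  rewrite /pushforward fine_ge0//= -[leRHS]/(fine 1%:E).
  by rewrite fine_le ?fin_num_measure// probability_le1.
have /andP[? ?] := h `]-oo, x[ (measurable_itv _).
have /andP[? ?] := h `]-oo, x] (measurable_itv _).
by rewrite /midrank; lra.
Qed.

Lemma measurable_midrank (nu : probability (R * R)%type R) (g : R * R -> R) :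
  measurable_fun setT g -> measurable_fun setT (midrank (pushforward nu g)).
Proof.
move=> mg; apply: nondecreasing_measurable => // x y xy.
have h (A B : set R) : measurable A -> measurable B -> A `<=` B ->
    fine (pushforward nu g A) <= fine (pushforward nu g B).
  move=> mA mB AB.
  have mgA : measurable (g @^-1` A) by rewrite -[X in measurable X]setTI; exact: mg.
  have mgB : measurable (g @^-1` B) by rewrite -[X in measurable X]setTI; exact: mg.
  rewrite /pushforward fine_le ?fin_num_measure// le_measure ?inE//.
  by move=> t; exact: AB.
rewrite /midrank ler_pM2r ?invr_gt0//; apply: lerD; apply: h => //.
  by move=> t /=; rewrite !in_itv/= => /lt_le_trans; exact.
by move=> t /=; rewrite !in_itv/= => /le_trans; exact.
Qed.

(** The difference of the integrands is nonnegative and equals [1 / 2] at the atom [p]. *)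
Lemma midcount_mean_lt mu k p q : 0 < atom mu p -> (k p < k q)%N ->
  \int[mu]_t midcount k (k p) t < \int[mu]_t midcount k (k q) t.
Proof.
move=> p0 pq; rewrite -subr_gt0 -RintegralB//; last 2 first.
- by apply: (@integrable_nat2 _ _ _ 1) => t; exact: norm_midcount.
- by apply: (@integrable_nat2 _ _ _ 1) => t; exact: norm_midcount.
have h t : 0 <= midcount k (k q) t - midcount k (k p) t <= 1.
  have /andP[_ ?] := midcount01 k (k q) t; have /andP[? _] := midcount01 k (k p) t.
  apply/andP; split; last lra.
  rewrite subr_ge0 /midcount ler_pM2r ?invr_gt0//; apply: lerD; rewrite ler_nat.
    by case: ltnP => // h; rewrite (ltn_trans h pq).
  by case: (leqP (k t) (k p)) => // h; rewrite (leq_trans h (ltnW pq)).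
apply: lt_le_trans (atom_le_mean mu p h); rewrite mulr_gt0//.
by rewrite /midcount pq (ltnW pq) ltnn leqnn /=; lra.
Qed.

Lemma spearman_limit (mun : nat -> probability (nat * nat)%type R) mu p q :
  (forall q, atom (mun n) q @[n --> \oo] --> atom mu q) ->
  0 < atom mu p -> 0 < atom mu q -> p.1 != q.1 -> p.2 != q.2 ->
  spearman (real_law (mun n)) @[n --> \oo] --> spearman (real_law mu).
Proof.
move=> lim p0 q0 pq1 pq2.
pose r nu (g : R * R -> R) u := midrank (pushforward (real_law nu) g) (g u).
have m1 nu : measurable_fun setT (r nu fst).
  exact: measurableT_comp (measurable_midrank _ (@measurable_fst _ _ _ _)) _.
have m2 nu : measurable_fun setT (r nu snd).
  exact: measurableT_comp (measurable_midrank _ (@measurable_snd _ _ _ _)) _.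
have b1 nu u : `|r nu fst u| <= 1.
  by have /andP[? ?] := midrank01 (real_law nu) u.1 (@measurable_fst _ _ _ _); rewrite ger0_norm.
have b2 nu u : `|r nu snd u| <= 1.
  by have /andP[? ?] := midrank01 (real_law nu) u.2 (@measurable_snd _ _ _ _); rewrite ger0_norm.
have FM (F G : R * R -> R) : (forall z, `|F z| <= 1) ->
    (forall z, `|G z| <= 1) -> forall z, `|F z * G z| <= 1.
  by move=> hF hG z; rewrite normrM -[leRHS]mulr1 ler_pM.
have e1 nu s : r nu fst (real_pair R s) = \int[nu]_t midcount fst s.1 t.
  exact: midrank_pushforward.
have e2 nu s : r nu snd (real_pair R s) = \int[nu]_t midcount snd s.2 t.
  exact: midrank_pushforward.
(* The midranks are those of [mun n], so they have to converge at each point before their means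
   can. *)
have c1 s : r (mun n) fst (real_pair R s) @[n --> \oo] --> r mu fst (real_pair R s).
  rewrite e1; under eq_fun do rewrite e1.
  apply: (mean_limit lim (M := 1)) => [t|n t]; first exact: cvg_cst.
  exact: norm_midcount.
have c2 s : r (mun n) snd (real_pair R s) @[n --> \oo] --> r mu snd (real_pair R s).
  rewrite e2; under eq_fun do rewrite e2.
  apply: (mean_limit lim (M := 1)) => [t|n t]; first exact: cvg_cst.
  exact: norm_midcount.
have cv (F : probability (nat * nat)%type R -> R * R -> R) :
    (forall nu, measurable_fun setT (F nu)) -> (forall nu u, `|F nu u| <= 1) ->
    (forall s, F (mun n) (real_pair R s) @[n --> \oo] --> F mu (real_pair R s)) ->
    \int[real_law (mun n)]_u F (mun n) u @[n --> \oo] --> \int[real_law mu]_u F mu u.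
  move=> mF hF cF; rewrite (real_law_mean mu (mF mu) (hF mu)).
  under eq_fun do rewrite (real_law_mean _ (mF _) (hF _)).
  exact: (mean_limit lim (M := 1)).
have d k : k p != k q -> \int[mu]_t midcount k (k p) t != \int[mu]_t midcount k (k q) t.
  rewrite neq_ltn => /orP[h|h]; first by rewrite lt_eqF// midcount_mean_lt.
  by rewrite gt_eqF// midcount_mean_lt.
have sE nu : spearman (real_law nu) = correlation (real_law nu) (r nu fst) (r nu snd) by [].
rewrite sE (correlation_bounded _ (m1 _) (m2 _) (b1 _) (b2 _)).
under eq_fun do rewrite sE (correlation_bounded _ (m1 _) (m2 _) (b1 _) (b2 _)).
apply: cvg_correlation_ratio.
- apply: (cv (fun nu u => r nu fst u * r nu snd u)) => [nu|nu|s].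
  + exact: measurable_funM.
  + exact: FM.
  + exact: cvgM.
- exact: (cv (fun nu u => r nu fst u)).
- exact: (cv (fun nu u => r nu snd u)).
- apply: (cv (fun nu u => r nu fst u * r nu fst u)) => [nu|nu|s].
  + exact: measurable_funM.
  + exact: FM.
  + exact: cvgM.
- apply: (cv (fun nu u => r nu snd u * r nu snd u)) => [nu|nu|s].
  + exact: measurable_funM.
  + exact: FM.
  + exact: cvgM.
- rewrite (real_law_mean mu (measurable_funM (m1 mu) (m1 mu)) (FM _ _ (b1 mu) (b1 mu))).
  rewrite (real_law_mean mu (m1 mu) (b1 mu)).
  apply: (variance_gt0 (M := 1)) p0 q0 _ => //; rewrite !e1; exact: d.
- rewrite (real_law_mean mu (measurable_funM (m2 mu) (m2 mu)) (FM _ _ (b2 mu) (b2 mu))).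
  rewrite (real_law_mean mu (m2 mu) (b2 mu)).
  apply: (variance_gt0 (M := 1)) p0 q0 _ => //; rewrite !e2; exact: d.
Qed.

End real_laws.

(** * Two atoms of the limit law *)

Lemma convolution_atom (R : realType) (f g : probability (nat * nat)%type R) p q :
  (0 < f [set p])%E -> (0 < g [set q])%E ->
  (0 < convolution f g [set (p.1 + q.1, p.2 + q.2)%N])%E.
Proof.
move=> fp gq; apply: (@lt_le_trans _ _ ((f \x g)%E ([set p] `*` [set q]))).
  by rewrite product_measure1E ?mule_gt0//; exact: measurable_nat2.
apply: le_measure; rewrite ?inE.
- by apply: measurableX; exact: measurable_nat2.
- rewrite -[X in measurable X]setTI; apply: measurable_add_pair => //.
  exact: measurable_nat2.
- by move=> [s t] /= [-> ->].
Qed.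

Section atoms.
Variables (R : realType) (mu : R) (P : probability (nat * R)%type R).
Hypotheses (P10 : (0 < cross_moment P 1 0 < +oo)%E) (P21 : (0 < cross_moment P 2 1 < +oo)%E).

(** Equality would make the summand law a point mass at 0: almost surely a layer would have at most
    one node or strength 0, so that [(X)_2 Y = 0], against [0 < P21]. *)
Lemma size_biased_pgf0_lt : size_biased_pgf P 0 < mean_size P.
Proof.
pose g (z : nat * R) : R := z.1%:R * (1 - z.2 * (1 - 0)) ^+ (z.1 - 1).
pose h (z : nat * R) : R := z.1%:R.
pose D z := h z - g z.
have mh : measurable_fun strip h by exact: measurable_fun_natM.
have mg : measurable_fun strip g.
  by apply: (@measurable_retention_strip R 0 (fun x => x - 1)%N (fun x _ => x%:R)) => x.
have mD : measurable_fun strip D by exact: measurable_funB.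
have gh z : strip z -> 0 <= g z <= h z.
  move=> sz; have zero01 : 0 <= (0 : R) <= 1 by rewrite lexx ler01.
  have /andP[r0 r1] := retention_itv zero01 sz.
  by rewrite /g mulr_ge0 ?exprn_ge0//= ler_piMr// exprn_ile1.
have Dh z : strip z -> 0 <= D z <= h z by move=> /gh/andP[g0 g1]; rewrite /D; lra.
have hoo : (\int[P]_(z in strip) (h z)%:E < +oo)%E.
  by rewrite -cross_moment10; case/andP: P10.
have gE := strip_integral_fin mg mh gh hoo.
have DE := strip_integral_fin mD mh Dh hoo.
have hE : (\int[P]_(z in strip) (h z)%:E = \int[P]_(z in strip) (g z)%:E +
    \int[P]_(z in strip) (D z)%:E)%E.
  rewrite -ge0_integralD//; last 4 first.
  - by move=> z /gh/andP[]; rewrite lee_fin.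
  - exact/measurable_EFinP.
  - by move=> z /Dh/andP[]; rewrite lee_fin.
  - exact/measurable_EFinP.
  by apply: eq_integral => z _; rewrite -EFinD /D addrC subrK.
have D0 : 0 <= \int[P]_(z in strip) D z.
  by apply: Rintegral_ge0 => z /Dh/andP[].
have : mean_size P = size_biased_pgf P 0 + \int[P]_(z in strip) D z.
  by rewrite /mean_size {1}/Rintegral -/h hE gE DE.
move=> ->; rewrite ltrDl lt_neqAle D0 andbT; apply/eqP => /esym D0'.
have aeD : ae_eq P strip (EFin \o D) (cst 0%E).
  apply/ae_eq_integral_abs => //; first exact/measurable_EFinP.
  transitivity (\int[P]_(z in strip) (D z)%:E)%E; last by rewrite DE D0'.
  by apply: eq_integral => z /set_mem/Dh/andP[? _]; rewrite gee0_abs// lee_fin.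
have /andP[+ _] := P21; rewrite cross_moment21 (_ : integral _ _ _ = 0%E) ?ltxx//.
rewrite -(integral0 P strip); apply: ae_eq_integral => //.
  by apply/measurable_EFinP; apply: measurable_fun_natM => // x /=; exact: measurable_funM.
apply: filterS aeD => -[x y] Dz sz; have [D1] := Dz sz; congr EFin => /=.
have /andP[/= y0 y1] := sz.
case: x {Dz sz} D1 => [|[|k]]; rewrite ?ffactn0 ?mul0r// /D /h /g /= subr0 mulr1 subSS subn0.
(* The size is now [k.+2], and [(1 - y) ^+ k.+1 = 1] forces [y = 0]. *)
move=> /eqP; rewrite -[X in X - _]mulr1 -mulrBr mulf_eq0 pnatr_eq0/= => /eqP E.
suff -> : y = 0 by rewrite mulr0.
apply/eqP; rewrite eq_le y0 andbT leNgt; apply/negP => y0'.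
have : (1 - y) ^+ k.+1 <= 1 - y by rewrite exprS ler_piMr ?exprn_ile1//; lra.
lra.
Qed.

Section atoms_of_limit.
Variables (d : measure_display) (Omega : measurableType d) (Q : probability Omega R).
Variables (Lambda : {mfun Omega >-> nat}) (H : nat -> {mfun Omega >-> nat}).
Hypotheses (mu0 : 0 < mu) (sumQ : random_sum_model mu P Q Lambda H).

Local Notation f1 := (random_sum_law Q Lambda H).

(** The mass at 0 is the generating function at 0, since [0 ^+ 0 = 1]. *)
Lemma random_sum_law0 : f1 [set 0%N] =
  (expR (- (mu * (mean_size P - size_biased_pgf P 0))))%:E.
Proof.
rewrite -(random_sum_pgf P10 mu0 sumQ) ?lexx ?ler01// ge0_integral_nat; last first.
  by move=> k; rewrite lee_fin exprn_ge0.
rewrite (@nneseriesD1 _ _ 0%N)//.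
rewrite expr0 mul1e eseries0 ?adde0// => -[|k] _ //= _.
by rewrite exprS mul0r mul0e.
Qed.

(** Otherwise all mass would sit at 0, whereas [random_sum_law0] gives less than 1 because
    [size_biased_pgf0_lt] makes its exponent negative. *)
Lemma random_sum_law_pos : exists2 h, (0 < h)%N & (0 < f1 [set h])%E.
Proof.
apply: contrapT => nh.
have h0 h : (0 < h)%N -> f1 [set h] = 0%E.
  move=> h0; apply/eqP; rewrite eq_le measure_ge0 andbT leNgt.
  by apply/negP => hp; apply: nh; exists h.
have E1 : f1 [set 0%N] = 1%E.
  rewrite -[RHS](@probability_setT _ _ _ f1) -[RHS]mul1e -integral_cst//.
  rewrite ge0_integral_nat// (@nneseriesD1 _ _ 0%N)//; last by move=> k _; rewrite mul1e.
  rewrite mul1e eseries0 ?adde0// => -[|k] _ //= _; by rewrite h0 ?mule0.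
have := etrans (esym random_sum_law0) E1 => -[] /eqP.
rewrite -expR0 (inj_eq (@expR_inj R)) oppr_eq0.
by apply/negP; rewrite mulf_neq0 ?gt_eqF// subr_gt0 size_biased_pgf0_lt.
Qed.

(** When both copies of [f1] take the same value [k], an atom of [joint_law] is shifted along the
    diagonal; [k = 0] and some [k > 0] give atoms that differ in both coordinates. *)
Lemma limit_bidegree_atoms : exists p q,
  [/\ 0 < atom (limit_bidegree P Q Lambda H) p,
      0 < atom (limit_bidegree P Q Lambda H) q, p.1 != q.1 & p.2 != q.2].
Proof.
have [[s t] st0] := exists_atom (joint_law P); rewrite atom_gt0 in st0.
have [h h0 fh] := random_sum_law_pos.
have f0 : (0 < f1 [set 0%N])%E by rewrite random_sum_law0 lte_fin expR_gt0.
have shift k : (0 < f1 [set k])%E ->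
    0 < atom (limit_bidegree P Q Lambda H) (1 + k + s, 1 + k + t)%N.
  move=> fk; rewrite atom_gt0.
  apply: (@convolution_atom _ _ _ (1 + k, 1 + k)%N (s, t)) => //.
  apply: (@convolution_atom _ _ _ (1, 1)%N (k, k)).
    by rewrite /= /dirac indicE mem_set//= lte01.
  rewrite (_ : [set _] = [set k] `*` [set k]); last first.
    by apply/seteqP; split => -[a b] /= [-> ->].
  have E : (f1 \x f1)%E ([set k] `*` [set k]) = (f1 [set k] * f1 [set k])%E.
    by rewrite product_measure1E.
  by rewrite [X in (_ < X)%E]E mule_gt0.
exists (1 + 0 + s, 1 + 0 + t)%N, (1 + h + s, 1 + h + t)%N.
by split; rewrite /= ?shift// !eqn_add2r addn0 -[X in X == _]addn0 eqn_add2l lt_eqF.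
Qed.

End atoms_of_limit.
End atoms.

Theorem theorem4 (R : realType) (mu : R) (m : nat -> nat)
    (Pn : nat -> probability (nat * R)%type R)
    (P : probability (nat * R)%type R)
    (d : nat -> measure_display) (Omega : forall n, measurableType (d n))
    (Pr : forall n, probability (Omega n) R)
    (L : forall n, 'I_(m n) -> {mfun (Omega n) >-> (nat * R * lgraph n)%type})
    (d' : measure_display) (Omega' : measurableType d')
    (Q : probability Omega' R)
    (Lambda : {mfun Omega' >-> nat}) (H : nat -> {mfun Omega' >-> nat}) :
  0 < mu ->
  m n @[n --> \oo] --> \oo ->
  (m n)%:R / n%:R @[n --> \oo] --> mu ->
  (forall n, Pn n (strip_upto n) = 1%E) ->
  P strip = 1%E ->
  weakly_converges Pn P ->
  cross_moment (Pn n) 1 0 @[n --> \oo] --> cross_moment P 1 0 ->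
  cross_moment (Pn n) 2 1 @[n --> \oo] --> cross_moment P 2 1 ->
  (0 < cross_moment P 1 0 < +oo)%E ->
  (0 < cross_moment P 2 1 < +oo)%E ->
  (forall n, layer_model (Pr n) (@L n) (Pn n)) ->
  random_sum_model mu P Q Lambda H ->
  let f2 n := real_law (model_bidegree (Pr n) (@L n)) in
  let f2_lim := real_law (limit_bidegree P Q Lambda H) in
  (kendall (f2 n) @[n --> \oo] --> kendall f2_lim) /\
  (spearman (f2 n) @[n --> \oo] --> spearman f2_lim).
Proof.
move=> mu0 _ mn Pn1 _ PnP P10n P21n P10 P21 modL sumQ f2 f2_lim.
have /andP[_ P10y] := P10; have /andP[_ P21y] := P21.
have s0 := mean_edges_gt0 P21.
have lim q : atom (model_bidegree (Pr n) (@L n)) q @[n --> \oo] -->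
    atom (limit_bidegree P Q Lambda H) q.
  apply: pgf_atom_limit => a b a01 b01; rewrite (limit_bidegree_pgf P10 P21 mu0 sumQ)//.
  exact: model_bidegree_pgf_limit.
have [p [q [p0 q0 pq1 pq2]]] := limit_bidegree_atoms P10 P21 mu0 sumQ.
by split; [exact: kendall_limit lim p0 q0 pq1 pq2|exact: spearman_limit lim p0 q0 pq1 pq2].
Qed.
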